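(* Let $\gamma,\gamma':[0,L]\to\mathbb{H}_{2d+1}$ be non-characteristic $C^2$ curves, parametrized with unit Riemannian speed. Denote with $\Gamma,\Gamma'\subset\mathbb{H}_{2d+1}$ the corresponding embedded submanifolds. Assume that $\theta_\Gamma(\gamma_t)=\theta_{\Gamma'}(\gamma'_t)$ for all $t\in[0,L]$. Then there exists $\epsilon>0$ such that $$\mu(T_\Gamma(r))=\mu(T_{\Gamma'}(r)),\qquad\forall\,r\in[0,\epsilon),$$ where $\mu$ denotes the Lebesgue measure of $\mathbb{H}_{2d+1}$.
   Context: Heisenberg group $\mathbb{H}_{2d+1}$: $\mathbb{R}^{2d+1}=\mathbb{R}^d\times\mathbb{R}^d\times\mathbb{R}$ with group law $(x,y,z)\star(x',y',z')=(x+x',y+y',z+z'+\frac12(x\cdot y'-x'\cdot y))$ and the left-invariant sub-Riemannian structure with distribution $\mathcal{D}$ spanned by the orthonormal vector fields $X_i=\partial_{x_i}-\frac{y_i}{2}\partial_z$, $X_{d+i}=\partial_{y_i}+\frac{x_i}{2}\partial_z$, $i=1,\dots,d$. The Reeb vector field is $X_0=\partial_z$. The canonical Riemannian extension $g_R$ is the Riemannian metric for which $X_0,X_1,\dots,X_{2d}$ are orthonormal; ''unit Riemannian speed'' is with respect to $g_R$. Curves: $\gamma$ and $\gamma'$ are embedded, with $\Gamma=\gamma([0,L])$, $\Gamma'=\gamma'([0,L])$. An embedded submanifold $S$ is non-characteristic if $\mathcal{D}_q+T_qS=T_q\mathbb{H}_{2d+1}$ for all $q\in S$ (for a curve: $\dot\gamma_t\notin\mathcal{D}_{\gamma_t}$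 for all $t$). Reeb angle: for $q\in S$, $\theta_S(q)=\sup_{W\in T_qS,\,W\neq0}\dfrac{g_R(W,X_0)}{\|W\|_{g_R}}$. Tubes: $H(\lambda)=\frac12\sum_{i=1}^{2d}\langle\lambda,X_i\rangle^2$ on $T^*\mathbb{H}_{2d+1}$, $e^{t\vec H}$ is its Hamiltonian flow (canonical symplectic structure), $\pi$ the projection of the cotangent bundle; $A\Gamma=\{\lambda\mid\pi(\lambda)\in\Gamma,\ \langle\lambda,T_{\pi(\lambda)}\Gamma\rangle=0\}$; $E(\lambda)=\pi\circ e^{\vec H}(\lambda)$; $T_\Gamma(r)=E(\{\lambda\in A\Gamma\mid\sqrt{2H(\lambda)}<r\})$, for $r>0$ small (smaller than the injectivity radius of $\Gamma$), and volume $0$ for $r=0$. *)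

(* Defs.v *)
From HB Require Import structures.
From mathcomp Require Import all_boot all_order all_algebra.
From mathcomp Require Import ring.
From mathcomp Require Import all_classical all_reals all_analysis.

Set Implicit Arguments.
Unset Strict Implicit.
Unset Printing Implicit Defensive.
Import Order.TTheory GRing.Theory Num.Theory.
Import numFieldNormedType.Exports.
Local Open Scope classical_set_scope.
Local Open Scope ring_scope.

(* Points (x, y, z) of R^d * R^d * R.  All tangent and cotangent spaces are
   identified with the same vector space through the global coordinates. *)
Notation heis R d := ('rV[R]_d * 'rV[R]_d * R^o)%type.

(* T^* H = H * (R^{2d+1})^*, elements are (base point, covector). *)
Notation cotangent R d := (heis R d * heis R d)%type.

Section heisenberg.
Context {R : realType} {d : nat}.
Implicit Types (q W p : heis R d) (u v : 'rV[R]_d).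

Definition dot u v : R := \sum_i u 0 i * v 0 i.

Definition hmul q q' : heis R d :=
  (q.1.1 + q'.1.1, q.1.2 + q'.1.2,
   q.2 + q'.2 + 2^-1 * (dot q.1.1 q'.1.2 - dot q'.1.1 q.1.2)).

(* inl i is X_{i+1}, inr i is X_{d+i+1}. *)
Definition hframe (k : 'I_d + 'I_d) q : heis R d :=
  match k with
  | inl i => (delta_mx 0 i, 0, - (q.1.2 0 i / 2))
  | inr i => (0, delta_mx 0 i, q.1.1 0 i / 2)
  end.

Definition reeb q : heis R d := (0, 0, 1).

Definition distribution q : set (heis R d) :=
  [set W | exists c : 'I_d + 'I_d -> R, W = \sum_k c k *: hframe k q].

(* The X_0-coefficient of W in the frame X_0, ..., X_{2d} at q; the
   coefficients along X_1, ..., X_{2d} are the entries of W.1.1 and W.1.2,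
   cf. gR_hframe and the lemmas after it. *)
Definition vertical q W : R :=
  W.2 - 2^-1 * (dot q.1.1 W.1.2 - dot W.1.1 q.1.2).

Definition gR q W W' : R :=
  dot W.1.1 W'.1.1 + dot W.1.2 W'.1.2 + vertical q W * vertical q W'.

Definition normR q W : R := Num.sqrt (gR q W W).

Definition pairing p W : R := dot p.1.1 W.1.1 + dot p.1.2 W.1.2 + p.2 * W.2.

Definition hamiltonian (l : cotangent R d) : R :=
  2^-1 * \sum_k (pairing l.2 (hframe k l.1)) ^+ 2.

(* The canonical symplectic form sum_i dp_i /\ dq_i. *)
Definition symplectic (xi eta : cotangent R d) : R :=
  pairing xi.2 eta.1 - pairing eta.2 xi.1.

(* c is an integral curve of the field \vec h with
   symplectic(. , \vec h) = dh. *)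
Definition ham_curve (h : cotangent R d -> R) (c : R -> cotangent R d) :=
  forall t, derivable c t 1 /\
    forall xi, symplectic xi ('D_1 c t) = 'D_xi (h : _ -> R^o) (c t).

Definition ham_flow (h : cotangent R d -> R) (t : R) (l : cotangent R d) :=
  get [set m | exists c, [/\ ham_curve h c, c 0 = l & c t = m]].

Definition sr_exp (l : cotangent R d) : heis R d := (ham_flow hamiltonian 1 l).1.

(* In the next definitions a submanifold is given by its set of points S
   and its tangent spaces T q. *)

Definition non_characteristic (S : set (heis R d)) (T : heis R d -> set (heis R d)) :=
  forall q, S q ->
    [set U + V | U in distribution q & V in T q] = [set: heis R d].

Definition reeb_angle (T : heis R d -> set (heis R d)) q : R :=
  sup [set gR q W (reeb q) / normR q W | W in [set W | T q W /\ W <> 0]].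

Definition annihilator (S : set (heis R d)) (T : heis R d -> set (heis R d)) :
    set (cotangent R d) :=
  [set l | S l.1 /\ forall W, T l.1 W -> pairing l.2 W = 0].

Definition tube (S : set (heis R d)) (T : heis R d -> set (heis R d)) (r : R) :
    set (heis R d) :=
  sr_exp @` [set l | annihilator S T l /\ Num.sqrt (2 * hamiltonian l) < r].

Lemma dot_deltal (i : 'I_d) u : dot (delta_mx 0 i) u = u 0 i.
Proof.
rewrite /dot (bigD1 i)//= !mxE !eqxx mul1r big1 ?addr0// => j /negbTE ji.
by rewrite !mxE ji andbF mul0r.
Qed.

Lemma dotC u v : dot u v = dot v u.
Proof. by apply: eq_bigr => i _; rewrite mulrC. Qed.

Lemma dot0l u : dot 0 u = 0.
Proof. by rewrite /dot big1// => i _; rewrite mxE mul0r. Qed.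

Lemma dotDl u v w : dot (u + v) w = dot u w + dot v w.
Proof. by rewrite -big_split; apply: eq_bigr => i _; rewrite mxE mulrDl. Qed.

Lemma dotZl a u v : dot (a *: u) v = a * dot u v.
Proof. by rewrite /dot mulr_sumr; apply: eq_bigr => i _; rewrite mxE mulrA. Qed.

Lemma vertical_hframe k q : vertical q (hframe k q) = 0.
Proof.
case: k => i; rewrite /vertical/= ?[dot _ (delta_mx _ _)]dotC !dot_deltal.
  by rewrite [dot _ 0]dotC !dot0l; ring.
by rewrite dot0l; ring.
Qed.

Lemma vertical_reeb q : vertical q (reeb q) = 1.
Proof. by rewrite /vertical/= [dot _ 0]dotC !dot0l subrr mulr0 subr0. Qed.

(* X_0, X_1, ..., X_{2d} are orthonormal for gR. *)
Lemma gR_hframe k l q : gR q (hframe k q) (hframe l q) = (k == l)%:R.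
Proof.
rewrite /gR !vertical_hframe mulr0 addr0.
by case: k l => i [] j /=; rewrite ?dot_deltal ?dot0l ?mxE ?add0r ?addr0 ?eqxx.
Qed.

Lemma gR_hframe_reeb k q : gR q (hframe k q) (reeb q) = 0.
Proof.
by rewrite /gR vertical_hframe mul0r/= ![dot _ 0]dotC !dot0l !addr0.
Qed.

Lemma gR_reeb q : gR q (reeb q) (reeb q) = 1.
Proof. by rewrite /gR vertical_reeb/= !dot0l mulr1 !add0r. Qed.

Lemma hframe_left_invariant k q q' (s : R) :
  hmul q (q' + s *: hframe k q') = hmul q q' + s *: hframe k (hmul q q').
Proof.
case: q q' => [[x y] z] [[x' y'] z']; rewrite /hmul/= !dotDl.
rewrite [dot x (_ + _)]dotC dotDl !dotZl; congr (_, _, _).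
- by case: k => i /=; rewrite addrA.
- by case: k => i /=; rewrite addrA.
- have scE (a b : R) : a *: (b : R^o) = a * b by [].
  by case: k => i /=; rewrite !scE ?dot_deltal ?dot0l ?mxE [dot y' x]dotC; field.
Qed.

End heisenberg.

Section curves.
Context {R : realType} {V : normedModType R}.
Implicit Types (I : set R) (f : R -> V).

(* Derivative relative to I, one-sided at the end points of an interval. *)
Definition diff_quotient f (t : R) := fun s : R => (s - t)^-1 *: (f s - f t).

Definition derivable_on I f :=
  forall t, I t -> cvg (diff_quotient f t s @[s --> within I (t^')]).

Definition deriv_on I f (t : R) : V :=
  lim (diff_quotient f t s @[s --> within I (t^')]).

Definition C2_on I f :=
  [/\ derivable_on I f, derivable_on I (deriv_on I f) &
      {within I, continuous (deriv_on I (deriv_on I f))}].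

(* Injective immersion with continuous inverse on its image. *)
Definition embedded_on I f :=
  [/\ {in I &, injective f},
      (forall t, I t -> deriv_on I f t <> 0) &
      forall t (A : set R), I t -> nbhs t A ->
        \forall q \near f t, forall s, I s -> f s = q -> A s].

Definition curve_tangent I f (q : V) : set V :=
  [set W | exists t, [/\ I t, f t = q & exists c : R, W = c *: deriv_on I f t]].

End curves.

Section lebesgue_tuple.
Context {R : realType}.
Local Notation mR := (measurableTypeR R).
Local Open Scope ereal_scope.

Definition tuple_cons n (x : mR * n.-tuple mR) : n.+1.-tuple mR :=
  [tuple of x.1 :: x.2].

Lemma measurable_tuple_cons n : measurable_fun setT (@tuple_cons n).
Proof. exact: measurable_cons. Qed.

Section step.
Context (n : nat) (mu : {sigma_finite_measure set (n.-tuple mR) -> \bar R}).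

Definition lebesgue_cons : set (n.+1.-tuple mR) -> \bar R :=
  pushforward (@lebesgue_measure R \x mu) (@tuple_cons n).

Let lebesgue_cons0 : lebesgue_cons set0 = 0.
Proof. by rewrite /lebesgue_cons /pushforward preimage_set0 measure0. Qed.

Let lebesgue_cons_ge0 A : 0 <= lebesgue_cons A.
Proof. by rewrite /lebesgue_cons /pushforward; exact: measure_ge0. Qed.

Let lebesgue_cons_sigma_additive : semi_sigma_additive lebesgue_cons.
Proof.
move=> F mF tF mUF; rewrite /lebesgue_cons /pushforward preimage_bigcup.
apply: measure_semi_sigma_additive.
- by move=> i; rewrite -[X in measurable X]setTI; exact: measurable_tuple_cons.
- apply/trivIsetP => i j _ _ ij; rewrite -preimage_setI.
  by move/trivIsetP : tF => /(_ _ _ _ _ ij) ->//; rewrite preimage_set0.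
- rewrite -preimage_bigcup -[X in measurable X]setTI.
  exact: measurable_tuple_cons.
Qed.

HB.instance Definition _ := isMeasure.Build _ _ _ lebesgue_cons
  lebesgue_cons0 lebesgue_cons_ge0 lebesgue_cons_sigma_additive.

Let lebesgue_cons_sigma_finite : sigma_finite setT lebesgue_cons.
Proof.
have /sigma_finiteP[F [TF ndF Foo]] := sigma_finiteT (@lebesgue_measure R).
have /sigma_finiteP[G [TG ndG Goo]] := sigma_finiteT mu.
pose uncons (v : n.+1.-tuple mR) : mR * n.-tuple mR :=
  (thead v, [tuple of behead v]).
have consK : cancel (@tuple_cons n) uncons.
  by case=> x v; rewrite /uncons theadE; congr (_, _); exact/val_inj.
have munc : measurable_fun setT uncons.
  apply/measurable_fun_pairP; split; first exact: measurable_tnth.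
  exact: measurable_behead.
exists (fun i => uncons @^-1` (F i `*` G i)).
  apply/seteqP; split => // v _.
  have [i _ Fi] : (\bigcup_i F i) (thead v) by rewrite -TF.
  have [j _ Gj] : (\bigcup_i G i) [tuple of behead v] by rewrite -TG.
  exists (maxn i j) => //; split.
    by move: Fi; exact/subsetPset/ndF/leq_maxl.
  by move: Gj; exact/subsetPset/ndG/leq_maxr.
move=> i; have [mFi Fioo] := Foo i; have [mGi Gioo] := Goo i; split.
  by rewrite -[X in measurable X]setTI; apply: munc => //; exact: measurableX.
rewrite /lebesgue_cons /pushforward (_ : _ @^-1` _ = F i `*` G i).
  by rewrite product_measure1E// lte_mul_pinfty// ge0_fin_numE.
by apply/funext => x; rewrite -[in RHS](consK x).
Qed.

HB.instance Definition _ := Measure_isSigmaFinite.Build _ _ _ lebesgue_cons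
  lebesgue_cons_sigma_finite.

End step.

(* Lebesgue measure on R^n (Borel sets), as an iterated product measure. *)
Fixpoint lebesgue_tuple n : {sigma_finite_measure set (n.-tuple mR) -> \bar R} :=
  match n with
  | 0 => \d_[tuple]
  | m.+1 => lebesgue_cons (lebesgue_tuple m)
  end.

End lebesgue_tuple.

(* Coordinates in the order x_1, ..., x_d, y_1, ..., y_d, z. *)
Definition heis_of_tuple (R : realType) d (v : (d + d + 1).-tuple R) : heis R d :=
  (\row_i tnth v (lshift 1 (lshift d i)), \row_i tnth v (lshift 1 (rshift d i)),
   tnth v (rshift (d + d) ord0)).

Definition volume (R : realType) d (A : set (heis R d)) : \bar R :=
  lebesgue_tuple (d + d + 1) (@heis_of_tuple R d @^-1` A).

(* Main.v *)
(* Identify H_{2d+1} with C^d x R.  Write the curve as t |-> (w, z), with vertical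
   velocity v and horizontal velocity - v k.  A covector over a point of the curve
   annihilates the tangent line when its vertical momentum is the product of k with
   its horizontal momentum h, and then its length is |h|.  Explicit integration of
   the geodesics shows that the endpoints issued from the time t with |h| < r form
   a graph z = phi t W over the set of W with len2 (k t) (W - w t) < r ^+ 2.  For
   small r these graphs are disjoint and d phi / dt has a constant sign, so, by the
   change of variables z = phi t W in the last coordinate, the volume of the tube is
   the integral over t of the integral over x = W - w t of |d phi / dt|.

   At fixed x, d phi / dt = v * pden k x + kden k k' x.  The second term is the
   variation of the height of the slice with k; after truncation to the slice it is
   the derivative in t of a function whose integral over x does not depend on k, so
   it does not contribute.  The integral of pden k depends only on |k|, because
   Lebesgue measure is invariant under unitary maps.  Unit speed gives
   v ^+ 2 * (1 + |k| ^+ 2) = 1, and |v| is the Reeb angle, so the volume is a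
   function of the Reeb angle alone. *)
From HB Require Import structures.
Require Import Defs.
From mathcomp Require Import all_boot all_order all_algebra.
From mathcomp Require Import ring lra.
From mathcomp Require Import all_classical all_reals all_analysis measurable_realfun.
Import Order.TTheory GRing.Theory Num.Theory.
Import numFieldNormedType.Exports.
Local Open Scope classical_set_scope.
Local Open Scope ring_scope.
Set Implicit Arguments.
Unset Strict Implicit.
Unset Printing Implicit Defensive.

(** * Iterated Lebesgue measures and coordinate maps *)

(** No Jacobian of the endpoint map is ever computed. Once each slice is a graph, only the last
    coordinate changes variables, and the rest is Tonelli and a translation. The graph form is
    available because the momentum can be read off the endpoint: if s is the product of k and h,
    multiplying h by (exp (i s) - 1) / (i s) makes tan (s / 2) the rational function [tau] of the
    displacement. The term with k' has no pointwise sign, and k' is arbitrary. What saves it is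
    parity: the length condition and the derivative of the height profile depend on [tau] through
    even functions only. Hence a primitive of the truncated profile has values at tau and - tau
    whose sum is free of k, and the reflection along k exchanges these values. As the truncation
    jumps, the primitive is compared only at the two ends of [0, L], through an integrated chain
    rule. The C^2 hypothesis enters because k is a quotient of first derivatives and phi has to be
    C^1 in t. *)

Section tuple_measure.
Context {R : realType}.
Local Notation mR := (measurableTypeR R).
Local Notation mu n := (@lebesgue_tuple R n).
Local Notation lam := (@lebesgue_measure R).
Local Open Scope ereal_scope.

Lemma lebesgue_tupleS n A : mu n.+1 A = (lam \x mu n) (@tuple_cons R n @^-1` A).
Proof. by []. Qed.

Lemma measurable_preimage d1 d2 (T1 : measurableType d1) (T2 : measurableType d2)
    (f : T1 -> T2) A :
  measurable_fun setT f -> measurable A -> measurable (f @^-1` A).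
Proof. by move=> mf mA; rewrite -[X in measurable X]setTI; exact: mf. Qed.

Lemma ge0_integral_tupleS n (f : n.+1.-tuple mR -> \bar R) :
  measurable_fun setT f -> (forall v, 0 <= f v) ->
  \int[mu n.+1]_v f v = \int[lam]_x \int[mu n]_v f (tuple_cons (x, v)).
Proof.
move=> mf f0.
transitivity (\int[lam \x mu n]_y f (tuple_cons y)).
  rewrite -[LHS]/(\int[pushforward (lam \x mu n) (@tuple_cons R n)]_v f v).
  by rewrite (ge0_integral_pushforward (@measurable_tuple_cons R n)).
rewrite -(fubini_tonelli1 (f \o @tuple_cons R n))//.
  exact: measurableT_comp (@measurable_tuple_cons R n).
by move=> x; exact: f0.
Qed.

Lemma lebesgue_tuple_integralS n A : measurable A ->
  mu n.+1 A = \int[lam]_x mu n [set v | A (tuple_cons (x, v))].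
Proof.
move=> mA; rewrite lebesgue_tupleS /product_measure1/=.
apply: eq_integral => x _ /=; congr (mu n _).
by apply/seteqP; split => v /=; rewrite /xsection/= inE.
Qed.

(** Slices with the first coordinate as inner variable are allowed because both iterated integrals
    agree on rectangles, which determines a sigma-finite product measure. *)
Lemma lebesgue_tuple_integralS2 n A : measurable A ->
  mu n.+1 A = \int[mu n]_v lam [set x | A (tuple_cons (x, v))].
Proof.
move=> mA; rewrite lebesgue_tupleS.
have mB := measurable_preimage (@measurable_tuple_cons R n) mA.
have -> : (lam \x mu n) (@tuple_cons R n @^-1` A) =
    (lam \x^ mu n) (@tuple_cons R n @^-1` A).
  apply: product_measure_unique => // B C hB hC.
  by rewrite /= product_measure2E.
rewrite /product_measure2/=.
apply: eq_integral => v _ /=; congr (lam _).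
by apply/seteqP; split => x /=; rewrite /ysection/= inE.
Qed.

Definition tuple_snoc n (v : n.-tuple mR) (z : mR) : (n + 1).-tuple mR :=
  [tuple of v ++ [:: z]].

Lemma tnth_snoc_l n (v : n.-tuple mR) z i :
  tnth (tuple_snoc v z) (lshift 1 i) = tnth v i.
Proof. by rewrite tnth_lshift. Qed.

Lemma tnth_snoc_r n (v : n.-tuple mR) z :
  tnth (tuple_snoc v z) (rshift n ord0) = z.
Proof. by rewrite tnth_rshift. Qed.

Lemma measurable_tuple_snoc n :
  measurable_fun setT (fun x : n.-tuple mR * mR => tuple_snoc x.1 x.2).
Proof.
apply/measurable_fun_tnthP => i.
case: (split_ordP i) => j ->.
  rewrite (_ : _ \o _ = (fun x : n.-tuple mR * mR => tnth x.1 j)); last first.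
    by apply/funext => x /=; rewrite tnth_snoc_l.
  apply: (measurableT_comp (@measurable_tnth _ mR n j)).
  exact: measurable_fst.
rewrite (_ : _ \o _ = snd); first exact: measurable_snd.
by apply/funext => x /=; rewrite (ord1 j) tnth_snoc_r.
Qed.

Lemma measurable_fun_lebesgue_snoc n (A : set ((n + 1).-tuple mR)) : measurable A ->
  measurable_fun setT (fun v : n.-tuple mR => lam [set z | A (tuple_snoc v z)]).
Proof.
move=> mA.
have := measurable_fun_xsection lam (measurable_preimage (@measurable_tuple_snoc n) mA).
apply: eq_measurable_fun => v _ /=; congr (lam _).
by apply/seteqP; split => z /=; rewrite /xsection/= inE.
Qed.

(** The measure is built by adding coordinates at the front, whereas the tube is a graph over the
    others in its last coordinate z. Induction peels the front coordinate off both sides until z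
    alone is left. *)
Lemma lebesgue_tuple_snoc n (A : set ((n + 1).-tuple mR)) : measurable A ->
  mu (n + 1) A = \int[mu n]_v lam [set z | A (tuple_snoc v z)].
Proof.
elim: n A => [|n IH] A mA.
  rewrite lebesgue_tuple_integralS2//=; apply: eq_integral => v _.
  congr (lam _); apply/seteqP; split => z /=.
    by rewrite (tuple0 v); congr A; apply/val_inj.
  by rewrite (tuple0 v); congr A; apply/val_inj.
rewrite (@lebesgue_tuple_integralS (n + 1))//.
rewrite ge0_integral_tupleS//; last first.
  exact: measurable_fun_lebesgue_snoc.
apply: eq_integral => x _; rewrite IH//; last first.
  apply: (@measurable_preimage _ _ _ _ (fun v => tuple_cons (x, v))) => //.
  by apply: (measurableT_comp (@measurable_tuple_cons R (n + 1))).
apply: eq_integral => v _; congr (lam _).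
by apply/seteqP; split => z /=; (congr A; apply/val_inj).
Qed.

End tuple_measure.

(** * Coordinate changes that preserve Lebesgue measure *)

Section coordinate_maps.
Context {R : realType}.
Local Notation mR := (measurableTypeR R).
Local Notation mu n := (@lebesgue_tuple R n).
Local Notation lam := (@lebesgue_measure R).

Lemma measurable_tnth_fun n (i : 'I_n) :
  measurable_fun setT (fun v : n.-tuple mR => tnth v i : mR).
Proof. exact: measurable_tnth. Qed.

(** Lebesgue measure is determined by half-open intervals. For s = -1 their preimages are closed at
    the other end, which does not change the length. *)
Lemma lebesgue_measure_isom (s c : R) (A : set mR) : `|s| = 1 -> measurable A ->
  lam [set x | A (s * x + c)] = lam A.
Proof.
move=> s1 mA.
pose f (x : mR) : mR := s * x + c.
have mf : measurable_fun setT f.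
  by apply: measurable_funD => //; apply: measurable_funM.
apply/esym.
pose M : {measure set mR -> \bar R} := measure_function_pushforward__canonical__measure_function_Measure lam mf.
suff H : forall X, ocitv X -> lam X = M X by exact: (lebesgue_measure_unique H mA).
move=> X [[a b] /= _ <-]; rewrite /M/= /pushforward.
have [sE|sE] : s = 1 \/ s = -1.
- by case: (ger0P s) s1 => _ <-; [left|right; rewrite opprK].
- rewrite (_ : _ @^-1` _ = `]a - c, b - c]%classic).
    rewrite !lebesgue_measure_itv/= !lte_fin ltrD2r; case: ifPn => // _.
    by rewrite -!EFinB; congr (_%:E); ring.
  by apply/seteqP; split => x /=; rewrite /f !in_itv/= sE mul1r => /andP[? ?]; apply/andP; split; lra.
- rewrite (_ : _ @^-1` _ = `[c - b, c - a[%classic).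
    rewrite !lebesgue_measure_itv/= !lte_fin ltrD2l ltrN2; case: ifPn => // _.
    by rewrite -!EFinB; congr (_%:E); ring.
  by apply/seteqP; split => x /=; rewrite /f !in_itv/= sE mulN1r => /andP[? ?]; apply/andP; split; lra.
Qed.

(** One form for three uses: shears (s = 1), translations (constant phi) and reflections (s = -1,
    phi = 0). *)
Definition coord_map n (i : 'I_n) (s : R) (phi : n.-tuple mR -> mR) (v : n.-tuple mR)
    : n.-tuple mR :=
  [tuple (if j == i then s * tnth v j + phi v else tnth v j) | j < n].

Definition indep_of n (i : 'I_n) (phi : n.-tuple mR -> mR) :=
  forall v v', (forall j, j != i -> tnth v j = tnth v' j) -> phi v = phi v'.

Lemma measurable_coord_map n (i : 'I_n) s phi : measurable_fun setT phi ->
  measurable_fun setT (coord_map i s phi).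
Proof.
move=> mphi; apply/measurable_fun_tnthP => j.
rewrite (_ : _ \o _ = if j == i then (fun v => s * tnth v j + phi v)
                                else (fun v => tnth v j)); last first.
  by apply/funext => v; rewrite /= tnth_mktuple; case: ifP.
case: ifP => _; last exact: measurable_tnth_fun.
apply: measurable_funD => //; apply: measurable_funM => //.
exact: measurable_tnth_fun.
Qed.

(** With the other coordinates frozen, the map is an isometry of the line in coordinate i, so it
    suffices to integrate in that coordinate first. The induction brings i to the front. *)
Lemma lebesgue_tuple_coord_map n (i : 'I_n) s phi A : `|s| = 1 ->
  measurable_fun setT phi -> indep_of i phi -> measurable A ->
  mu n (coord_map i s phi @^-1` A) = mu n A.
Proof.
move=> s1; elim: n i phi A => [[] //|n IH] i phi A mphi iphi mA.
have mcons x : measurable_fun setT (fun v => @tuple_cons R n (x, v)).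
  exact: (measurableT_comp (@measurable_tuple_cons R n)).
have mcons2 v : measurable_fun setT (fun x => @tuple_cons R n (x, v)).
  exact: (measurableT_comp (@measurable_tuple_cons R n)).
have mC : measurable (coord_map i s phi @^-1` A).
  by apply: measurable_preimage => //; exact: measurable_coord_map.
case: (unliftP ord0 i) => [j|] ij; last first.
  rewrite !lebesgue_tuple_integralS2//; apply: eq_integral => v _.
  (* The value 0 is a placeholder for the front coordinate, on which phi does not depend. *)
  rewrite -[RHS](@lebesgue_measure_isom s (phi (tuple_cons (0, v))) [set x | _])//; last first.
    exact: (measurable_preimage (mcons2 v)).
  congr (lam _); apply/funext => x /=; congr A; apply/eq_from_tnth => j.
  rewrite tnth_mktuple ij; case: (unliftP ord0 j) => [k ->|->].
    by rewrite eq_sym (negbTE (neq_lift _ _)) !tnthS.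
  rewrite eqxx !tnth0 /=; congr (_ + _); apply: iphi => k; rewrite ij.
  by case: (unliftP ord0 k) => [l ->|->]; rewrite ?eqxx// !tnthS.
rewrite !lebesgue_tuple_integralS//; apply: eq_integral => x _.
pose psi v := phi (tuple_cons (x, v)).
rewrite -[RHS](IH j psi [set v | A (tuple_cons (x, v))]); first last.
- exact: (measurable_preimage (mcons x)).
- move=> v v' vv'; apply: iphi => k; rewrite ij.
  case: (unliftP ord0 k) => [l ->|->]; last by rewrite !tnth0.
  by rewrite (inj_eq lift_inj) !tnthS => /vv'.
- exact: measurableT_comp mphi (mcons x).
congr (mu n _); apply/funext => v /=; congr A; apply/eq_from_tnth => k.
rewrite tnth_mktuple ij; case: (unliftP ord0 k) => [l ->|->].
  by rewrite (inj_eq lift_inj) !tnthS tnth_mktuple.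
by rewrite (negbTE (neq_lift _ _)) !tnth0.
Qed.

Definition lebesgue_preserving n (f : n.-tuple mR -> n.-tuple mR) :=
  measurable_fun setT f /\ forall A, measurable A -> mu n (f @^-1` A) = mu n A.

Lemma lebesgue_preserving_id n : lebesgue_preserving (@id (n.-tuple mR)).
Proof. by split => //; exact: measurable_id. Qed.

Lemma lebesgue_preserving_comp n (f g : n.-tuple mR -> n.-tuple mR) :
  lebesgue_preserving f -> lebesgue_preserving g -> lebesgue_preserving (g \o f).
Proof.
move=> [mf pf] [mg pg]; split; first exact: measurableT_comp.
move=> A mA; rewrite comp_preimage pf ?pg//; exact: measurable_preimage.
Qed.

Lemma lebesgue_preserving_coord_map n (i : 'I_n) s phi : `|s| = 1 ->
  measurable_fun setT phi -> indep_of i phi ->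
  lebesgue_preserving (coord_map i s phi).
Proof.
move=> s1 mphi iphi; split; first exact: measurable_coord_map.
by move=> A; exact: lebesgue_tuple_coord_map.
Qed.

Lemma ge0_integral_preserving n (f : n.-tuple mR -> n.-tuple mR) g :
  lebesgue_preserving f -> measurable_fun setT g -> (forall v, 0 <= g v)%E ->
  (\int[mu n]_v g (f v) = \int[mu n]_v g v)%E.
Proof.
move=> [mf pf] mg g0.
transitivity (\int[pushforward (mu n) f]_v g v)%E.
  by rewrite (ge0_integral_pushforward mf).
apply: eq_measure_integral => A mA _; exact: pf.
Qed.

Lemma integral_preserving n (f : n.-tuple mR -> n.-tuple mR) (g : n.-tuple mR -> \bar R) :
  lebesgue_preserving f -> measurable_fun setT g ->
  (\int[mu n]_v g (f v) = \int[mu n]_v g v)%E.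
Proof.
move=> pf mg; rewrite integralE [RHS]integralE.
congr (_ - _)%E.
  rewrite -[RHS](ge0_integral_preserving pf (measurable_funepos mg) (funepos_ge0 g)).
  by apply: eq_integral => v _; rewrite !funeposE.
rewrite -[RHS](ge0_integral_preserving pf (measurable_funeneg mg) (funeneg_ge0 g)).
by apply: eq_integral => v _; rewrite !funenegE.
Qed.

(** A translation is a composition of translations of single coordinates; [T k] translates the first
    k of them. *)
Lemma lebesgue_preserving_translation n (w : 'I_n -> R) :
  lebesgue_preserving (fun v : n.-tuple mR => [tuple (tnth v i - w i : mR) | i < n]).
Proof.
pose T k (v : n.-tuple mR) : n.-tuple mR :=
  [tuple (if (i < k)%N then tnth v i - w i else tnth v i) | i < n].
suff H k : (k <= n)%N -> lebesgue_preserving (T k).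
  have -> : (fun v : n.-tuple mR => [tuple (tnth v i - w i : mR) | i < n]) = T n.
    apply/funext => v; apply/eq_from_tnth => i.
    by rewrite !tnth_mktuple ltn_ord.
  exact: H.
elim: k => [|k IH] kn.
  rewrite (_ : T 0%N = id); first exact: lebesgue_preserving_id.
  by apply/funext => v; apply/eq_from_tnth => i; rewrite tnth_mktuple.
rewrite (_ : T k.+1 = T k \o coord_map (Ordinal kn) 1 (fun=> - w (Ordinal kn))).
  apply: lebesgue_preserving_comp; last exact/IH/ltnW.
  by apply: lebesgue_preserving_coord_map; rewrite ?normr1.
apply/funext => v; apply/eq_from_tnth => i; rewrite /= !tnth_mktuple mul1r.
rewrite -val_eqE/= ltnS leq_eqVlt; have [ik|ik] := eqVneq; last by [].
have -> : Ordinal kn = i by exact/val_inj/esym.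
by rewrite /= ik ltnn addrC.
Qed.

Lemma lebesgue_tuple_box n r :
  (mu n [set v | forall i, (`|tnth v i| <= r)%R] < +oo)%E.
Proof.
elim: n => [|n IH]; first by rewrite /= diracE; case: (_ \in _); rewrite ltry.
rewrite lebesgue_tupleS (_ : _ @^-1` _ =
    `[-r, r]%classic `*` [set v | forall i, `|tnth v i| <= r]); last first.
  apply/seteqP; split => [[x v] /= H|[x v] /= [x1 v1] i].
    split; first by have := H ord0; rewrite tnth0 in_itv/= -ler_norml.
    by move=> i; have := H (lift ord0 i); rewrite tnthS.
  case: (unliftP ord0 i) => [j ->|->]; first by rewrite tnthS.
  by rewrite tnth0 ler_norml; move: x1; rewrite in_itv.
rewrite product_measure1E//.
  apply: lte_mul_pinfty; [by []| |exact: IH].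
  change (lam `[- r, r]%classic \is a fin_num).
  by rewrite lebesgue_measure_itv/=; case: ifP.
rewrite (_ : mkset _ = \bigcap_(i in [set: 'I_n]) [set v : n.-tuple mR | `|tnth v i| <= r]).
  apply: fin_bigcap_measurable => // i _; rewrite (_ : mkset _ = (fun v => tnth v i : mR) @^-1` `[-r, r]%classic).
    apply: measurable_preimage => //; exact: measurable_tnth_fun.
  by apply/seteqP; split => v /=; rewrite in_itv/= ler_norml.
by apply/seteqP; split => [v H i _|v H i] /=; [exact: H|exact: (H i)].
Qed.

End coordinate_maps.

(** * Height and length profiles of normal geodesics *)

Section profile.
Context {R : realType}.
Implicit Types x : R.

Lemma near_neq (a x : R) : x != a -> \forall y \near x, y != a.
Proof. by move=> xa; apply: open_nbhs_nbhs; split; [exact: open_neq|]. Qed.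

Lemma nondecreasing_from0 (f df : R -> R) x : 0 <= x ->
  (forall y : R, is_derive y 1 f (df y)) -> (forall y, 0 <= df y) -> f 0 <= f x.
Proof.
move=> x0 fdf df0.
have [c _ E] := @MVT_segment R f df 0 x x0 (fun y _ => fdf y)
  (derivable_within_continuous (fun y _ => @ex_derive _ _ _ _ _ _ _ (fdf y))).
by rewrite -subr_ge0 E subr0 mulr_ge0.
Qed.

(** Together with [atan_upper], this squeezes (x - atan x) / x ^+ 3 to 1/3 at 0. *)
Lemma atan_lower x : 0 <= x -> x - x ^+ 3 / 3 <= atan x.
Proof.
move=> x0; rewrite -subr_ge0.
pose f (y : R) := atan y - (y - y ^+ 3 * 3^-1).
pose df (y : R) := (1 + y ^+ 2)^-1 - (1 - y ^+ 2).
have fdf (y : R) : is_derive y 1 f (df y).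
  apply: is_derive_eq; rewrite /df /GRing.scale/=; field.
  by rewrite gt_eqF// ltr_wpDr// sqr_ge0.
have /(nondecreasing_from0 x0 fdf) : forall y, 0 <= df y.
  move=> y; rewrite /df (_ : _ - _ = y ^+ 4 / (1 + y ^+ 2)); last first.
    by field; rewrite gt_eqF// ltr_wpDr// sqr_ge0.
  by apply: divr_ge0; [exact: exprn_even_ge0|rewrite addr_ge0// sqr_ge0].
by rewrite /f atan0 expr0n/= mul0r !subr0.
Qed.

Lemma atan_upper x : 0 <= x -> atan x <= x - x ^+ 3 / 3 + x ^+ 5 / 5.
Proof.
move=> x0; rewrite -subr_ge0.
pose f (y : R) := (y - y ^+ 3 * 3^-1 + y ^+ 5 * 5^-1) - atan y.
pose df (y : R) := (1 - y ^+ 2 + y ^+ 4) - (1 + y ^+ 2)^-1.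
have fdf (y : R) : is_derive y 1 f (df y).
  apply: is_derive_eq; rewrite /df /GRing.scale/=; field.
  by rewrite gt_eqF// ltr_wpDr// sqr_ge0.
have /(nondecreasing_from0 x0 fdf) : forall y, 0 <= df y.
  move=> y; rewrite /df (_ : _ - _ = y ^+ 6 / (1 + y ^+ 2)); last first.
    by field; rewrite gt_eqF// ltr_wpDr// sqr_ge0.
  by apply: divr_ge0; [exact: exprn_even_ge0|rewrite addr_ge0// sqr_ge0].
by rewrite /f atan0 !expr0n/= !mul0r !(subr0, addr0).
Qed.

(* The value at 0 makes [atan_defect] continuous. *)
Definition atan_defect x : R := if x == 0 then 3^-1 else (x - atan x) / x ^+ 3.

Lemma atanE x : atan x = x * (1 - x ^+ 2 * atan_defect x).
Proof.
rewrite /atan_defect; case: eqVneq => [->|x0]; first by rewrite atan0 mul0r.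
by field.
Qed.

Lemma atan_defectN x : atan_defect (- x) = atan_defect x.
Proof.
rewrite /atan_defect oppr_eq0; case: eqVneq => // x0.
by rewrite atanN; field; rewrite ?oppr_eq0 x0.
Qed.

Lemma atan_defect_bounds x : 3^-1 - x ^+ 2 / 5 <= atan_defect x <= 3^-1.
Proof.
wlog x0 : x / 0 <= x.
  move=> H; have [|/ltW] := leP 0 x; first exact: H.
  by rewrite -oppr_ge0 => /H; rewrite atan_defectN sqrrN.
move: x0; rewrite le_eqVlt => /predU1P[<-|x0].
  by rewrite /atan_defect eqxx expr0n/= mul0r subr0 lexx.
rewrite /atan_defect gt_eqF//.
rewrite ler_pdivlMr ?exprn_gt0// ler_pdivrMr ?exprn_gt0//.
have := atan_lower (ltW x0); have := atan_upper (ltW x0).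
have -> : (3^-1 - x ^+ 2 / 5) * x ^+ 3 = x ^+ 3 / 3 - x ^+ 5 / 5 by field.
have -> : 3^-1 * x ^+ 3 = x ^+ 3 / 3 by field.
by move=> ? ?; apply/andP; split; lra.
Qed.

Lemma atan_defect_ge0 x : 0 <= atan_defect x.
Proof.
wlog x0 : x / 0 <= x.
  move=> H; have [|/ltW] := leP 0 x; first exact: H.
  by rewrite -oppr_ge0 => /H; rewrite atan_defectN.
rewrite /atan_defect; case: ifP => // _.
rewrite divr_ge0 ?exprn_ge0//.
pose f (y : R) := y - atan y.
pose df (y : R) := 1 - (1 + y ^+ 2)^-1.
have fdf (y : R) : is_derive y 1 f (df y).
  by apply: is_derive_eq; rewrite /df.
have /(nondecreasing_from0 x0 fdf) : forall y, 0 <= df y.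
  move=> y; rewrite /df subr_ge0 invf_le1 ?ltr_wpDr ?sqr_ge0//.
  by rewrite lerDl sqr_ge0.
by rewrite /f atan0 subr0.
Qed.

Lemma continuous_atan_defect : continuous (atan_defect : R -> R).
Proof.
move=> x; have [->|x0] := eqVneq x 0.
  rewrite /continuous_at (_ : atan_defect 0 = 3^-1); last by rewrite /atan_defect eqxx.
  apply: (@squeeze_cvgr _ _ _ _ (fun y : R => 3^-1 - y ^+ 2 / 5) (fun=> 3^-1)).
  - by near=> y; exact: atan_defect_bounds.
  - rewrite -[X in _ --> X](subr0 (3^-1 : R)); apply: cvgB; first exact: cvg_cst.
    rewrite -[X in _ --> X](mul0r (5^-1 : R)); apply: cvgMl.
    rewrite [X in _ --> X](_ : _ = (0 : R) ^+ 2); last by rewrite expr0n.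
    exact: exprn_continuous.
  - exact: cvg_cst.
rewrite /continuous_at {2}/atan_defect (negbTE x0).
apply: (@cvg_trans _ ((fun y : R => (y - atan y) / y ^+ 3) @ x)).
  apply: near_eq_cvg; apply: filterS (near_neq x0) => y y0.
  by rewrite /= /atan_defect (negbTE y0).
apply: (@continuousM R _ (fun y : R => y - atan y) (fun y : R => (y ^+ 3)^-1) x).
  by apply: continuousB; [exact: cvg_id|exact: continuous_atan].
apply: cvgV; first exact: expf_neq0.
exact: exprn_continuous.
Unshelve. all: by end_near.
Qed.

(* With [tau = tan (s / 2)], [qprof tau = (s - sin s) / (4 * (1 - cos s))] is the
   height of the endpoint of a normal geodesic of vertical momentum [s] divided
   by the squared norm of its horizontal displacement, and
   [tprof tau = (s / 2) ^+ 2 / sin (s / 2) ^+ 2] is the squared length of the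
   geodesic divided by the same quantity. *)
Definition qprof x : R := (x - x ^+ 3 * atan_defect x - x * atan_defect x) / 4.
Definition tprof x : R := (1 - x ^+ 2 * atan_defect x) ^+ 2 * (1 + x ^+ 2).

Lemma tprofN x : tprof (- x) = tprof x.
Proof. by rewrite /tprof atan_defectN sqrrN. Qed.

Lemma qprofE x : 4 * x ^+ 2 * qprof x = (1 + x ^+ 2) * atan x - x.
Proof. by rewrite /qprof atanE; field. Qed.

Lemma tprofE x : x ^+ 2 * tprof x = atan x ^+ 2 * (1 + x ^+ 2).
Proof. by rewrite /tprof atanE; ring. Qed.

Lemma continuous_tprof : continuous (tprof : R -> R).
Proof.
move=> x; apply: cvgM; last first.
  by apply: cvgD; [exact: cvg_cst|exact: exprn_continuous].
apply: (continuous_comp (f := fun x => 1 - x ^+ 2 * atan_defect x)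
  (g := fun y : R => y ^+ 2)); last exact: exprn_continuous.
apply: cvgB; first exact: cvg_cst.
apply: cvgM; [exact: exprn_continuous|exact: continuous_atan_defect].
Qed.

Lemma sqr_sin_le x : sin x ^+ 2 <= x ^+ 2.
Proof.
wlog x0 : x / 0 <= x.
  move=> H; have [|/ltW] := leP 0 x; first exact: H.
  by rewrite -oppr_ge0 => /H; rewrite sinN !sqrrN.
have up : sin x <= x.
  rewrite -subr_ge0; pose f (y : R) := y - sin y.
  have fdf (y : R) : is_derive y 1 f (1 - cos y) by apply: is_derive_eq.
  have /(nondecreasing_from0 x0 fdf) : forall y : R, 0 <= 1 - cos y.
    by move=> y; rewrite subr_ge0 cos_le1.
  by rewrite /f sin0 subr0.
have dn : - x <= sin x.
  rewrite -subr_ge0 opprK; pose f (y : R) := sin y + y.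
  have fdf (y : R) : is_derive y 1 f (cos y + 1) by apply: is_derive_eq.
  have /(nondecreasing_from0 x0 fdf) : forall y : R, 0 <= cos y + 1.
    by move=> y; rewrite -lerBlDr sub0r cos_geN1.
  by rewrite /f sin0 addr0.
by rewrite -subr_ge0 subr_sqr mulr_ge0// ?subr_ge0// -lerBlDl sub0r.
Qed.

(** For x = tan u this is sin u ^+ 2 <= u ^+ 2: a geodesic is at least as long as its horizontal
    displacement. *)
Lemma tprof_ge1 x : 1 <= tprof x.
Proof.
have [->|x0] := eqVneq x 0.
  by rewrite /tprof expr0n/= mul0r subr0 expr1n addr0 mulr1.
have x20 : 0 < x ^+ 2 by rewrite exprn_even_gt0.
rewrite -(ler_pM2l x20) tprofE mulr1.
have x1 : 0 < 1 + x ^+ 2 by rewrite ltr_wpDr// sqr_ge0.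
have sinE : sin (atan x) = x * cos (atan x).
  rewrite -{2}(atanK x) /tan divfK// cos_atan invr_eq0 gt_eqF// sqrtr_gt0//.
rewrite [X in X <= _](_ : _ = sin (atan x) ^+ 2 * (1 + x ^+ 2)); last first.
  by rewrite sinE exprMn cos_atan exprVn sqr_sqrtr ?ltW// mulfVK// gt_eqF.
rewrite ler_pM2r//; exact: sqr_sin_le.
Qed.

(** Away from 0 the closed form in terms of atan is differentiated. At 0 the difference quotient is
    itself a continuous expression in [atan_defect], with limit (1 - 1/3) / 4 = 1/6, so continuity
    of [atan_defect] suffices. *)
Lemma is_derive_qprof x : is_derive x 1 (qprof : R -> R) (atan_defect x / 2).
Proof.
have [->|x0] := eqVneq x 0; last first.
  pose g (y : R) := ((1 + y ^+ 2) * atan y - y) / (4 * y ^+ 2).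
  have gE : {near x, g =1 qprof}.
    apply: filterS (near_neq x0) => y y0.
    by rewrite /g -qprofE mulrC mulKf// mulf_neq0// expf_neq0.
  apply: (near_eq_is_derive gE).
  rewrite /g.
  have ? : 4 * x ^+ 2 != 0 by rewrite mulf_neq0// expf_neq0.
  apply: is_derive_eq; rewrite /GRing.scale/= /atan_defect (negbTE x0); field.
  rewrite x0 gt_eqF// ltr_wpDr// sqr_ge0//.
have H : h^-1 *: (qprof (h *: 1 + 0) - qprof 0) @[h --> (0:R)^'] --> (atan_defect 0 / 2 : R).
  apply: (@cvg_trans _ ((fun y : R => (1 - y ^+ 2 * atan_defect y - atan_defect y) / 4) @ (0:R)^')).
    apply: near_eq_cvg; near=> y.
    have y0 : y != 0 by near: y; exact: nbhs_dnbhs_neq.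
    by rewrite /qprof /GRing.scale/= mulr1 addr0; field.
  rewrite (_ : atan_defect 0 / 2 = (1 - 0 ^+ 2 * atan_defect 0 - atan_defect 0) / 4); last first.
    by rewrite /atan_defect eqxx; field.
  apply: cvg_within_filter.
  apply: cvgMl; apply: cvgB; last exact: continuous_atan_defect.
  apply: cvgB; first exact: cvg_cst.
  apply: cvgM; [exact: exprn_continuous|exact: continuous_atan_defect].
by split; [apply/cvg_ex; exists (atan_defect 0 / 2)|exact: cvg_lim H].
Unshelve. all: by end_near.
Qed.

End profile.

(** * One-dimensional change of variables *)

Section one_dimensional.
Context {R : realType}.
Local Notation mR := (measurableTypeR R).
Local Notation lam := (@lebesgue_measure R).

(** Differentiability is asked only inside the interval: curves are extended by constants beyond
    [0, L], which keeps them continuous but may destroy the two-sided derivative at the end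
    points. *)
Definition C1_itv (a b : R) (f df : R -> R) :=
  [/\ {in `[a, b], continuous f}, {in `[a, b], continuous df} &
      forall x, x \in `]a, b[ -> is_derive x 1 f (df x)].

Lemma C1_itv_sub a b c d f df : a <= c -> d <= b ->
  C1_itv a b f df -> C1_itv c d f df.
Proof.
move=> ac db [cf cdf fdf]; split => x; rewrite in_itv/= => /andP[cx xd].
- by apply: cf; rewrite in_itv/= (le_trans ac cx) (le_trans xd db).
- by apply: cdf; rewrite in_itv/= (le_trans ac cx) (le_trans xd db).
- by apply: fdf; rewrite in_itv/= (le_lt_trans ac cx) (lt_le_trans xd db).
Qed.

Lemma C1_within a b f df : C1_itv a b f df -> {within `[a, b], continuous f}.
Proof. by move=> [cf _ _]; apply: continuous_in_subspaceT => x /[1!inE] /cf. Qed.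

Lemma C1_within' a b f df : C1_itv a b f df -> {within `[a, b], continuous df}.
Proof. by move=> [_ cf _]; apply: continuous_in_subspaceT => x /[1!inE] /cf. Qed.

Lemma C1_integral a b f df : a <= b -> C1_itv a b f df ->
  (\int[lam]_(x in `[a, b]) (df x)%:E = (f b - f a)%:E)%E.
Proof.
rewrite le_eqVlt => /predU1P[->|ab] H; first by rewrite set_itv1 integral_set1 subrr.
have [cf cdf fdf] := H.
rewrite (@continuous_FTC2 _ df f)//.
- exact: C1_within' H.
- split.
  + by move=> x xab; have [] := fdf x xab.
  + by apply: cvg_at_right_filter; apply: cf; rewrite in_itv/= lexx ltW.
  + by apply: cvg_at_left_filter; apply: cf; rewrite in_itv/= lexx ltW.
- by move=> x xab; rewrite derive1E; have [_ ->] := fdf x xab.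
Qed.

Section density.
Variables (a b : R) (df : R -> R).
Hypothesis cdf : {within `[a, b], continuous df}.
Hypothesis df0 : forall x, x \in `[a, b] -> 0 <= df x.

(** The half-open interval matches the half-open intervals on which measures are compared, so
    intersections keep the same form. *)
Definition density (E : set mR) : \bar R :=
  (\int[lam]_(x in E `&` `]a, b]%classic) (df x)%:E)%E.

Let mdf : measurable_fun (`]a, b]%classic : set mR) (fun x => (df x)%:E).
Proof.
apply/measurable_EFinP.
apply: (@measurable_funS _ _ _ _ (`[a, b]%classic : set mR)) => //.
  by move=> x /=; rewrite !in_itv/= => /andP[/ltW -> ->].
exact: subspace_continuous_measurable_fun.
Qed.

Let density0 : density set0 = 0%E.
Proof. by rewrite /density set0I integral_set0. Qed.

Let density_ge0 E : (0 <= density E)%E.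
Proof.
apply: integral_ge0 => x [_ xab]; rewrite lee_fin; apply: df0.
by move: xab; rewrite /= !in_itv/= => /andP[/ltW -> ->].
Qed.

Let density_sigma_additive : semi_sigma_additive density.
Proof.
move=> F mF tF mUF; rewrite /density setI_bigcupl ge0_integral_bigcup//.
- apply: is_cvg_ereal_nneg_natsum_cond => n _ _; exact: density_ge0.
- by move=> k; exact: measurableI.
- rewrite -setI_bigcupl; apply: measurable_funS mdf => //.
- move=> x; rewrite -setI_bigcupl => -[_ xab]; rewrite lee_fin; apply: df0.
  by move: xab; rewrite /= !in_itv/= => /andP[/ltW -> ->].
- exact: trivIset_setIr.
Qed.

HB.instance Definition _ := isMeasure.Build _ _ _ density
  density0 density_ge0 density_sigma_additive.

Definition density_measure : {measure set mR -> \bar R} :=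
  [the measure _ _ of density].

End density.


Section image_measure.
Variables (a b : R) (f df : R -> R).
Hypotheses (ab : a <= b) (C1f : C1_itv a b f df).
Hypothesis df0 : forall x, x \in `[a, b] -> 0 < df x.

Let lb x : x \in `[a, b] -> a <= x. Proof. by rewrite in_itv => /andP[]. Qed.
Let ub x : x \in `[a, b] -> x <= b. Proof. by rewrite in_itv => /andP[]. Qed.

Lemma C1_increasing : {in `[a, b] &, {homo f : x y / x < y}}.
Proof.
move=> x y xab yab xy; have [cf _ fdf] := C1_itv_sub (lb xab) (ub yab) C1f.
have [c cxy] := @MVT _ f df x y xy fdf (C1_within (C1_itv_sub (lb xab) (ub yab) C1f)).
rewrite -subr_gt0 => ->; rewrite mulr_gt0 ?subr_gt0//; apply: df0.
move: xab yab cxy; rewrite !in_itv/= => /andP[ax _] /andP[_ yb] /andP[xc cy].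
by rewrite (le_trans ax (ltW xc)) (le_trans (ltW cy) yb).
Qed.

Let flt : {in `[a, b] &, {mono f : x y / x < y}}.
Proof. exact/leW_mono_in/(le_mono_in C1_increasing). Qed.

Let fle : {in `[a, b] &, {mono f : x y / x <= y}}.
Proof. exact: le_mono_in C1_increasing. Qed.

Let aab : a \in `[a, b]. Proof. by rewrite in_itv/= lexx. Qed.
Let bab : b \in `[a, b]. Proof. by rewrite in_itv/= lexx andbT. Qed.

Lemma C1_surjective z : f a <= z <= f b -> exists2 x, x \in `[a, b] & f x = z.
Proof.
move=> zab; apply: IVT => //; first exact: C1_within C1f.
have fab : f a <= f b by rewrite fle.
by rewrite min_l// max_r.
Qed.

Variable h : mR -> mR.
Hypotheses (mh : measurable_fun setT h) (fK : {in `[a, b], cancel f h}).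

(** Through the measurable left inverse h, the image of E under f becomes a preimage, hence
    measurable, and both sides become measures in E. On half-open intervals they agree by the
    fundamental theorem of calculus. *)
Lemma lebesgue_preimage_density E : measurable E ->
  lam (h @^-1` E `&` `]f a, f b]%classic) = density a b df E.
Proof.
move=> mE.
have cdf := C1_within' C1f.
have df0' x : x \in `[a, b] -> 0 <= df x by move=> /df0/ltW.
pose D : set mR := `]f a, f b]%classic.
have mD : measurable D by exact: measurable_itv.
pose nu1 : {measure set mR -> \bar R} :=
  measure_function_pushforward__canonical__measure_function_Measure
    (measure_function_mrestr__canonical__measure_function_Measure lam mD) mh.
pose nu2 : {measure set mR -> \bar R} := density_measure cdf df0'.
have nu12 X : ocitv X -> nu1 X = nu2 X.
  move=> [[c d] /= cd <-].
  rewrite /nu1 /nu2/= /pushforward /mrestr /density.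
  (* The test interval ]c, d] is clipped to [a, b], where f is monotone; it may become empty. *)
  pose c' := Num.max a c; pose d' := Num.min b d.
  rewrite (_ : `]c, d] `&` `]a, b] = `]c', d']%classic); last first.
    by apply/seteqP; split => x /=; rewrite !in_itv/= gt_max le_min;
      [move=> [/andP[-> ->] /andP[-> ->]]|move=> /andP[/andP[-> ->] /andP[-> ->]]].
  rewrite (_ : _ `&` D = [set z | exists2 x, x \in `[a, b] & z = f x /\ c' < x <= d']); last first.
    apply/seteqP; split => z /=.
      rewrite /D/= !in_itv/= => -[hz /andP[z1 z2]].
      have [x xab xz] := C1_surjective (introT andP (conj (ltW z1) z2)).
      exists x => //; split => //; move: z1 z2 hz; rewrite -xz fK// flt// fle//.
      by rewrite gt_max le_min => -> -> /andP[-> ->].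
    move=> [x xab [-> ]]; rewrite gt_max le_min => /andP[/andP[ax cx] /andP[xb xd]].
    by rewrite fK// /D/= !in_itv/= cx xd flt// ax fle.
  have [cd'|cd'] := ltP c' d'; last first.
    rewrite [X in lam X](_ : _ = set0) ?measure0.
      by rewrite set_itv_ge ?integral_set0// bnd_simp -leNgt.
    apply/seteqP; split => // z [x _ [_ /andP[cx xd]]].
    by move: cd'; rewrite leNgt (lt_le_trans cx xd).
  have c'ab : c' \in `[a, b].
    by rewrite in_itv/= le_max lexx/=; apply: (le_trans (ltW cd')); rewrite ge_min lexx.
  have d'ab : d' \in `[a, b].
    rewrite in_itv/= [X in _ && X]ge_min lexx andbT.
    by apply: (le_trans _ (ltW cd')); rewrite le_max lexx.
  rewrite (_ : [set z | exists2 x, _ & _ ] = `]f c', f d']%classic); last first.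
    apply/seteqP; split => z /=.
      by move=> [x xab [-> /andP[cx xd]]]; rewrite in_itv/= flt// cx fle.
    rewrite in_itv/= => /andP[z1 z2].
    have [|x xab xz] := @C1_surjective z.
      apply/andP; split; [apply: le_trans (ltW z1)|apply: (le_trans z2)];
      by rewrite fle// ?(lb c'ab) ?(ub d'ab).
    by exists x => //; split => //; rewrite -flt// -fle// xz z1 z2.
  have C1f' := C1_itv_sub (lb c'ab) (ub d'ab) C1f.
  rewrite lebesgue_measure_itv/= lte_fin flt// cd' -EFinB.
  rewrite -(C1_integral (ltW cd') C1f').
  rewrite integral_itv_obnd_cbnd//.
  apply/measurable_EFinP.
  apply: (@measurable_funS _ _ _ _ (`[c', d']%classic : set mR)) => //.
    by move=> x /=; rewrite !in_itv/= => /andP[/ltW -> ->].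
  by apply: subspace_continuous_measurable_fun => //; exact: C1_within' C1f'.
pose g (n : nat) : set mR := `](- n%:R), n%:R]%classic.
have Gg n : ocitv (g n) by exists (- n%:R, n%:R) => //=.
have g_cover : \bigcup_k g k = setT.
  apply/seteqP; split => // x _.
  exists (Num.truncn `|x|).+1 => //=.
  have := truncnS_gt `|x|; rewrite ltr_norml /g/= in_itv/= => /andP[-> /ltW ->] //.
have goo k : (nu1 (g k) < +oo)%E.
  apply: (@le_lt_trans _ _ (lam D)).
    rewrite /nu1/= /pushforward /mrestr; apply: le_measure; rewrite ?inE//.
    by apply: measurableI => //; apply: measurable_preimage => //; exact: measurable_itv.
  by rewrite /D lebesgue_measure_itv/=; case: ifP => // _; rewrite -EFinB ltry.
exact: (@measure_unique _ R mR (@ocitv R) g erefl (@ocitvI R) Gg g_cover nu1 nu2 nu12 goo E mE).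
Qed.

End image_measure.

End one_dimensional.

Section image_measure.
Context {R : realType}.
Local Notation mR := (measurableTypeR R).
Local Notation lam := (@lebesgue_measure R).
Variables (a b : R) (f df : R -> R).
Hypotheses (ab : a <= b) (C1f : C1_itv a b f df).

Lemma lebesgue_image (h : mR -> mR) (E : set mR) :
  (forall x, x \in `[a, b] -> 0 < df x) ->
  measurable_fun setT h -> {in `[a, b], cancel f h} ->
  measurable E -> E `<=` `[a, b]%classic ->
  lam (f @` E) = (\int[lam]_(x in E) (df x)%:E)%E.
Proof.
move=> df0 mh fK mE Eab.
have H := lebesgue_preimage_density ab C1f df0 mh fK mE.
have mD : measurable (`]f a, f b]%classic : set mR) by exact: measurable_itv.
have mE' : measurable (h @^-1` E `&` `]f a, f b]%classic).
  by apply: measurableI => //; exact: measurable_preimage.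
have fE x : E x -> x != a -> (h @^-1` E `&` `]f a, f b]%classic) (f x).
  move=> Ex xa; have xab := Eab _ Ex; split; first by rewrite /= fK.
  have aab : a \in `[a, b] by rewrite in_itv/= lexx.
  have bab : b \in `[a, b] by rewrite in_itv/= lexx andbT.
  move: (xab); rewrite /= !in_itv/= => /andP[ax xb]; apply/andP; split.
    by apply: (C1_increasing C1f df0) => //; rewrite lt_neqAle eq_sym xa.
  have := xb; rewrite le_eqVlt => /predU1P[->//|xb'].
  by apply/ltW; apply: (C1_increasing C1f df0).
have Ef z : (h @^-1` E `&` `]f a, f b]%classic) z -> exists2 x, E x & f x = z.
  move=> [hz /=]; rewrite in_itv/= => /andP[z1 z2].
  have [x xab xz] := C1_surjective ab C1f df0 (introT andP (conj (ltW z1) z2)).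
  by exists x => //; move: hz; rewrite /= -xz fK.
have mdf (D : set mR) : D `<=` `[a, b]%classic ->
    measurable D -> measurable_fun D (fun x => (df x)%:E).
  move=> Dab mD'; apply/measurable_EFinP.
  apply: (@measurable_funS _ _ _ _ (`[a, b]%classic : set mR)) => //.
  by apply: subspace_continuous_measurable_fun => //; exact: C1_within' C1f.
(* The half-open interval loses the point a, which contributes a null set to each side. *)
have [Ea|Ea] := pselect (E a).
  rewrite (_ : f @` E = [set f a] `|` (h @^-1` E `&` `]f a, f b]%classic)); last first.
    apply/seteqP; split => [_ [x Ex <-]|z [->|/Ef//]]; last by exists a.
    by have [->|xa] := eqVneq x a; [left|right; exact: fE].
  rewrite measureU//; last first.
    by apply/seteqP; split => // z [/= -> [_]]; rewrite /= in_itv/= ltxx.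
  rewrite [X in (X + _)%E](_ : _ = 0%E) ?add0e; last exact: lebesgue_measure_set1.
  rewrite [LHS]H /density [in RHS](_ : E = [set a] `|` (E `&` `]a, b]%classic)); last first.
    apply/seteqP; split => [x Ex|x [->//|[]//]].
    have [->|xa] := eqVneq x a; [by left|right; split => //].
    have := Eab _ Ex; rewrite /= !in_itv/= => /andP[ax ->].
    by rewrite lt_neqAle eq_sym xa ax.
  rewrite ge0_integral_setU//.
  - by rewrite integral_set1 add0e.
  - by apply: measurableI => //; exact: measurable_itv.
  - apply: mdf; first by move=> x [->|[/Eab]]//=; rewrite in_itv/= lexx.
    by apply: measurableU => //; apply: measurableI => //; exact: measurable_itv.
  - move=> x [->|[/Eab xab _]]; rewrite lee_fin ltW// df0// in_itv/= lexx//.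
  - apply/disj_set2P/seteqP; split => // x [/= -> [_]].
    by rewrite /= in_itv/= ltxx.
rewrite (_ : f @` E = h @^-1` E `&` `]f a, f b]%classic); last first.
  apply/seteqP; split => [_ [x Ex <-]|z /Ef//]; apply: fE => //.
  by apply/eqP => xa; apply: Ea; rewrite -xa.
rewrite [LHS]H /density (_ : E `&` _ = E)//; apply/setIidl => x Ex.
have := Eab _ Ex; rewrite /= !in_itv/= => /andP[ax ->].
rewrite lt_neqAle ax andbT andbT; apply/eqP => xa; apply: Ea; by rewrite xa.
Qed.

Hypothesis f1 : forall x, x \in `[a, b] -> `|f x| <= 1.

Let segment_integrable (c d : R) (g : R -> R) : {within `[c, d], continuous g} ->
  lam.-integrable `[c, d] (EFin \o g).
Proof. by move=> cg; apply: continuous_compact_integrable => //; exact: segment_compact. Qed.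

(** The values of f lie in [-1, 1], inside ]-2, 2[, so the primitive of m based at -2 is
    differentiable at each of them and can be composed with f. *)
Lemma integral_comp_continuous (m : R -> R) : continuous m ->
  (\int[lam]_(x in `[a, b]) (m (f x) * df x)%:E =
   \int[lam]_(y in `[(-2)%R, f b]) (m y)%:E - \int[lam]_(y in `[(-2)%R, f a]) (m y)%:E)%E.
Proof.
move=> cm.
have im c d : lam.-integrable `[c, d] (EFin \o m).
  by apply: segment_integrable; exact: continuous_subspaceT.
pose M (y : R) : R := (\int[lam]_(t in `[(-2)%R, y]) m t)%R.
have ME (y : R) : (M y)%:E = (\int[lam]_(t in `[(-2)%R, y]) (m t)%:E)%E.
  by rewrite /M /Rintegral fineK//; exact: integrable_fin_num (im _ _).
rewrite -!ME -EFinB.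
have dM (y : R) : `|y| <= 1 -> is_derive y 1 M (m y).
  rewrite ler_norml => /andP[y1 y2].
  have [|||dM <-] := @continuous_FTC1_closed _ m (-2) y 2 _ (im _ _).
  - by lra.
  - by lra.
  - exact: cm.
  - by rewrite derive1E; exact: DeriveDef.
have C1Mf : C1_itv a b (M \o f) (fun x => m (f x) * df x).
  have [cf cdf fdf] := C1f; split.
  - move=> x xab; apply: continuous_comp; first exact: cf.
    apply/differentiable_continuous/derivable1_diffP.
    by have [] := dM _ (f1 xab).
  - move=> x xab; apply: continuousM; last exact: cdf.
    by apply: continuous_comp; [exact: cf|exact: cm].
  - move=> x xab; have := f1 (subset_itv_oo_cc xab) => /dM dMx.
    have dfx := fdf x xab.
    by apply: is_derive_eq; rewrite mulrC.
exact: C1_integral ab C1Mf.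
Qed.

(** For a discontinuous m the primitive need not be differentiable along f. Both sides are therefore
    limits of the continuous case, by dominated convergence; f need not be monotone. *)
Lemma integral_comp_limit (m : R -> R) (m_ : nat -> R -> R) C :
  (forall n, continuous (m_ n)) -> (forall n y, `|m_ n y| <= C) ->
  (forall y, m_ n y @[n --> \oo] --> m y) -> measurable_fun setT m ->
  (\int[lam]_(x in `[a, b]) (m (f x) * df x)%:E =
   \int[lam]_(y in `[(-2)%R, f b]) (m y)%:E - \int[lam]_(y in `[(-2)%R, f a]) (m y)%:E)%E.
Proof.
move=> cm bm lm mm.
have [cf cdf fdf] := C1f.
have wf := C1_within C1f; have wdf := C1_within' C1f.
have mf : measurable_fun (`[a, b]%classic : set mR) f.
  exact: subspace_continuous_measurable_fun.
have mdf : measurable_fun (`[a, b]%classic : set mR) df.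
  exact: subspace_continuous_measurable_fun.
have mm_ n : measurable_fun setT (m_ n) by exact: continuous_measurable_fun.
have lim1 y : (\int[lam]_(t in `[(-2)%R, y]) (m t)%:E)%E \is a fin_num /\
    (\int[lam]_(t in `[(-2)%R, y]) (m_ n t)%:E)%E @[n --> \oo] -->
    (\int[lam]_(t in `[(-2)%R, y]) (m t)%:E)%E.
  have [||||||im _ lm'] := @dominated_convergence _ mR R lam `[(-2)%R, y] _
    (fun n t => (m_ n t)%:E) (fun t => (m t)%:E) (fun=> C%:E); last first.
    by split => //; apply: integrable_fin_num im; exact: measurable_itv.
  - by apply: aeW => t n _; rewrite abse_EFin lee_fin.
  - by apply: segment_integrable; apply: continuous_subspaceT => ?; exact: cvg_cst.
  - by apply: aeW => t _; apply/fine_cvgP; split; [exact: nearW|exact: lm].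
  - by apply/measurable_EFinP; apply: measurable_funTS; exact: mm.
  - by move=> n; apply/measurable_EFinP; apply: measurable_funTS; exact: mm_.
  - exact: measurable_itv.
have lim2 : (\int[lam]_(x in `[a, b]) (m_ n (f x) * df x)%:E)%E @[n --> \oo] -->
    (\int[lam]_(x in `[a, b]) (m (f x) * df x)%:E)%E.
  have [||||||_ _ +] := @dominated_convergence _ mR R lam `[a, b] _
    (fun n t => (m_ n (f t) * df t)%:E) (fun t => (m (f t) * df t)%:E)
    (fun t => (C * `|df t|)%:E); last by apply.
  - exact: measurable_itv.
  - move=> n; apply/measurable_EFinP; apply: measurable_funM => //.
    exact: measurableT_comp (mm_ n) mf.
  - apply/measurable_EFinP; apply: measurable_funM => //.
    exact: measurableT_comp mm mf.
  - apply: aeW => t _; apply/fine_cvgP; split; [exact: nearW|].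
    by apply: cvgMl; exact: lm.
  - apply: segment_integrable; apply: continuous_in_subspaceT => x /[1!inE] /cdf cx.
    by apply: cvgM; [exact: cvg_cst|exact: cvg_norm].
  - by apply: aeW => t n _; rewrite abse_EFin lee_fin normrM ler_wpM2r.
apply: (cvg_unique _ lim2) => //.
rewrite [X in X @ _](_ : _ = (fun n => \int[lam]_(y in `[(-2)%R, f b]) (m_ n y)%:E -
    \int[lam]_(y in `[(-2)%R, f a]) (m_ n y)%:E)%E); last first.
  by apply/funext => n; rewrite integral_comp_continuous.
have [fb lb] := lim1 (f b); have [fa la] := lim1 (f a).
by apply: cvgeB => //; exact: fin_num_adde_defr.
Qed.

End image_measure.

(** * Unitary invariance of Lebesgue measure *)

Section vectors.
Context {R : realType}.
Local Notation mR := (measurableTypeR R).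
Local Notation mu n := (@lebesgue_tuple R n).

Definition dotv n (a b : 'I_n -> R) : R := \sum_i a i * b i.

Lemma dotvC n (a b : 'I_n -> R) : dotv a b = dotv b a.
Proof. by apply: eq_bigr => i _; rewrite mulrC. Qed.

(* Multiplication by i under the identification (x, y) = x + i y. *)
Definition Jv d (k : 'I_(d + d) -> R) (i : 'I_(d + d)) : R :=
  match fintype.split i with inl j => - k (rshift d j) | inr j => k (lshift d j) end.

Lemma Jv_l d (k : 'I_(d + d) -> R) i : Jv k (lshift d i) = - k (rshift d i).
Proof.
rewrite /Jv; case: splitP => j /= ij; first by congr (- k (rshift d _)); exact/val_inj.
by have := ltn_ord i; rewrite ij ltnNge leq_addr.
Qed.

Lemma Jv_r d (k : 'I_(d + d) -> R) i : Jv k (rshift d i) = k (lshift d i).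
Proof.
rewrite /Jv; case: splitP => j /= ij; first by have := ltn_ord j; rewrite -ij ltnNge leq_addr.
by congr (k (lshift d _)); apply/val_inj; move/addnI: ij.
Qed.

Lemma dotv_split d (a b : 'I_(d + d) -> R) :
  dotv a b = \sum_i (a (lshift d i) * b (lshift d i) + a (rshift d i) * b (rshift d i)).
Proof. by rewrite /dotv big_split_ord big_split. Qed.

Lemma dotv_Jv d (a b : 'I_(d + d) -> R) : dotv (Jv a) b = - dotv (Jv b) a.
Proof.
rewrite !dotv_split -sumrN; apply: eq_bigr => i _.
by rewrite !Jv_l !Jv_r; ring.
Qed.

Lemma dotv_Jvv d (a : 'I_(d + d) -> R) : dotv (Jv a) a = 0.
Proof. by have := dotv_Jv a a; set x := dotv _ _ => xE; lra. Qed.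

Section givens.
Context {n : nat}.
Variables (p q : 'I_n) (c s : R).

Definition givens (k : 'I_n -> R) (i : 'I_n) : R :=
  if i == p then c * k p - s * k q else if i == q then s * k p + c * k q else k i.

Hypotheses (pq : p != q) (cs : c ^+ 2 + s ^+ 2 = 1).

Lemma dotv_givens a b : dotv (givens a) (givens b) = dotv a b.
Proof.
rewrite /dotv (bigD1 p)//= [RHS](bigD1 p)//= (bigD1 q) 1?eq_sym//= [in RHS](bigD1 q) 1?eq_sym//=.
rewrite !addrA; congr (_ + _).
  rewrite /givens !eqxx [q == p]eq_sym (negbTE pq).
  transitivity ((c ^+ 2 + s ^+ 2) * (a p * b p + a q * b q)); first by ring.
  by rewrite cs mul1r.
by apply: eq_bigr => i /andP[ip iq]; rewrite /givens (negbTE ip) (negbTE iq).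
Qed.

Definition givens_map (v : n.-tuple mR) : n.-tuple mR :=
  [tuple (givens (tnth v) i : mR) | i < n].

Lemma tnth_givens_map v : tnth (givens_map v) = givens (tnth v).
Proof. by apply/funext => i; rewrite tnth_mktuple. Qed.

(* A rotation by an angle t <> pi is the product of three shears, with
   parameters - tan (t / 2), sin t, - tan (t / 2). *)
Lemma lebesgue_preserving_givens : c != -1 -> lebesgue_preserving givens_map.
Proof.
move=> c1; have c10 : 1 + c != 0 by rewrite addr_eq0 -eqr_oppLR eq_sym.
pose t := s / (1 + c).
have ts : t * s = 1 - c.
  by apply: (mulIf c10); rewrite /t mulrAC divfK// (_ : s * s = 1 - c ^+ 2); [ring|rewrite -cs; ring].
pose f1 : n.-tuple mR -> mR := fun v => - t * tnth v q.
pose f2 : n.-tuple mR -> mR := fun v => s * tnth v p.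
have mf1 : measurable_fun setT f1 by apply: measurable_funM => //; exact: measurable_tnth_fun.
have mf2 : measurable_fun setT f2 by apply: measurable_funM => //; exact: measurable_tnth_fun.
have P1 : lebesgue_preserving (coord_map p 1 f1).
  apply: lebesgue_preserving_coord_map; rewrite ?normr1// => v v' vv'.
  by rewrite /f1 vv'// eq_sym.
have P2 : lebesgue_preserving (coord_map q 1 f2).
  by apply: lebesgue_preserving_coord_map; rewrite ?normr1// => v v' vv'; rewrite /f2 vv'.
have := lebesgue_preserving_comp (lebesgue_preserving_comp P1 P2) P1.
congr lebesgue_preserving; apply/funext => v; apply/eq_from_tnth => i.
rewrite !tnth_mktuple /f1 /f2 /= !tnth_mktuple /givens !eqxx.
rewrite [q == p]eq_sym (negbTE pq); have [->|ip] := eqVneq i p.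
  rewrite (negbTE pq) !mul1r.
  transitivity ((1 - t * s) * tnth v p - (2 * t - t * (t * s)) * tnth v q); first by ring.
  rewrite ts subKr; congr (_ - _ * _).
  by rewrite mulrBr mulr1 /t; field.
have [->|//] := eqVneq i q.
rewrite !mul1r.
transitivity ((1 - t * s) * tnth v q + s * tnth v p); first by ring.
by rewrite ts subKr addrC.
Qed.

End givens.

Section unitary_equivalence.
Context {d : nat}.
Implicit Types k : 'I_(d + d) -> R.

(** A measure-preserving map that carries k to k' as a unitary map would, recorded only through the
    three inner products on which the slice densities depend. *)
Definition ueq k k' := dotv k k = dotv k' k' /\
  exists2 f : (d + d).-tuple mR -> (d + d).-tuple mR, lebesgue_preserving f &
  forall v, [/\ dotv (tnth (f v)) (tnth (f v)) = dotv (tnth v) (tnth v),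
    dotv k' (tnth (f v)) = dotv k (tnth v) &
    dotv (Jv k') (tnth (f v)) = dotv (Jv k) (tnth v)].

Lemma ueq_refl k : ueq k k.
Proof. by split => //; exists id => //; exact: lebesgue_preserving_id. Qed.

Lemma ueq_trans k1 k2 k3 : ueq k1 k2 -> ueq k2 k3 -> ueq k1 k3.
Proof.
move=> [n12 [f pf fE]] [n23 [g pg gE]]; split; first by rewrite n12.
exists (g \o f); first exact: lebesgue_preserving_comp.
move=> v /=; have [e1 e2 e3] := fE v; have [h1 h2 h3] := gE (f v).
by rewrite h1 h2 h3 e1 e2 e3.
Qed.

(** [givens1] multiplies one complex coordinate by a phase; [givens2] applies the same real rotation
    to the real and to the imaginary parts of two coordinates. Both commute with [Jv], that is, they
    are unitary. *)
Definition givens1 (i : 'I_d) c s := @givens (d + d) (lshift d i) (rshift d i) c s.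
Definition givens2 (i j : 'I_d) c s k :=
  givens (rshift d i) (rshift d j) c s (givens (lshift d i) (lshift d j) c s k).

Lemma lr_neq (i j : 'I_d) : (lshift d i == rshift d j) = false.
Proof. by apply/negbTE; rewrite -val_eqE/= neq_ltn (leq_trans (ltn_ord i)) ?leq_addr. Qed.

Lemma rl_neq (i j : 'I_d) : (rshift d j == lshift d i) = false.
Proof. by rewrite eq_sym lr_neq. Qed.

Lemma ll_eq (i j : 'I_d) : (lshift d i == lshift d j) = (i == j).
Proof. by rewrite -!val_eqE. Qed.

Lemma rr_eq (i j : 'I_d) : (rshift d i == rshift d j) = (i == j).
Proof. by rewrite -!val_eqE/= eqn_add2l. Qed.

Lemma Jv_givens1 i c s k : Jv (givens1 i c s k) = givens1 i c s (Jv k).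
Proof.
apply/funext => l; rewrite /givens1 /givens; case: (split_ordP l) => j ->.
  rewrite Jv_l lr_neq rl_neq rr_eq ll_eq !Jv_l !Jv_r.
  by case: eqP => _; [ring|].
rewrite Jv_r lr_neq rl_neq rr_eq ll_eq !Jv_l !Jv_r.
by case: eqP => _; [ring|].
Qed.

Lemma Jv_givens2 i j c s k : i != j -> Jv (givens2 i j c s k) = givens2 i j c s (Jv k).
Proof.
move=> ij; apply/funext => l; rewrite /givens2 /givens; case: (split_ordP l) => m ->.
  rewrite !(Jv_l, Jv_r, lr_neq, rl_neq, rr_eq, ll_eq).
  by case: eqP => _; [ring|case: eqP => _; [ring|]].
rewrite !(Jv_l, Jv_r, lr_neq, rl_neq, rr_eq, ll_eq).
by case: eqP => _; [ring|case: eqP => _; [ring|]].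
Qed.

Lemma ueq_givens1 i c s k : c ^+ 2 + s ^+ 2 = 1 -> c != -1 -> ueq k (givens1 i c s k).
Proof.
move=> cs c1; have ne : lshift d i != rshift d i by rewrite lr_neq.
split; first by rewrite dotv_givens.
exists (givens_map (lshift d i) (rshift d i) c s).
  exact: lebesgue_preserving_givens.
by move=> v; rewrite Jv_givens1 tnth_givens_map !dotv_givens.
Qed.

Lemma ueq_givens2 i j c s k : i != j -> c ^+ 2 + s ^+ 2 = 1 -> c != -1 ->
  ueq k (givens2 i j c s k).
Proof.
move=> ij cs c1.
have nl : lshift d i != lshift d j by rewrite ll_eq.
have nr : rshift d i != rshift d j by rewrite rr_eq.
split; first by rewrite !dotv_givens.
exists (givens_map (rshift d i) (rshift d j) c s \o givens_map (lshift d i) (lshift d j) c s).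
  by apply: lebesgue_preserving_comp; exact: lebesgue_preserving_givens.
by move=> v /=; rewrite Jv_givens2// !tnth_givens_map !dotv_givens.
Qed.

(** The hypothesis on b excludes the half turn c = -1, which the factorization into three shears
    does not reach. *)
Lemma rotation_exists (a b : R) : b != 0 ->
  exists c s, [/\ c ^+ 2 + s ^+ 2 = 1, c != -1 & s * a + c * b = 0].
Proof.
move=> b0; pose rho := Num.sqrt (a ^+ 2 + b ^+ 2).
have ab0 : 0 < a ^+ 2 + b ^+ 2 by rewrite ltr_wpDl ?sqr_ge0// exprn_even_gt0.
have rho0 : rho != 0 by rewrite gt_eqF// sqrtr_gt0.
have rho2 : rho ^+ 2 = a ^+ 2 + b ^+ 2 by rewrite sqr_sqrtr// ltW.
exists (a / rho), (- b / rho); split.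
- by rewrite !exprMn sqrrN -mulrDl -rho2 -exprMn divff// expr1n.
- apply/eqP => /(congr1 (fun x => x * rho)); rewrite divfK// mulN1r => aE.
  by move: rho2; rewrite aE sqrrN -[LHS]addr0 => /addrI/esym/eqP; rewrite sqrf_eq0 (negbTE b0).
- by field.
Qed.

(** Phases remove the imaginary parts one complex coordinate at a time; coordinates that are already
    real are left alone. *)
Lemma ueq_real k : exists2 k', ueq k k' & forall i, k' (rshift d i) = 0.
Proof.
suff H m : exists2 k', ueq k k' & forall i : 'I_d, (i < m)%N -> k' (rshift d i) = 0.
  by have [k' ? k'0] := H d; exists k' => // i; exact: k'0.
elim: m => [|m [k' kk' k'0]]; first by exists k => //; exact: ueq_refl.
have [md|dm] := ltnP m d; last first.
  by exists k' => // i _; apply: k'0; exact: leq_trans (ltn_ord i) dm.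
pose j := Ordinal md.
have [z|nz] := eqVneq (k' (rshift d j)) 0.
  exists k' => // i; rewrite ltnS leq_eqVlt => /predU1P[im|]; last exact: k'0.
  by rewrite (_ : i = j)//; exact/val_inj.
have [c [s [cs c1 E]]] := rotation_exists (k' (lshift d j)) nz.
exists (givens1 j c s k'); first exact: ueq_trans kk' (ueq_givens1 _ _ cs c1).
move=> i im; rewrite /givens1 /givens rl_neq rr_eq; case: eqP => [//|ij].
apply: k'0; move: im; rewrite ltnS leq_eqVlt => /predU1P[im|//].
by case: ij; exact/val_inj.
Qed.

End unitary_equivalence.

Definition basis0 d (kappa : R) (i : 'I_(d.+1 + d.+1)) : R :=
  if i == lshift d.+1 ord0 then kappa else 0.

Lemma dotv_basis0 d kappa (a : 'I_(d.+1 + d.+1) -> R) :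
  dotv (basis0 kappa) a = kappa * a (lshift d.+1 ord0).
Proof.
rewrite /dotv (bigD1 (lshift d.+1 ord0))//= /basis0 eqxx big1 ?addr0// => i /negbTE ->.
by rewrite mul0r.
Qed.

(** Once k is real, real rotations against coordinate 0 clear the other coordinates and keep the
    imaginary parts 0. What remains is a multiple of the first basis vector, of the norm of k up to
    sign. *)
Lemma ueq_basis0 d (k : 'I_(d.+1 + d.+1) -> R) :
  ueq k (basis0 (Num.sqrt (dotv k k))).
Proof.
have [kappa H] : exists kappa, ueq k (basis0 kappa).
  suff H m : exists k', [/\ ueq k k', forall i, k' (rshift d.+1 i) = 0 &
      forall i : 'I_d.+1, (0 < i < m)%N -> k' (lshift d.+1 i) = 0].
    have [k' [kk' k'0 k'1]] := H d.+1; exists (k' (lshift d.+1 ord0)).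
    rewrite (_ : basis0 _ = k')//; apply/funext => i; rewrite /basis0.
    case: (split_ordP i) => j ->; last by rewrite rl_neq k'0.
    rewrite ll_eq; case: eqP => [->//|/eqP j0]; rewrite k'1// ltn_ord andbT.
    by rewrite lt0n.
  elim: m => [|m [k' [kk' k'0 k'1]]].
    by have [k' ? ?] := ueq_real k; exists k'; split => // i; rewrite ltn0 andbF.
  have [md|dm] := ltnP m d.+1; last first.
    exists k'; split => // i /andP[i0 _]; apply: k'1; rewrite i0/=.
    exact: leq_trans (ltn_ord i) dm.
  pose j := Ordinal md.
  have [z|nz] := boolP ((j == ord0) || (k' (lshift d.+1 j) == 0)).
    exists k'; split => // i /andP[i0]; rewrite ltnS leq_eqVlt => /predU1P[im|im].
      move: z; rewrite (_ : j = i); last exact/val_inj.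
      by rewrite -val_eqE/= (gtn_eqF i0)/= => /eqP.
    by apply: k'1; rewrite i0.
  move: nz; rewrite negb_or => /andP[j0 nz].
  have [c [s [cs c1 E]]] := rotation_exists (k' (lshift d.+1 ord0)) nz.
  have j0' : ord0 != j by rewrite eq_sym.
  exists (givens2 ord0 j c s k'); split.
  - exact: ueq_trans kk' (ueq_givens2 _ j0' cs c1).
  - move=> i; rewrite /givens2 /givens !(lr_neq, rl_neq, rr_eq, ll_eq) !k'0.
    by rewrite !mulr0 subr0 addr0 !if_same.
  - move=> i /andP[i0 im]; rewrite /givens2 /givens !(lr_neq, rl_neq, rr_eq, ll_eq).
    rewrite -val_eqE/= gtn_eqF//; case: eqP => [//|/eqP ij]; apply: k'1.
    by rewrite i0/=; move: im; rewrite ltnS leq_eqVlt => /predU1P[im|//]; move: ij; rewrite -val_eqE/= im eqxx.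
have kn : dotv k k = kappa ^+ 2.
  by have [-> _] := H; rewrite dotv_basis0 /basis0 eqxx expr2.
rewrite kn sqrtr_sqr; have [k0|k0] := leP 0 kappa; first by rewrite ger0_norm.
rewrite ltr0_norm//; apply: ueq_trans H _.
(* The sign is changed by two quarter turns, since a single half turn is excluded in
   [ueq_givens1]. *)
have cs : (0 : R) ^+ 2 + 1 ^+ 2 = 1 by rewrite expr0n expr1n add0r.
have c1 : (0 : R) != -1 by rewrite eq_sym oppr_eq0 oner_eq0.
suff <- : givens1 (@ord0 d) 0 1 (givens1 (@ord0 d) 0 1 (basis0 kappa)) = basis0 (- kappa).
  exact: ueq_trans (ueq_givens1 ord0 _ cs c1) (ueq_givens1 ord0 _ cs c1).
apply/funext => i; rewrite /givens1 /givens /basis0.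
rewrite !(lr_neq, rl_neq, rr_eq, ll_eq) !eqxx.
case: (split_ordP i) => j ->; rewrite !(lr_neq, rl_neq, rr_eq, ll_eq).
  by case: eqP => _; [ring|].
by case: eqP => _; [ring|].
Qed.

Section invariance.
Context {d : nat}.
Variable F : R -> R -> R -> R.
Let f (k : 'I_(d + d) -> R) (v : (d + d).-tuple mR) : \bar R :=
  (F (dotv (tnth v) (tnth v)) (dotv k (tnth v)) (dotv (Jv k) (tnth v)))%:E.
Hypothesis mf : forall k, measurable_fun setT (f k).

Lemma integral_ueq k k' : ueq k k' -> (\int[mu (d + d)]_v f k v = \int[mu (d + d)]_v f k' v)%E.
Proof.
move=> [_ [g pg gE]]; rewrite -(integral_preserving pg (mf k')).
by apply: eq_integral => v _; rewrite /f; have [-> -> ->] := gE v.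
Qed.

End invariance.

Lemma integral_norm_eq d (F : R -> R -> R -> R) (k k' : 'I_(d + d) -> R) :
  let f (k : 'I_(d + d) -> R) (v : (d + d).-tuple mR) : \bar R :=
    (F (dotv (tnth v) (tnth v)) (dotv k (tnth v)) (dotv (Jv k) (tnth v)))%:E in
  (forall k, measurable_fun setT (f k)) -> dotv k k = dotv k' k' ->
  (\int[mu (d + d)]_v f k v = \int[mu (d + d)]_v f k' v)%E.
Proof.
(* For d = 0 there is no first coordinate to rotate into, but then all inner products are empty
   sums. *)
move=> f mf kk'; case: d => [|d] in k k' f mf kk' *.
  by apply: eq_integral => v _; rewrite /f /dotv !big_ord0.
by rewrite (integral_ueq mf (ueq_basis0 k)) (integral_ueq mf (ueq_basis0 k')) kk'.
Qed.

(* Reflecting the coordinate along k changes the sign of the inner product with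
   k, and preserves its product with the direction orthogonal to k in the
   complex line of k. *)
Lemma integral_reflection d (F : R -> R -> R -> R) (k : 'I_(d + d) -> R) :
  let f (F : R -> R -> R -> R) (k : 'I_(d + d) -> R) (v : (d + d).-tuple mR) : \bar R :=
    (F (dotv (tnth v) (tnth v)) (dotv k (tnth v)) (dotv (Jv k) (tnth v)))%:E in
  (forall k, measurable_fun setT (f F k)) ->
  (forall k, measurable_fun setT (f (fun x a b => F x (- a) b) k)) ->
  (\int[mu (d + d)]_v f F k v = \int[mu (d + d)]_v f (fun x a b => F x (- a)%R b) k v)%E.
Proof.
move=> f mf mf'; case: d => [|d] in k f mf mf' *.
  by apply: eq_integral => v _; rewrite /f /dotv !big_ord0 oppr0.
rewrite (integral_ueq mf (ueq_basis0 k)) (integral_ueq mf' (ueq_basis0 k)).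
set kappa := Num.sqrt _; pose g : (d.+1 + d.+1).-tuple mR -> _ :=
  coord_map (lshift d.+1 ord0) (-1) (fun=> 0).
have pg : lebesgue_preserving g.
  by apply: lebesgue_preserving_coord_map; rewrite ?normrN1.
rewrite -(integral_preserving pg (mf (basis0 kappa))).
apply: eq_integral => v _; rewrite /f.
have gE i : tnth (g v) i = if i == lshift d.+1 ord0 then - tnth v i else tnth v i.
  by rewrite tnth_mktuple mulN1r addr0.
congr ((F _ _ _)%:E).
- apply: eq_bigr => i _; rewrite gE; case: ifP => // _; by rewrite mulrNN.
- by rewrite !dotv_basis0 gE eqxx mulrN.
- apply: eq_bigr => i _; rewrite gE; case: eqP => // ->.
  by rewrite Jv_l /basis0 rl_neq oppr0 !mul0r.
Qed.

End vectors.

(** * Slices of the tube as graphs *)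

Section height_function.
Context {R : realType}.
Local Notation mR := (measurableTypeR R).

(** An inverse truncated so as to be continuous and bounded on the whole line. [tau] and the
    densities become continuous everywhere, hence measurable without domain conditions, and the true
    inverse is recovered on the small ball where y > 1. *)
Definition ginv (y : R) : R := (Num.max 1 y)^-1.

Lemma ginvE y : 1 <= y -> ginv y = y^-1.
Proof. by move=> y1; rewrite /ginv max_r. Qed.

Lemma ginv_gt0 y : 0 < ginv y.
Proof. by rewrite invr_gt0 lt_max ltr01. Qed.

Lemma ginv_le1 y : ginv y <= 1.
Proof. by rewrite /ginv invf_le1 ?le_max ?lexx// lt_max ltr01. Qed.

Lemma continuous_ginv : continuous (ginv : R -> R).
Proof.
move=> y; apply: (@continuous_comp _ _ _ (fun y : R => Num.max 1 y) GRing.inv).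
  exact: (continuous_max (cvg_cst _) (cvg_id)).
by apply: inv_continuous; rewrite gt_eqF// lt_max ltr01.
Qed.

Context {d : nat}.
Local Notation n := (d + d)%N.
(** The tangent of half the vertical momentum of the geodesic normal to the curve whose horizontal
    displacement is x, as [slice_endpoint] shows. *)
Definition tau (k x : 'I_n -> R) : R := dotv k x * ginv (2 - dotv (Jv k) x).

Definition dtau (k l x : 'I_n -> R) : R := let g := ginv (2 - dotv (Jv k) x) in
  dotv l x * g + dotv k x * dotv (Jv l) x * g ^+ 2.

Definition height (k x : 'I_n -> R) : R := dotv x x * qprof (tau k x).

Definition len2 (k x : 'I_n -> R) : R := dotv x x * tprof (tau k x).

(** The coefficient of v in the time derivative of [phi]. The summands come from the motion of the
    base point, from the change of the squared norm of x (which moves with velocity v k), and from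
    the change of [tau] with x. *)
Definition pden (k x : 'I_n -> R) : R := (2 - dotv (Jv k) x) / 2 + 2 * dotv k x * qprof (tau k x) +
  dotv x x * (atan_defect (tau k x) / 2) * (dotv k k * ginv (2 - dotv (Jv k) x)).

Definition kden (k l x : 'I_n -> R) : R := dotv x x * (atan_defect (tau k x) / 2 * dtau k l x).

Section measurability.
Context dT (T : measurableType dT).

Lemma measurable_fun_dotv m (a b : T -> 'I_m -> R) :
  (forall i, measurable_fun setT (a^~ i)) -> (forall i, measurable_fun setT (b^~ i)) ->
  measurable_fun setT (fun x => dotv (a x) (b x)).
Proof. by move=> ma mb; apply: measurable_sum => i; exact: measurable_funM. Qed.

Lemma measurable_fun_Jv (a : T -> 'I_n -> R) :
  (forall i, measurable_fun setT (a^~ i)) ->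
  forall i, measurable_fun setT (fun x => Jv (a x) i).
Proof.
move=> ma i; rewrite /Jv; case: fintype.split => j //.
by apply: measurable_funN; exact: ma.
Qed.

Lemma measurable_fun_continuous_comp (f : R -> R) (g : T -> R) :
  continuous f -> measurable_fun setT g -> measurable_fun setT (fun x => f (g x)).
Proof.
by move=> cf mg; apply: measurableT_comp mg; exact: continuous_measurable_fun.
Qed.

Variables (k l x : T -> 'I_n -> R).
Hypotheses (mk : forall i, measurable_fun setT (k^~ i))
           (ml : forall i, measurable_fun setT (l^~ i))
           (mx : forall i, measurable_fun setT (x^~ i)).

Let mB : measurable_fun setT (fun t => 2 - dotv (Jv (k t)) (x t)).
Proof.
apply: measurable_funB => //; apply: measurable_fun_dotv => //.
exact: measurable_fun_Jv.
Qed.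

Let mg : measurable_fun setT (fun t => ginv (2 - dotv (Jv (k t)) (x t))).
Proof. exact: (measurable_fun_continuous_comp continuous_ginv). Qed.

Lemma measurable_fun_tau : measurable_fun setT (fun t => tau (k t) (x t)).
Proof. by apply: measurable_funM => //; exact: measurable_fun_dotv. Qed.

Lemma measurable_fun_dtau : measurable_fun setT (fun t => dtau (k t) (l t) (x t)).
Proof.
apply: measurable_funD; first by apply: measurable_funM => //; exact: measurable_fun_dotv.
apply: measurable_funM; last exact: measurable_funX.
apply: measurable_funM; first exact: measurable_fun_dotv.
apply: measurable_fun_dotv => //; exact: measurable_fun_Jv.
Qed.

Lemma measurable_fun_len2 : measurable_fun setT (fun t => len2 (k t) (x t)).
Proof.
apply: measurable_funM; first exact: measurable_fun_dotv.
apply: (measurable_fun_continuous_comp continuous_tprof); exact: measurable_fun_tau.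
Qed.

Lemma continuous_qprof : continuous (qprof : R -> R).
Proof.
move=> y; apply/differentiable_continuous/derivable1_diffP.
by have [] := is_derive_qprof y.
Qed.

Lemma measurable_fun_height : measurable_fun setT (fun t => height (k t) (x t)).
Proof.
apply: measurable_funM; first exact: measurable_fun_dotv.
apply: (measurable_fun_continuous_comp continuous_qprof); exact: measurable_fun_tau.
Qed.

Let mdefect : measurable_fun setT (fun t => atan_defect (tau (k t) (x t)) / 2).
Proof.
apply: measurable_funM => //.
apply: (measurable_fun_continuous_comp continuous_atan_defect); exact: measurable_fun_tau.
Qed.

Lemma measurable_fun_pden : measurable_fun setT (fun t => pden (k t) (x t)).
Proof.
apply: measurable_funD; last first.
  apply: measurable_funM.
    by apply: measurable_funM => //; exact: measurable_fun_dotv.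
  by apply: measurable_funM => //; exact: measurable_fun_dotv.
apply: measurable_funD; first exact: measurable_funM.
apply: measurable_funM.
  by apply: measurable_funM => //; exact: measurable_fun_dotv.
apply: (measurable_fun_continuous_comp continuous_qprof); exact: measurable_fun_tau.
Qed.

Lemma measurable_fun_kden : measurable_fun setT (fun t => kden (k t) (l t) (x t)).
Proof.
apply: measurable_funM; first exact: measurable_fun_dotv.
by apply: measurable_funM => //; exact: measurable_fun_dtau.
Qed.

End measurability.

Section continuity.
Context (T : topologicalType) (t : T).

Lemma continuous_fcomp (f : R -> R) (g : T -> R) : continuous f ->
  {for t, continuous g} -> {for t, continuous (fun s => f (g s))}.
Proof. by move=> cf cg; exact: continuous_comp cg (cf _). Qed.

Lemma continuous_dotv m (a b : T -> 'I_m -> R) :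
  (forall i, {for t, continuous (a^~ i)}) -> (forall i, {for t, continuous (b^~ i)}) ->
  {for t, continuous (fun s => dotv (a s) (b s) : R)}.
Proof.
move=> ca cb; apply: cvg_big; first exact: add_continuous.
by move=> i _; apply: cvgM; [exact: ca|exact: cb].
Qed.

Lemma continuous_Jv (a : T -> 'I_n -> R) : (forall i, {for t, continuous (a^~ i)}) ->
  forall i, {for t, continuous (fun s => Jv (a s) i : R)}.
Proof.
move=> ca i; rewrite /Jv; case: fintype.split => j; last exact: ca.
by apply: cvgN; exact: ca.
Qed.

Variables (k l x : T -> 'I_n -> R).
Hypotheses (ck : forall i, {for t, continuous (k^~ i)})
           (cl : forall i, {for t, continuous (l^~ i)})
           (cx : forall i, {for t, continuous (x^~ i)}).

Let cg : {for t, continuous (fun s => ginv (2 - dotv (Jv (k s)) (x s)) : R)}.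
Proof.
apply: (@continuous_fcomp ginv); first exact: continuous_ginv.
apply: cvgB; first exact: cvg_cst.
apply: continuous_dotv => //; exact: continuous_Jv.
Qed.

Lemma continuous_tau : {for t, continuous (fun s => tau (k s) (x s) : R)}.
Proof. by apply: cvgM => //; apply: continuous_dotv. Qed.

Lemma continuous_dtau : {for t, continuous (fun s => dtau (k s) (l s) (x s) : R)}.
Proof.
apply: cvgD; first by apply: cvgM => //; apply: continuous_dotv.
apply: cvgM.
  apply: cvgM; first exact: continuous_dotv.
  by apply: continuous_dotv => //; apply: continuous_Jv.
by apply: (@continuous_fcomp (fun y => y ^+ 2)); [exact: exprn_continuous|exact: cg].
Qed.

Lemma continuous_height : {for t, continuous (fun s => height (k s) (x s) : R)}.
Proof.
apply: cvgM; first exact: continuous_dotv.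
by apply: (@continuous_fcomp qprof); [exact: continuous_qprof|exact: continuous_tau].
Qed.

Let cdefect : {for t, continuous (fun s => atan_defect (tau (k s) (x s)) / 2 : R)}.
Proof.
apply: cvgMl.
by apply: (@continuous_fcomp atan_defect); [exact: continuous_atan_defect|exact: continuous_tau].
Qed.

Lemma continuous_kden : {for t, continuous (fun s => kden (k s) (l s) (x s) : R)}.
Proof.
apply: cvgM; first exact: continuous_dotv.
by apply: cvgM => //; exact: continuous_dtau.
Qed.

Lemma continuous_pden : {for t, continuous (fun s => pden (k s) (x s) : R)}.
Proof.
apply: cvgD; last first.
  apply: cvgM; first by apply: cvgM; [exact: continuous_dotv|exact: cdefect].
  by apply: cvgM; [exact: continuous_dotv|exact: cg].
apply: cvgD.
  apply: cvgMl; apply: cvgB; first exact: cvg_cst.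
  apply: continuous_dotv => //; exact: continuous_Jv.
apply: cvgM; first by apply: cvgM; [exact: cvg_cst|exact: continuous_dotv].
by apply: (@continuous_fcomp qprof); [exact: continuous_qprof|exact: continuous_tau].
Qed.

End continuity.

Section derivatives.

Lemma is_derive_dotv m (a b : R -> 'I_m -> R) (t : R) (a' b' : 'I_m -> R) :
  (forall i, is_derive t 1 (a^~ i) (a' i)) -> (forall i, is_derive t 1 (b^~ i) (b' i)) ->
  is_derive t 1 (fun s => dotv (a s) (b s)) (dotv a' (b t) + dotv (a t) b').
Proof.
move=> da db.
have dab i : is_derive t 1 (fun s => a s i * b s i) (a' i * b t i + a t i * b' i).
  have := da i; have := db i => ? ?; apply: is_derive_eq.
  by rewrite /GRing.scale/= addrC mulrC.
have := is_derive_sum dab; rewrite big_split/=.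
rewrite (_ : \sum_(i < m) _ = (fun s => dotv (a s) (b s)))//.
by apply/funext => s; rewrite fct_sumE.
Qed.

End derivatives.

End height_function.

(** * Abstract curve data and the graph functions of the slices *)

Section curve_data.
Context {R : realType}.
Local Notation mR := (measurableTypeR R).

(* For a curve (w, z) in C^d x R with vertical velocity v, the horizontal
   velocity is w' = - v k; [l] is the derivative of [k]. *)
Record curve_data (d : nat) (L : R) := CurveData {
  cw : R -> 'I_(d + d) -> R;
  ck : R -> 'I_(d + d) -> R;
  cl : R -> 'I_(d + d) -> R;
  cz : R -> R;
  cv : R -> R;
  csg : R;
  cK : R;
  cv0 : R;
  cw_cont : forall i, continuous (cw^~ i);
  ck_cont : forall i, continuous (ck^~ i);
  cl_cont : forall i, continuous (cl^~ i);
  cz_cont : continuous cz;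
  cv_cont : continuous cv;
  cw_der : forall t i, t \in `]0, L[ -> is_derive t 1 (cw^~ i) (- (cv t * ck t i));
  ck_der : forall t i, t \in `]0, L[ -> is_derive t 1 (ck^~ i) (cl t i);
  cz_der : forall t, t \in `]0, L[ ->
    is_derive t 1 cz (cv t - cv t * dotv (Jv (cw t)) (ck t) / 2);
  csg1 : `|csg| = 1;
  cv0_gt0 : 0 < cv0;
  cv_ge : forall t, cv0 <= csg * cv t;
  cv_le : forall t, `|cv t| <= 1;
  ck_le : forall t i, `|ck t i| <= cK;
  cl_le : forall t i, `|cl t i| <= cK }.

Context {d : nat} {L : R} (D : curve_data d L).
Local Notation n := (d + d)%N.

Definition disp (t : R) (W : 'I_n -> R) (i : 'I_n) : R := W i - cw D t i.

(** The last coordinate of the group product of (w, z) with (x, height), where x = W - w. The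
    product of J w with x is written with W instead, since J w is orthogonal to w. *)
Definition phi (t : R) (W : 'I_n -> R) : R :=
  cz D t + dotv (Jv (cw D t)) W / 2 + height (ck D t) (disp t W).

Definition dphi (t : R) (x : 'I_n -> R) : R :=
  cv D t * pden (ck D t) x + kden (ck D t) (cl D t) x.

Lemma dotvZr m (a : R) (x y : 'I_m -> R) : dotv x (fun i => a * y i) = a * dotv x y.
Proof. by rewrite /dotv mulr_sumr; apply: eq_bigr => i _; rewrite mulrCA. Qed.

Lemma dotvBr m (x y z : 'I_m -> R) : dotv x (fun i => y i - z i) = dotv x y - dotv x z.
Proof. by rewrite /dotv -sumrB; apply: eq_bigr => i _; rewrite mulrBr. Qed.

Lemma JvZ (a : R) (x : 'I_n -> R) : Jv (fun i => a * x i) = (fun i => a * Jv x i).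
Proof. by apply/funext => i; rewrite /Jv; case: fintype.split => // j; rewrite mulrN. Qed.

Lemma is_derive_Jv (a : R -> 'I_n -> R) (a' : 'I_n -> R) (t : R) :
  (forall i, is_derive t 1 (a^~ i) (a' i)) ->
  forall i, is_derive t 1 (fun s => Jv (a s) i) (Jv a' i).
Proof.
move=> da i; rewrite /Jv; case: fintype.split => j; last exact: da.
by have := da (rshift d j) => ?; apply: is_derive_eq.
Qed.

Lemma is_derive_fcomp (f g : R -> R) (t f' g' : R) :
  is_derive (g t) 1 f f' -> is_derive t 1 g g' ->
  is_derive t 1 (fun s => f (g s)) (f' * g').
Proof. by move=> ? ?; apply: is_derive_eq; rewrite mulrC. Qed.

Lemma is_derive_ginv (y : R) : 1 < y -> is_derive y 1 (ginv : R -> R) (- (ginv y) ^+ 2).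
Proof.
move=> y1; have y0 : y != 0 by rewrite gt_eqF// (lt_trans ltr01).
apply: (@near_eq_is_derive _ _ _ (fun y : R => y^-1)).
  have : \forall s \near y, 1 < s by exact: lt_nbhsr.
  by apply: filterS => s s1; rewrite ginvE// ltW.
apply: DeriveDef; first exact: (@derivableV _ _ id).
rewrite (@deriveV _ _ id)// derive_id ginvE ?ltW// /GRing.scale/= mulr1 exprVn//.
Qed.

Lemma is_derive_tau (k x : R -> 'I_n -> R) (k' x' : 'I_n -> R) (t : R) :
  (forall i, is_derive t 1 (k^~ i) (k' i)) ->
  (forall i, is_derive t 1 (x^~ i) (x' i)) ->
  1 < 2 - dotv (Jv (k t)) (x t) ->
  is_derive t 1 (fun s => tau (k s) (x s))
    (dtau (k t) k' (x t) + (dotv (k t) x' * ginv (2 - dotv (Jv (k t)) (x t)) +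
     dotv (k t) (x t) * dotv (Jv (k t)) x' * ginv (2 - dotv (Jv (k t)) (x t)) ^+ 2)).
Proof.
move=> dk dx B1.
have dA := is_derive_dotv dk dx.
have dB := is_derive_dotv (is_derive_Jv dk) dx.
have dB2 : is_derive t 1 (fun s => 2 - dotv (Jv (k s)) (x s))
    (- (dotv (Jv k') (x t) + dotv (Jv (k t)) x')).
  by apply: is_derive_eq; ring.
have dg := @is_derive_fcomp ginv (fun s => 2 - dotv (Jv (k s)) (x s)) t _ _
  (is_derive_ginv B1) dB2.
apply: (is_derive_eq (is_deriveM dA dg)); rewrite /dtau /GRing.scale/=; ring.
Qed.

(** At fixed W the displacement moves with velocity v k. As J k is orthogonal to k, this motion does
    not change 2 - <J k, x>, so the denominator of [tau] varies only through k'. *)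
Lemma is_derive_phi (t : R) (W : 'I_n -> R) : t \in `]0, L[ ->
  1 < 2 - dotv (Jv (ck D t)) (disp t W) ->
  is_derive t 1 (phi^~ W) (dphi t (disp t W)).
Proof.
move=> t0L B1.
pose x' i := cv D t * ck D t i.
have dx i : is_derive t 1 (fun s => disp s W i) (x' i).
  have ? := cw_der D i t0L.
  by apply: is_derive_eq; rewrite /GRing.scale/= /x'; ring.
have dT := is_derive_tau (fun i => ck_der D i t0L) dx B1.
have dq := @is_derive_fcomp qprof (fun s => tau (ck D s) (disp s W)) t _ _
  (is_derive_qprof _) dT.
have dr := is_derive_dotv dx dx.
have dh := is_deriveM dr dq.
have dJw := is_derive_dotv (is_derive_Jv (fun i => cw_der D i t0L))
  (fun i => is_derive_cst (W i) t 1).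
have dz := cz_der D t0L.
have dJ2 : is_derive t 1 (fun s => dotv (Jv (cw D s)) W / 2)
   (dotv (Jv (fun i => - (cv D t * ck D t i))) W / 2).
  apply: is_derive_eq; rewrite /GRing.scale/= (_ : dotv _ (fun=> 0) = 0); last first.
    by rewrite /dotv big1// => i _; rewrite mulr0.
  ring.
apply: (is_derive_eq (is_deriveD (is_deriveD dz dJ2) dh)).
rewrite /dphi /pden /kden /GRing.scale/=.
have -> : dotv (Jv (fun i => - (cv D t * ck D t i))) W = - cv D t * dotv (Jv (ck D t)) W.
  rewrite (_ : (fun i => _) = (fun i => - cv D t * ck D t i)); last first.
    by apply/funext => i; rewrite mulNr.
  by rewrite JvZ dotvC dotvZr dotvC.
have -> : dotv (Jv (cw D t)) (ck D t) = - dotv (Jv (ck D t)) (cw D t) by rewrite dotv_Jv.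
have BE : dotv (Jv (ck D t)) (disp t W) = dotv (Jv (ck D t)) W - dotv (Jv (ck D t)) (cw D t).
  by rewrite -dotvBr.
have -> : dotv (Jv (ck D t)) W = dotv (Jv (ck D t)) (disp t W) + dotv (Jv (ck D t)) (cw D t).
  by rewrite BE subrK.
rewrite /x' dotvZr [dotv (fun _ => cv D t * _) _]dotvC !dotvZr dotv_Jvv [dotv (disp t W) (ck D t)]dotvC.
by field.
Qed.

Lemma continuous_disp (W : 'I_n -> R) i : continuous (fun t => disp t W i).
Proof. by move=> t; apply: cvgB; [exact: cvg_cst|exact: cw_cont]. Qed.

Lemma continuous_phi (W : 'I_n -> R) : continuous (phi^~ W).
Proof.
move=> t; apply: cvgD; last first.
  by apply: continuous_height => i; [exact: ck_cont|exact: continuous_disp].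
apply: cvgD; first exact: cz_cont.
apply: cvgMl; apply: continuous_dotv => i; last exact: cvg_cst.
by apply: continuous_Jv => j; exact: cw_cont.
Qed.

Lemma continuous_dphi (W : 'I_n -> R) : continuous (fun t => dphi t (disp t W)).
Proof.
move=> t; apply: cvgD.
  apply: cvgM; first exact: cv_cont.
  by apply: continuous_pden => i; [exact: ck_cont|exact: continuous_disp].
by apply: continuous_kden => i; [exact: ck_cont|exact: cl_cont|exact: continuous_disp].
Qed.

Lemma dotv_le m (a x : 'I_m -> R) (K e : R) : 0 <= e ->
  (forall i, `|a i| <= K) -> (forall i, `|x i| <= e) -> `|dotv a x| <= m%:R * K * e.
Proof.
move=> e0 aK xe; apply: (le_trans (ler_norm_sum _ _ _)).
rewrite -mulrA mulr_natl -[X in _ *+ X]card_ord -sumr_const; apply: ler_sum => i _.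
by rewrite normrM ler_pM.
Qed.

Lemma Jv_le (a : 'I_n -> R) (K : R) : (forall i, `|a i| <= K) -> forall i, `|Jv a i| <= K.
Proof. by move=> aK i; rewrite /Jv; case: fintype.split => j; rewrite ?normrN. Qed.

Lemma coord_le_norm m (x : 'I_m -> R) (e : R) : 0 <= e ->
  dotv x x <= e ^+ 2 -> forall i, `|x i| <= e.
Proof.
move=> e0 xe i; rewrite -(@ler_pXn2r _ 2)// ?nnegrE// -normrX ger0_norm ?sqr_ge0//.
apply: le_trans xe; rewrite /dotv (bigD1 i)//= expr2 lerDl.
by apply: sumr_ge0 => j _; rewrite -expr2 sqr_ge0.
Qed.

Lemma dotvv_ge0 m (x : 'I_m -> R) : 0 <= dotv x x.
Proof. by apply: sumr_ge0 => j _; rewrite -expr2 sqr_ge0. Qed.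

Lemma qprof_le (y : R) : `|y| <= 1 -> `|qprof y| <= `|y|.
Proof.
move=> y1; have /andP[_ e3] := atan_defect_bounds y; have e0 := atan_defect_ge0 y.
rewrite (_ : qprof y = y * ((1 - (1 + y ^+ 2) * atan_defect y) / 4)); last first.
  by rewrite /qprof; field.
rewrite normrM -[X in _ <= X]mulr1 ler_wpM2l// ler_norml.
have y2 : y ^+ 2 <= 1 by rewrite -(@real_normK _ y) ?num_real// exprn_ile1.
have y20 := sqr_ge0 y.
have : (1 + y ^+ 2) * atan_defect y <= 2 by nra.
have : 0 <= (1 + y ^+ 2) * atan_defect y by nra.
by move=> ? ?; apply/andP; split; lra.
Qed.

(** On a small ball [pden] is at least 1/4 while [kden] is of order e ^+ 2, so [dphi] has the sign
    of v uniformly in t. *)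
Lemma uniform_radius : exists e M : R, [/\ 0 < e,
  forall t x, dotv x x < e ^+ 2 ->
    [/\ 1 < 2 - dotv (Jv (ck D t)) x, `|tau (ck D t) x| <= 1,
      0 < csg D * dphi t x & 0 <= pden (ck D t) x],
  forall t x, dotv x x < e ^+ 2 ->
    pden (ck D t) x <= M /\ `|kden (ck D t) (cl D t) x| <= M &
  forall t x, dotv x x < e ^+ 2 -> `|dotv (ck D t) x| <= 1].
Proof.
pose K := `|cK D|; have K0 : 0 <= K by exact: normr_ge0.
have kK t i : `|ck D t i| <= K by apply: le_trans (ler_norm _); exact: ck_le.
have lK t i : `|cl D t i| <= K by apply: le_trans (ler_norm _); exact: cl_le.
pose N : R := n%:R; have N0 : 0 <= N by rewrite ler0n.
have NK : 0 <= N * K by exact: mulr_ge0.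
(* The last entry bounds the products of x with k, l and their images under J by 1/2. The other two
   give e ^+ 2 / 6 <= e / 6 <= cv0 / 6, which is below the lower bound cv0 / 4 of the main term. *)
pose e := Num.min (Num.min 1 (cv0 D)) (2 * (N * K) + 1)^-1.
have e0 : 0 < e by rewrite !lt_min ltr01 cv0_gt0 invr_gt0 ltr_wpDl// mulr_ge0.
have e1 : e <= 1 by rewrite !ge_min lexx.
have ev : e <= cv0 D by rewrite !ge_min lexx orbT.
have eNK : N * K * e <= 2^-1.
  have : e <= (2 * (N * K) + 1)^-1 by rewrite !ge_min lexx orbT.
  have p0 : 0 < 2 * (N * K) + 1 by rewrite ltr_wpDl// mulr_ge0.
  rewrite -(ler_pM2l p0) divff ?gt_eqF// => ?; nra.
suff H t x : dotv x x < e ^+ 2 ->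
    [/\ 1 < 2 - dotv (Jv (ck D t)) x, `|tau (ck D t) x| <= 1,
      0 < csg D * dphi t x & 0 <= pden (ck D t) x] /\
    (pden (ck D t) x <= 3 + N * K * K /\ `|kden (ck D t) (cl D t) x| <= 3 + N * K * K).
  exists e, (3 + N * K * K); split => // t x xe; try by have [] := H t x xe.
  have xi := coord_le_norm (ltW e0) (ltW xe).
  by apply: le_trans (dotv_le (ltW e0) (kK t) xi) _; lra.
move=> /ltW xe.
have xi := coord_le_norm (ltW e0) xe.
have A1 : `|dotv (ck D t) x| <= 2^-1 := le_trans (dotv_le (ltW e0) (kK t) xi) eNK.
have B1 : `|dotv (Jv (ck D t)) x| <= 2^-1 := le_trans (dotv_le (ltW e0) (Jv_le (kK t)) xi) eNK.
have l1 : `|dotv (cl D t) x| <= 2^-1 := le_trans (dotv_le (ltW e0) (lK t) xi) eNK.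
have Jl1 : `|dotv (Jv (cl D t)) x| <= 2^-1 := le_trans (dotv_le (ltW e0) (Jv_le (lK t)) xi) eNK.
have B2 : 1 < 2 - dotv (Jv (ck D t)) x by move: B1; rewrite ler_norml => /andP[? ?]; lra.
set B := dotv (Jv (ck D t)) x in B1 B2 *.
set A := dotv (ck D t) x in A1 *.
have g0 := ginv_gt0 (2 - B); have g1 := ginv_le1 (2 - B).
have tE : tau (ck D t) x = A * ginv (2 - B) by [].
have t1 : `|tau (ck D t) x| <= 2^-1.
  rewrite tE normrM (ger0_norm (ltW g0)) -[X in _ <= X]mulr1.
  by apply: ler_pM => //; exact: ltW.
have t1' : `|tau (ck D t) x| <= 1 by apply: le_trans t1 _; rewrite invf_le1// ler1n.
have q1 : `|qprof (tau (ck D t) x)| <= 2^-1 := le_trans (qprof_le t1') t1.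
have /andP[_ d3] := atan_defect_bounds (tau (ck D t) x).
have d0 := atan_defect_ge0 (tau (ck D t) x).
have x0 := dotvv_ge0 x.
have kk0 := dotvv_ge0 (ck D t).
have p4 : 4^-1 <= pden (ck D t) x.
  rewrite /pden -/A -/B.
  have : 0 <= dotv x x * (atan_defect (tau (ck D t) x) / 2) *
      (dotv (ck D t) (ck D t) * ginv (2 - B)).
    by apply: mulr_ge0; apply: mulr_ge0 => //; [exact: divr_ge0|exact: ltW].
  have : `|A * qprof (tau (ck D t) x)| <= 2^-1 * 2^-1 by rewrite normrM ler_pM.
  rewrite -[2 * A * _]mulrA; set Aq := A * qprof _; rewrite ler_norml => /andP[? ?].
  move: B1; rewrite ler_norml => /andP[? ?]; lra.
have dt1 : `|dtau (ck D t) (cl D t) x| <= 1.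
  rewrite /dtau -/A -/B; apply: (le_trans (ler_normD _ _)).
  have : `|dotv (cl D t) x * ginv (2 - B)| <= 2^-1 * 1.
    by rewrite normrM ler_pM// ger0_norm// ltW.
  have : `|A * dotv (Jv (cl D t)) x * ginv (2 - B) ^+ 2| <= 2^-1 * 2^-1 * 1.
    rewrite normrM ler_pM//; first by rewrite normrM ler_pM.
    by rewrite ger0_norm ?exprn_ge0 ?exprn_ile1// ltW.
  move=> ? ?; lra.
have k6 : `|kden (ck D t) (cl D t) x| <= e ^+ 2 * (6^-1 * 1).
  rewrite /kden normrM ler_pM//; first by rewrite ger0_norm.
  rewrite normrM ler_pM// ger0_norm; first by lra.
  by rewrite divr_ge0.
have NKK : 0 <= N * K * K by exact: mulr_ge0.
have e21 : e ^+ 2 <= 1 by rewrite exprn_ile1// ltW.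
split; last split; last first.
- by apply: (le_trans k6); lra.
- rewrite /pden -/A -/B.
  have : dotv x x * (atan_defect (tau (ck D t) x) / 2) *
      (dotv (ck D t) (ck D t) * ginv (2 - B)) <= 1 * 1 * (N * K * K * 1).
    apply: ler_pM; [|apply: mulr_ge0 => //; exact: ltW|apply: ler_pM => //|apply: ler_pM => //].
    + by apply: mulr_ge0 => //; exact: divr_ge0.
    + exact: divr_ge0.
    + exact: le_trans xe e21.
    + by lra.
    + exact: ltW.
    + by apply: le_trans (dotv_le K0 (kK t) (kK t)); exact: ler_norm.
  have : `|A * qprof (tau (ck D t) x)| <= 2^-1 * 2^-1 by rewrite normrM ler_pM.
  rewrite -[2 * A * _]mulrA; set Aq := A * qprof _; rewrite ler_norml => /andP[? ?].
  move: B1; rewrite ler_norml => /andP[? ?]; lra.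
split => //; last by apply: le_trans p4; rewrite invr_ge0.
rewrite /dphi mulrDr mulrA.
have s1 : `|csg D * kden (ck D t) (cl D t) x| <= e / 6.
  rewrite normrM csg1 mul1r; apply: le_trans k6 _; rewrite mulr1 ler_pM2r ?invr_gt0//.
  by rewrite expr2 -[X in _ <= X]mul1r ler_pM2r.
have v1 : cv0 D * 4^-1 <= csg D * cv D t * pden (ck D t) x.
  by apply: ler_pM; rewrite ?cv_ge// ?invr_ge0// ltW// cv0_gt0.
have := cv0_gt0 D.
move: s1; rewrite ler_norml => /andP[? ?] ?; lra.
Qed.

End curve_data.

(** * Volume of a short piece of the tube *)

Section piece.
Context {R : realType}.
Local Notation mR := (measurableTypeR R).
Local Notation lam := (@lebesgue_measure R).
Local Notation mu n := (@lebesgue_tuple R n).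
Context {d : nat} {L : R} (D : curve_data d L).
Local Notation n := (d + d)%N.
Local Notation X := (n.-tuple mR).

Definition tube_density (r t : R) (x : 'I_n -> R) : R :=
  if len2 (ck D t) x < r ^+ 2 then csg D * dphi D t x else 0.

Section joint_measurability.
Context dT (T : measurableType dT) (s : T -> R) (x : T -> 'I_n -> R).
Hypotheses (ms : measurable_fun setT s) (mx : forall i, measurable_fun setT (x^~ i)).

Let mw i : measurable_fun setT (fun p => cw D (s p) i).
Proof. exact: (measurable_fun_continuous_comp (@cw_cont _ _ _ D i)). Qed.

Let mk i : measurable_fun setT (fun p => ck D (s p) i).
Proof. exact: (measurable_fun_continuous_comp (@ck_cont _ _ _ D i)). Qed.

Let ml i : measurable_fun setT (fun p => cl D (s p) i).
Proof. exact: (measurable_fun_continuous_comp (@cl_cont _ _ _ D i)). Qed.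

Lemma measurable_fun_disp i : measurable_fun setT (fun p => disp D (s p) (x p) i).
Proof. exact: measurable_funB. Qed.

Lemma measurable_fun_len2_disp :
  measurable_fun setT (fun p => len2 (ck D (s p)) (x p)).
Proof. exact: measurable_fun_len2. Qed.

Lemma measurable_fun_phi : measurable_fun setT (fun p => phi D (s p) (x p)).
Proof.
apply: measurable_funD; last first.
  by apply: measurable_fun_height => // i; exact: measurable_fun_disp.
apply: measurable_funD.
  exact: (measurable_fun_continuous_comp (@cz_cont _ _ _ D)).
apply: measurable_funM => //; apply: measurable_fun_dotv => // i.
exact: measurable_fun_Jv.
Qed.

Lemma measurable_fun_dphi : measurable_fun setT (fun p => dphi D (s p) (x p)).
Proof.
apply: measurable_funD; last exact: measurable_fun_kden.
apply: measurable_funM; last exact: measurable_fun_pden.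
exact: (measurable_fun_continuous_comp (@cv_cont _ _ _ D)).
Qed.

Lemma measurable_fun_tube_density r :
  measurable_fun setT (fun p => tube_density r (s p) (x p)).
Proof.
apply: measurable_fun_ifT => //.
- by apply: measurable_fun_ltr => //; exact: measurable_fun_len2_disp.
- by apply: measurable_funM => //; exact: measurable_fun_dphi.
Qed.

End joint_measurability.

Lemma sqnorm_le_len2 (k x : 'I_n -> R) : dotv x x <= len2 k x.
Proof. by rewrite /len2 ler_peMr ?dotvv_ge0// tprof_ge1. Qed.

Lemma sqnormD_le (x y : 'I_n -> R) :
  dotv (fun i => x i + y i) (fun i => x i + y i) <= 2 * dotv x x + 2 * dotv y y.
Proof.
rewrite /dotv !mulr_sumr -big_split/=; apply: ler_sum => i _.
have : 0 <= (x i - y i) ^+ 2 by exact: sqr_ge0.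
by nra.
Qed.

Variables (e : R).
Hypotheses (e0 : 0 < e) (He : forall t x, dotv x x < e ^+ 2 ->
  [/\ 1 < 2 - dotv (Jv (ck D t)) x, `|tau (ck D t) x| <= 1,
      0 < csg D * dphi D t x & 0 <= pden (ck D t) x]).
Variables (r : R).
Hypotheses (re : r ^+ 2 <= (e / 4) ^+ 2).

Lemma len2_small t x : len2 (ck D t) x < r ^+ 2 -> dotv x x < (e / 4) ^+ 2.
Proof. by move=> /(le_lt_trans (sqnorm_le_len2 _ _)) /lt_le_trans; apply. Qed.

Let e4 : (e / 4) ^+ 2 < e ^+ 2.
Proof. by rewrite ltr_pXn2r ?nnegrE ?divr_ge0 ?ltW//; have := e0; lra. Qed.

Lemma tube_density_ge0 t x : 0 <= tube_density r t x.
Proof.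
rewrite /tube_density; case: ifPn => // /len2_small lt.
by case: (He t (lt_trans lt e4)) => _ _ /ltW.
Qed.

Variables (a b : R).
Hypotheses (a0 : 0 <= a) (ab : a <= b) (bL : b <= L).
Let w_diff t t' i := cw D t i - cw D t' i.
Hypothesis w_small : forall t t', t \in `[a, b] -> t' \in `[a, b] ->
  dotv (w_diff t t') (w_diff t t') <= (e / 4) ^+ 2.

(** The radius e / 2 fits between two needs. A point within e / 4 of some w t on the arc is good, as
    2 (e/4)^2 + 2 (e/4)^2 = (e/2)^2; a good point is within e of every w t on the arc, as 2 (e/2)^2
    + 2 (e/4)^2 < e^2. *)
Definition good (W : 'I_n -> R) := dotv (disp D a W) (disp D a W) <= (e / 2) ^+ 2.

Let aab : a \in `[a, b]. Proof. by rewrite in_itv/= lexx. Qed.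
Let bab : b \in `[a, b]. Proof. by rewrite in_itv/= lexx andbT. Qed.

Let disp_diff t t' W : disp D t W = (fun i => disp D t' W i + w_diff t' t i).
Proof. by apply/funext => i; rewrite /disp /w_diff; ring. Qed.

Lemma good_small W t : good W -> t \in `[a, b] -> dotv (disp D t W) (disp D t W) < e ^+ 2.
Proof.
move=> gW tab; rewrite (disp_diff t a); apply: (le_lt_trans (sqnormD_le (disp D a W) (w_diff a t))).
have := gW; have := w_small aab tab; rewrite /good.
have : 0 < e ^+ 2 by rewrite exprn_gt0.
rewrite !exprMn; set x := dotv _ _; set y := dotv _ _ => ? ? ?.
by lra.
Qed.

Lemma small_good W t : t \in `[a, b] -> dotv (disp D t W) (disp D t W) < (e / 4) ^+ 2 -> good W.
Proof.
move=> tab; rewrite /good (disp_diff a t) => h; apply: (le_trans (sqnormD_le (disp D t W) (w_diff t a))).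
have := h; have := w_small tab aab.
have : 0 < e ^+ 2 by rewrite exprn_gt0.
rewrite !exprMn; set x := dotv _ _; set y := dotv _ _ => ? ? ?.
by lra.
Qed.

Lemma good_C1 W : good W ->
  C1_itv a b (fun t => csg D * phi D t W) (fun t => csg D * dphi D t (disp D t W)).
Proof.
move=> gW; split.
- by move=> t _; apply: cvgM; [exact: cvg_cst|exact: continuous_phi].
- by move=> t _; apply: cvgM; [exact: cvg_cst|exact: continuous_dphi].
- move=> t tab.
  have [B1 _ _ _] := He t (good_small gW (subset_itv_oo_cc tab)).
  have t0L : t \in `]0, L[.
    by move: tab; rewrite !in_itv/= => /andP[? ?]; rewrite (le_lt_trans a0)// (lt_le_trans _ bL).
  have ? := is_derive_phi t0L B1.
  by apply: is_derive_eq; rewrite /GRing.scale/=; ring.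
Qed.

Lemma good_dphi W t : good W -> t \in `[a, b] -> 0 < csg D * dphi D t (disp D t W).
Proof. by move=> gW tab; have [] := He t (good_small gW tab). Qed.

Let sg2 (z : R) : csg D * (csg D * z) = z.
Proof.
rewrite mulrA; have := csg1 D; case: (ger0P (csg D)) => _ E; last first.
  by rewrite -[csg D]opprK E mulrNN !mul1r.
by rewrite E !mul1r.
Qed.

(** By monotonicity and the intermediate value theorem, the two extreme slices already decide
    whether some slice graph over [a, b] passes through p. This makes the condition measurable. *)
Definition valid (p : X * mR) : bool :=
  [&& dotv (disp D a (tnth p.1)) (disp D a (tnth p.1)) <= (e / 2) ^+ 2,
   csg D * phi D a (tnth p.1) <= csg D * p.2 & csg D * p.2 <= csg D * phi D b (tnth p.1)].

(** The inverse of t |-> phi t W. The default a keeps all values in [a, b]. *)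
Definition time_of (p : X * mR) : mR :=
  if valid p then get [set t | t \in `[a, b] /\ phi D t (tnth p.1) = p.2] else a.

Lemma good_mono W : good W -> {in `[a, b] &, {mono (fun t => csg D * phi D t W) : x y / x < y}}.
Proof.
move=> gW; exact/leW_mono_in/(le_mono_in (C1_increasing (good_C1 gW) (fun t => good_dphi gW))).
Qed.

Lemma good_inj W t t' : good W -> t \in `[a, b] -> t' \in `[a, b] ->
  phi D t W = phi D t' W -> t = t'.
Proof.
move=> gW tab t'ab tt'; have mono := good_mono gW.
case: (ltgtP t t') => // h; move: h.
  by rewrite -(mono t t' tab t'ab) /= tt' ltxx.
by rewrite -(mono t' t t'ab tab) /= tt' ltxx.
Qed.

Lemma time_ofP p : valid p -> time_of p \in `[a, b] /\ phi D (time_of p) (tnth p.1) = p.2.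
Proof.
move=> vp; rewrite /time_of vp; case/and3P: vp => gW pa pb.
have [t tab /(congr1 (fun y => csg D * y))] :=
  C1_surjective ab (good_C1 gW) (fun t => good_dphi gW) (introT andP (conj pa pb)).
rewrite /= !sg2 => tE; exact: (@getPex _ [set t | t \in `[a, b] /\ phi D t (tnth p.1) = p.2] (ex_intro _ t (conj tab tE))).
Qed.

Lemma valid_phi W t : good (tnth W) -> t \in `[a, b] -> valid (W, phi D t (tnth W)).
Proof.
move=> gW tab; rewrite /valid /= -/(good (tnth W)) gW/=.
have mono := le_mono_in (C1_increasing (good_C1 gW) (fun t => good_dphi gW)).
move: (tab); rewrite in_itv/= => /andP[ta tb].
by apply/andP; split; [have := mono a t aab tab; rewrite ta|have := mono t b tab bab; rewrite tb].
Qed.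

Lemma time_of_phi W t : good (tnth W) -> t \in `[a, b] -> time_of (W, phi D t (tnth W)) = t.
Proof.
move=> gW tab; have [tab' tE] := time_ofP (valid_phi gW tab).
exact: good_inj tab' tab tE.
Qed.

Lemma measurable_fun_fst_tnth i : measurable_fun setT (fun p : X * mR => tnth p.1 i : mR).
Proof. exact: measurableT_comp (@measurable_tnth_fun R n i) measurable_fst. Qed.

Let mf := measurable_fun_fst_tnth.

Let mphi c : measurable_fun setT (fun p : X * mR => csg D * phi D c (tnth p.1)).
Proof. by apply: measurable_funM => //; exact: measurable_fun_phi. Qed.

Let msnd : measurable_fun setT (fun p : X * mR => csg D * p.2).
Proof. by apply: measurable_funM => //; exact: measurable_snd. Qed.

Lemma measurable_valid : measurable_fun setT valid.
Proof.
have md i : measurable_fun setT (fun p : X * mR => disp D a (tnth p.1) i).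
  exact: measurable_fun_disp.
apply: measurable_and; last apply: measurable_and.
- by apply: measurable_fun_ler => //; exact: measurable_fun_dotv.
- exact: measurable_fun_ler.
- exact: measurable_fun_ler.
Qed.

Lemma measurable_set_of_bool dT (T : measurableType dT) (P : T -> bool) :
  measurable_fun setT P -> measurable [set x | P x].
Proof.
move=> mP; have := mP measurableT [set true] I; rewrite setTI.
by congr measurable; apply/seteqP; split => x /=.
Qed.

(** Superlevel sets are explicit: for a <= c < b, the time exceeds c exactly when p is valid and
    lies beyond the slice of time c. Points that are not valid have time a, hence never exceed such
    a c. *)
Lemma measurable_time_of : measurable_fun setT time_of.
Proof.
apply: (measurability _ (RGenOInfty.measurableE R)) => //= _ [_ [c ->] <-]; rewrite setTI.
have tab p : time_of p \in `[a, b].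
  rewrite /time_of; case: ifPn => // vp; have := time_ofP vp.
  by rewrite /time_of vp => -[].
have [ca|ac] := ltP c a.
  rewrite (_ : _ @^-1` _ = setT)//; apply/seteqP; split => // p _ /=.
  by have := tab p; rewrite !in_itv/= andbT => /andP[/(lt_le_trans ca)].
have [bc|cb] := leP b c.
  rewrite (_ : _ @^-1` _ = set0)//; apply/seteqP; split => // p /=.
  have := tab p; rewrite !in_itv/= andbT => /andP[_ /le_trans/(_ bc)].
  by rewrite leNgt => /negP.
rewrite (_ : _ @^-1` _ = [set p | valid p && (csg D * phi D c (tnth p.1) < csg D * p.2)]).
  apply: measurable_set_of_bool; apply: measurable_and; first exact: measurable_valid.
  exact: measurable_fun_ltr.
have cab : c \in `[a, b] by rewrite in_itv/= ac ltW.
apply/seteqP; split => p /=; rewrite !in_itv/= andbT.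
  have [vp|nv] := boolP (valid p); last by rewrite /time_of (negbTE nv) ltNge ac.
  move=> ct /=; have [tab' tE] := time_ofP vp; case/and3P: vp => gW _ _.
  by rewrite -tE; have := good_mono gW cab tab' => /= ->.
move=> /andP[vp]; have [tab' tE] := time_ofP vp; case/and3P: vp => gW _ _.
by rewrite -{1}tE; have := good_mono gW cab tab' => /= ->.
Qed.

Variable J : set mR.
Hypotheses (mJ : measurable J) (Jab : J `<=` `[a, b]%classic).

Definition tube_piece : set (X * mR) := [set p | exists2 t, J t &
  len2 (ck D t) (disp D t (tnth p.1)) < r ^+ 2 /\ p.2 = phi D t (tnth p.1)].

(** A point of the piece determines its time, so the quantifier over t is replaced by measurable
    conditions on [time_of]. *)
Lemma tube_pieceE : tube_piece = [set p | valid p] `&` ((time_of @^-1` J) `&`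
  [set p | len2 (ck D (time_of p)) (disp D (time_of p) (tnth p.1)) < r ^+ 2]).
Proof.
apply/seteqP; split => [[W z] [t Jt /= [lt ->]]|[W z] [/= vp [/= Jt lt]]].
  have tab := Jab Jt; have gW := small_good tab (len2_small lt).
  by rewrite time_of_phi//; split => //; exact: valid_phi.
by exists (time_of (W, z)) => //; split => //; have [_ ->] := time_ofP vp.
Qed.

Lemma measurable_tube_piece : measurable tube_piece.
Proof.
rewrite tube_pieceE; apply: measurableI.
  exact: measurable_set_of_bool measurable_valid.
apply: measurableI; first exact: measurable_preimage measurable_time_of mJ.
have m1 : measurable_fun setT (fun p : X * mR =>
    len2 (ck D (time_of p)) (disp D (time_of p) (tnth p.1))).
  apply: measurable_fun_len2_disp; first exact: measurable_time_of.
  by move=> i; apply: measurable_fun_disp => //; exact: measurable_time_of.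
exact: measurable_set_of_bool (measurable_fun_ltr m1 (measurable_cst _)).
Qed.

(** Over a good W the section is the image of the admissible times under t |-> phi t W.
    Multiplication by the sign [csg] preserves [lam] and makes this map increasing, as
    [lebesgue_image] requires. Over any other W there are no admissible times. *)
Lemma tube_piece_section (W : X) : lam [set z | tube_piece (W, z)] =
  (\int[lam]_(t in J) (tube_density r t (disp D t (tnth W)))%:E)%E.
Proof.
pose B : set mR := [set t | len2 (ck D t) (disp D t (tnth W)) < r ^+ 2].
have mB : measurable B.
  apply: measurable_set_of_bool; apply: measurable_fun_ltr => //.
  by apply: measurable_fun_len2_disp => // i; exact: measurable_fun_disp.
rewrite (_ : (\int[lam]_(t in J) _)%E =
    (\int[lam]_(t in J `&` B) (csg D * dphi D t (disp D t (tnth W)))%:E)%E); last first.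
  rewrite integral_mkcondr; apply: eq_integral => t _.
  rewrite /tube_density /patch; case: ifPn => lt; first by rewrite mem_set.
  by rewrite memNset//; exact/negP.
have [gW|ngW] := pselect (good (tnth W)); last first.
  have JB0 : J `&` B = set0.
    apply/seteqP; split => // t [Jt /len2_small Bt]; apply: ngW.
    exact: small_good (Jab Jt) Bt.
  rewrite JB0 integral_set0 (_ : mkset _ = set0) ?measure0//.
  by apply/seteqP; split => // z [t Jt [Bt _]]; have : (J `&` B) t by []; rewrite JB0.
have mS : measurable [set z | tube_piece (W, z)].
  apply: (@measurable_preimage _ _ _ _ (pair W)); last exact: measurable_tube_piece.
  exact: pair1_measurable.
rewrite -(@lebesgue_measure_isom R (csg D) 0 _ (csg1 D) mS).
pose h (y : mR) : mR := time_of (W, csg D * y).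
have mh : measurable_fun setT h.
  apply: measurableT_comp measurable_time_of _.
  by apply: measurable_fun_pair => //; apply: measurable_funM.
have hK : {in `[a, b], cancel (fun t => csg D * phi D t (tnth W)) h}.
  by move=> t tab; rewrite /h sg2 time_of_phi.
rewrite -(lebesgue_image ab (good_C1 gW) (fun t => good_dphi gW) mh hK); first last.
- by move=> t [/Jab].
- exact: measurableI.
congr (lam _); apply/seteqP; split => z /=.
  move=> [t Jt [Bt /=]]; rewrite addr0 => zE; exists t => //.
  by rewrite -zE sg2.
move=> [t [Jt Bt] <-]; exists t => //; split => //=; by rewrite addr0 sg2.
Qed.

(** Tonelli brings t outside; only then, with t fixed, can W be translated by w t. *)
Lemma tube_piece_volume : (\int[mu n]_W lam [set z | tube_piece (W, z)] =
  \int[lam]_(t in J) \int[mu n]_x (tube_density r t (tnth x))%:E)%E.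
Proof.
pose F (p : mR * X) : \bar R :=
  (\1_J p.1 * tube_density r p.1 (disp D p.1 (tnth p.2)))%:E.
have mF : measurable_fun setT F.
  apply/measurable_EFinP; apply: measurable_funM.
    exact: measurableT_comp (measurable_indic mJ) measurable_fst.
  apply: measurable_fun_tube_density => [|i]; first exact: measurable_fst.
  apply: measurable_fun_disp => [|j]; first exact: measurable_fst.
  exact: measurableT_comp (@measurable_tnth_fun R n j) measurable_snd.
have F0 p : (0 <= F p)%E by rewrite lee_fin mulr_ge0 ?tube_density_ge0.
have FJ t (g : R -> R) : ((\1_J t * g t)%:E = ((EFin \o g) \_ J) t)%E.
  by rewrite /patch indicE; case: ifP => _; rewrite ?mul1r ?mul0r.
transitivity (\int[mu n]_W \int[lam]_t F (t, W))%E.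
  apply: eq_integral => W _; rewrite tube_piece_section integral_mkcond.
  apply: eq_integral => t _; rewrite /F /=.
  exact: esym (FJ t (fun t => tube_density r t (disp D t (tnth W)))).
rewrite -(fubini_tonelli F mF F0) [RHS]integral_mkcond; apply: eq_integral => t _.
rewrite /fubini_F /F /= /patch indicE; case: ifP => _; last first.
  by under eq_integral do rewrite mul0r; rewrite integral0.
under eq_integral do rewrite mul1r.
have P := lebesgue_preserving_translation (cw D t).
rewrite -[RHS](ge0_integral_preserving P).
- apply: eq_integral => W _; congr (tube_density _ _ _)%:E.
  by apply/funext => i; rewrite tnth_mktuple.
- apply/measurable_EFinP; apply: measurable_fun_tube_density => // i.
  exact: measurable_tnth_fun.
- by move=> v; rewrite lee_fin tube_density_ge0.
Qed.

End piece.

(** * The mean of the density over a slice *)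

Section bounded_integrable.
Context dT (T : measurableType dT) (R : realType).
Variable nu : {measure set T -> \bar R}.

Lemma bounded_support_integrable (f : T -> R) (S : set T) (M : R) :
  measurable_fun setT f -> measurable S -> (nu S < +oo)%E -> 0 <= M ->
  (forall x, `|f x| <= M) -> (forall x, ~ S x -> f x = 0) ->
  nu.-integrable setT (EFin \o f).
Proof.
move=> mf mS Soo M0 fM fS.
have mg : measurable_fun setT ((cst M%:E) \_ S).
  by apply/(measurable_restrictT _ mS); exact: measurable_cst.
apply/integrableP; split; first exact/measurable_EFinP.
apply: (@le_lt_trans _ _ (\int[nu]_x ((cst M%:E) \_ S) x)%E).
  apply: ge0_le_integral => //.
  - by apply: measurableT_comp => //; exact/measurable_EFinP.
  - move=> x _; rewrite /patch; case: ifPn => xS; first by rewrite /= lee_fin.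
    by rewrite /= fS ?normr0// => /mem_set; rewrite (negbTE xS).
rewrite -integral_mkcond integral_cst//.
by rewrite lte_mul_pinfty// lee_fin.
Qed.

End bounded_integrable.

Section total.
Context {R : realType}.
Local Notation mR := (measurableTypeR R).
Local Notation lam := (@lebesgue_measure R).
Local Notation mu n := (@lebesgue_tuple R n).

Definition coord_box m (e : R) : set (m.-tuple mR) := [set v | forall i, `|tnth v i| <= e].

Lemma measurable_coord_box m e : measurable (@coord_box m e).
Proof.
rewrite (_ : coord_box e = \bigcap_(i in [set: 'I_m]) [set v : m.-tuple mR | `|tnth v i| <= e]).
  apply: fin_bigcap_measurable => // i _; apply: measurable_set_of_bool.
  apply: measurable_fun_ler => //; apply: measurableT_comp => //.
  exact: measurable_tnth_fun.
by apply/seteqP; split => [v H i _|v H i] /=; [exact: H|exact: (H i)].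
Qed.

Lemma not_coord_box m e (v : m.-tuple mR) : 0 < e -> ~ coord_box e v ->
  e ^+ 2 <= dotv (tnth v) (tnth v).
Proof.
move=> e0 nb; rewrite leNgt; apply/negP => /ltW h; apply: nb.
exact: coord_le_norm (ltW e0) h.
Qed.

Section primitive.
Variables (r : R).

(* The truncation of the derivative of [qprof] to the heights reached by
   geodesics of length less than r whose endpoint is at squared distance rho
   from the axis. *)
Definition cutoff (rho y : R) : R :=
  if rho * tprof y < r ^+ 2 then atan_defect y / 2 else 0.

Lemma cutoff_ge0 rho y : 0 <= cutoff rho y.
Proof. by rewrite /cutoff; case: ifP => // _; rewrite divr_ge0// atan_defect_ge0. Qed.

Lemma cutoff_le1 rho y : cutoff rho y <= 1.
Proof.
rewrite /cutoff; case: ifP => // _.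
by have /andP[_ ?] := atan_defect_bounds y; lra.
Qed.

Lemma cutoffN rho y : cutoff rho (- y) = cutoff rho y.
Proof. by rewrite /cutoff tprofN atan_defectN. Qed.

Let clamp01 (y : R) : R := Num.min 1 (Num.max 0 y).

Let clamp01_bounds y : 0 <= clamp01 y <= 1.
Proof. by rewrite le_min ler01 le_max lexx ge_min lexx. Qed.

(** Continuous approximations of [cutoff]: a ramp of slope m tends pointwise to the indicator of the
    positive numbers. It vanishes at 0, which agrees with the strict inequality in [cutoff]. *)
Definition cutoff_ (rho : R) (m : nat) (y : R) : R :=
  clamp01 (m%:R * (r ^+ 2 - rho * tprof y)) * (atan_defect y / 2).

Lemma continuous_cutoff_ rho m : continuous (cutoff_ rho m).
Proof.
move=> y; apply: cvgM; last by apply: cvgMl; exact: continuous_atan_defect.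
have ch : {for y, continuous (fun y : R => m%:R * (r ^+ 2 - rho * tprof y))}.
  apply: cvgM; first exact: cvg_cst.
  apply: cvgB; first exact: cvg_cst.
  apply: cvgM; first exact: cvg_cst.
  exact: continuous_tprof.
apply: (@continuous_min _ _ (cst 1) (fun y => Num.max 0 _)); first exact: cvg_cst.
by apply: (@continuous_max _ _ (cst 0)); first exact: cvg_cst.
Qed.

Lemma cutoff_le rho m y : `|cutoff_ rho m y| <= 1.
Proof.
have /andP[c0 c1] := clamp01_bounds (m%:R * (r ^+ 2 - rho * tprof y)).
have /andP[_ d3] := atan_defect_bounds y; have d0 := atan_defect_ge0 y.
rewrite /cutoff_ normrM !ger0_norm ?divr_ge0//.
rewrite -[X in _ <= X]mulr1; apply: ler_pM => //; first by rewrite divr_ge0.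
by lra.
Qed.

Lemma cvg_cutoff rho y : cutoff_ rho m y @[m --> \oo] --> cutoff rho y.
Proof.
rewrite /cutoff; case: ltP => h.
  rewrite -[X in _ --> X]mul1r; apply: cvgMl.
  apply: cvg_near_cst; near=> m.
  have : (r ^+ 2 - rho * tprof y)^-1 <= m%:R by near: m; exact: nbhs_infty_ger.
  rewrite -(ler_pM2r (_ : 0 < r ^+ 2 - rho * tprof y)) ?subr_gt0// mulVf; last first.
    by rewrite gt_eqF// subr_gt0.
  move=> h1; rewrite /clamp01 max_r ?(le_trans ler01)// min_l//.
rewrite -[X in _ --> X](mul0r (atan_defect y / 2)); apply: cvgMl.
apply: cvg_near_cst; near=> m.
rewrite /clamp01 max_l ?min_r//.
by rewrite mulr_ge0_le0// subr_le0.
Unshelve. all: by end_near. Qed.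

Lemma measurable_cutoff dT (T : measurableType dT) (f g : T -> R) :
  measurable_fun setT f -> measurable_fun setT g ->
  measurable_fun setT (fun x => cutoff (f x) (g x)).
Proof.
move=> mf mg; apply: measurable_fun_ifT => //.
  apply: measurable_fun_ltr => //; apply: measurable_funM => //.
  exact: (measurable_fun_continuous_comp continuous_tprof).
apply: measurable_funM => //.
exact: (measurable_fun_continuous_comp continuous_atan_defect).
Qed.

Definition cutoff_int (rho y : R) : \bar R :=
  (\int[lam]_(t in `[(-2)%R, y]) (cutoff rho t)%:E)%E.

Lemma cutoff_int_ge0 rho y : (0 <= cutoff_int rho y)%E.
Proof. by apply: integral_ge0 => t _; rewrite lee_fin cutoff_ge0. Qed.

Let mcut rho (S : set mR) : measurable_fun S (fun t => (cutoff rho t)%:E).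
Proof.
apply/measurable_EFinP; apply: measurable_funTS; apply: measurable_cutoff => //.
Qed.

Lemma cutoff_int_le rho y : `|y| <= 1 -> (cutoff_int rho y <= 4%:E)%E.
Proof.
rewrite ler_norml => /andP[y1 y2].
apply: (@le_trans _ _ (\int[lam]_(t in `[(-2)%R, y]) (cst 1%:E) t)%E).
  apply: ge0_le_integral => //.
  - by move=> t _; rewrite lee_fin cutoff_ge0.
  - by move=> t _; rewrite lee_fin cutoff_le1.
rewrite integral_cst//= lebesgue_measure_itv/= lte_fin mul1e.
by case: ifP => _; rewrite ?lee_fin//; lra.
Qed.

Lemma cutoff_int_fin rho y : `|y| <= 1 -> cutoff_int rho y \is a fin_num.
Proof.
move=> y1; rewrite ge0_fin_numE ?cutoff_int_ge0//.
exact: le_lt_trans (cutoff_int_le _ y1) (ltry _).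
Qed.

(** As [cutoff] is even, the integral from -2 to - y equals the integral from y to 2, and the two
    pieces fill [-2, 2]. *)
Lemma cutoff_intN rho y : `|y| <= 1 ->
  (cutoff_int rho y + cutoff_int rho (- y)%R = cutoff_int rho 2)%E.
Proof.
rewrite ler_norml => /andP[y1 y2].
have E : cutoff_int rho (- y) = (\int[lam]_(t in `]y, 2%R]) (cutoff rho t)%:E)%E.
  rewrite /cutoff_int.
  rewrite -integral_itv_obnd_cbnd//; last exact: mcut.
  pose N (x : mR) : mR := -1 * x + 0.
  have mN : measurable_fun setT N by apply: measurable_funD => //; exact: measurable_funM.
  transitivity (\int[pushforward lam N]_(t in `](-2)%R, (- y)%R]) (cutoff rho t)%:E)%E.
    apply: eq_measure_integral => A mA _.
    exact: esym (@lebesgue_measure_isom R (-1) 0 A (@normrN1 _) mA).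
  rewrite (ge0_integral_pushforward mN)//; first last.
  - by move=> t _; rewrite lee_fin cutoff_ge0.
  have -> : N @^-1` `]-2, - y]%classic = `[y, 2%R[%classic.
    by apply/seteqP; split => t /=; rewrite /N !in_itv/= => /andP[? ?]; apply/andP; split; lra.
  transitivity (\int[lam]_(t in `[y, 2%R[) (cutoff rho t)%:E)%E.
    by apply: eq_integral => t _; rewrite /= /N mulN1r addr0 cutoffN.
  rewrite integral_itv_bndo_bndc; last exact: mcut.
  rewrite -integral_itv_obnd_cbnd; last exact: mcut.
  by [].
have U : `[(-2)%R, 2%R]%classic = `[(-2)%R, y]%classic `|` `]y, 2%R]%classic.
  by rewrite -itv_bndbnd_setU ?bnd_simp//; lra.
rewrite E /cutoff_int U ge0_integral_setU//=.
- by move=> t _; rewrite lee_fin cutoff_ge0.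
- apply/disj_set2P/seteqP; split => // t [/=]; rewrite !in_itv/= => /andP[_ h1] /andP[h2 _].
  by move: h1; rewrite leNgt h2.
Qed.

Lemma cutoff_int_eq0 rho y : r ^+ 2 <= rho -> cutoff_int rho y = 0%E.
Proof.
move=> rrho; rewrite /cutoff_int (eq_integral (cst 0%E)) ?integral0// => t _.
rewrite /cutoff ltNge (le_trans rrho)// ler_peMr ?tprof_ge1//.
by apply: le_trans rrho; rewrite sqr_ge0.
Qed.

Lemma measurable_cutoff_int dT (T : measurableType dT) (f g : T -> R) :
  measurable_fun setT f -> measurable_fun setT g ->
  measurable_fun setT (fun x => cutoff_int (f x) (g x)).
Proof.
move=> mf mg.
pose h (p : T * mR) : \bar R :=
  (if (-2 <= p.2) && (p.2 <= g p.1) then cutoff (f p.1) p.2 else 0)%:E.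
have mf1 := measurableT_comp mf (@measurable_fst _ _ T mR).
have mg1 := measurableT_comp mg (@measurable_fst _ _ T mR).
have m2 := @measurable_snd _ _ T mR.
have mh : measurable_fun setT h.
  apply/measurable_EFinP; apply: measurable_fun_ifT => //.
    by apply: measurable_and; apply: measurable_fun_ler.
  exact: measurable_cutoff.
have h0 p : (0 <= h p)%E by rewrite lee_fin; case: ifP => // _; exact: cutoff_ge0.
have := measurable_fun_fubini_tonelli_F (m2 := lam) h mh h0.
congr measurable_fun; apply/funext => x; rewrite /fubini_F /cutoff_int.
rewrite [RHS]integral_mkcond; apply: eq_integral => t _; rewrite /h /patch /= mem_setE in_itv/=.
by case: ifP.
Qed.

End primitive.

Section curve.
Context {d : nat} {L : R} (D : curve_data d L).
Local Notation n := (d + d)%N.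
Local Notation X := (n.-tuple mR).
Variables (e M r : R).
Hypotheses (L0 : 0 <= L) (e0 : 0 < e) (He : forall t x, dotv x x < e ^+ 2 ->
  [/\ 1 < 2 - dotv (Jv (ck D t)) x, `|tau (ck D t) x| <= 1,
      0 < csg D * dphi D t x & 0 <= pden (ck D t) x])
  (Hb : forall t x, dotv x x < e ^+ 2 ->
    pden (ck D t) x <= M /\ `|kden (ck D t) (cl D t) x| <= M).
Hypotheses (re : r ^+ 2 <= (e / 4) ^+ 2).

Let re' : r ^+ 2 < e ^+ 2.
Proof.
apply: le_lt_trans re _.
by rewrite ltr_pXn2r ?nnegrE ?divr_ge0 ?ltW//; have := e0; lra.
Qed.

Definition truncated (k x : 'I_n -> R) (y : R) := if len2 k x < r ^+ 2 then y else 0.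

Lemma truncated_bound k x y : (dotv x x < e ^+ 2 -> `|y| <= M) -> 0 <= M ->
  `|truncated k x y| <= M.
Proof.
rewrite /truncated => yM M0; case: ifPn => [h|_]; last by rewrite normr0.
by apply: yM; apply: le_lt_trans (sqnorm_le_len2 _ _) (lt_trans h re').
Qed.

Lemma truncated_eq0 k x y : e ^+ 2 <= dotv x x -> truncated k x y = 0.
Proof.
move=> ex; rewrite /truncated ltNge; case: ifPn => //.
by rewrite (le_trans _ (sqnorm_le_len2 _ _))// (le_trans (ltW re')).
Qed.

Lemma tube_density_split t x : tube_density D r t x =
  csg D * cv D t * truncated (ck D t) x (pden (ck D t) x) +
  csg D * truncated (ck D t) x (kden (ck D t) (cl D t) x).
Proof.
rewrite /tube_density /truncated /dphi; case: ifP => _; first by rewrite mulrDr mulrA.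
by rewrite !mulr0 addr0.
Qed.

Definition slice_mass (k : 'I_n -> R) : \bar R :=
  (\int[mu n]_x (truncated k (tnth x) (pden k (tnth x)))%:E)%E.

(** Truncating [height] would not give a primitive of the truncated [kden], because the truncation
    jumps as k varies. Integrating the cut-off derivative in [tau] does. *)
Definition height_mass (k x : 'I_n -> R) : R :=
  dotv x x * fine (cutoff_int r (dotv x x) (tau k x)).

Lemma measurable_height_mass (k : 'I_n -> R) (s : R) :
  measurable_fun setT (fun v : X => dotv (tnth v) (tnth v) *
    fine (cutoff_int r (dotv (tnth v) (tnth v)) (s * tau k (tnth v)))).
Proof.
have mt (i : 'I_n) : measurable_fun setT (fun v : X => tnth v i : R) by exact: measurable_tnth_fun.
apply: measurable_funM; first exact: measurable_fun_dotv.
apply: measurableT_comp => //; apply: measurable_cutoff_int; first exact: measurable_fun_dotv.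
by apply: measurable_funM => //; apply: measurable_fun_tau.
Qed.

Lemma height_mass_bound t x s : `|s| = 1 ->
  `|dotv x x * fine (cutoff_int r (dotv x x) (s * tau (ck D t) x))| <= e ^+ 2 * 4.
Proof.
move=> s1; have [xe|ex] := ltP (dotv x x) (e ^+ 2); last first.
  rewrite cutoff_int_eq0; last exact: le_trans (ltW re') ex.
  by rewrite /= mulr0 normr0 mulr_ge0 ?sqr_ge0.
have [_ t1 _ _] := He t xe.
have st1 : `|s * tau (ck D t) x| <= 1 by rewrite normrM s1 mul1r.
rewrite ger0_norm; last by rewrite mulr_ge0 ?dotvv_ge0// fine_ge0// cutoff_int_ge0.
apply: ler_pM; [exact: dotvv_ge0|by rewrite fine_ge0// cutoff_int_ge0|exact: ltW|].
by rewrite -lee_fin fineK ?cutoff_int_fin// cutoff_int_le.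
Qed.

Lemma height_mass_integrable t s : `|s| = 1 ->
  (mu n).-integrable setT (fun v : X => (dotv (tnth v) (tnth v) *
    fine (cutoff_int r (dotv (tnth v) (tnth v)) (s * tau (ck D t) (tnth v))))%:E).
Proof.
move=> s1; apply: (@bounded_support_integrable _ _ _ _ _ (@coord_box n e) (e ^+ 2 * 4)).
- exact: measurable_height_mass.
- exact: measurable_coord_box.
- exact: lebesgue_tuple_box.
- by rewrite mulr_ge0 ?sqr_ge0.
- by move=> x; exact: height_mass_bound.
- move=> x /(not_coord_box e0) ex; rewrite cutoff_int_eq0 ?mulr0//; exact: le_trans (ltW re') ex.
Qed.

(* [cutoff] is even, so reflecting the slice along k shows that the integral of
   [height_mass] is half the integral of a quantity that does not involve k. *)
Lemma height_mass_const t t' :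
  (\int[mu n]_v (height_mass (ck D t) (tnth v))%:E =
   \int[mu n]_v (height_mass (ck D t') (tnth v))%:E)%E.
Proof.
pose c := (\int[mu n]_(v in [set: X])
  (dotv (tnth v) (tnth v) * fine (cutoff_int r (dotv (tnth v) (tnth v)) 2))%:E)%E.
(* Finiteness of the integral is part of the claim, since a is to be recovered from a + a = c. *)
have E s : exists2 a : R, (\int[mu n]_v (height_mass (ck D s) (tnth v))%:E = a%:E)%E &
    ((a + a)%:E = c)%E.
  pose F rho A B := rho * fine (cutoff_int r rho (A * ginv (2 - B))).
  have H := @integral_reflection R d F (ck D s).
  have I1 := @height_mass_integrable s 1 (normr1 _).
  have I2 := @height_mass_integrable s (-1) (@normrN1 _).
  have E1 : (\int[mu n]_v (height_mass (ck D s) (tnth v))%:E)%E =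
      (\int[mu n]_v (dotv (tnth v) (tnth v) *
    fine (cutoff_int r (dotv (tnth v) (tnth v)) (1 * tau (ck D s) (tnth v))))%:E)%E.
    by apply: eq_integral => v _; rewrite mul1r.
  have E2 : (\int[mu n]_v (height_mass (ck D s) (tnth v))%:E)%E =
      (\int[mu n]_v (dotv (tnth v) (tnth v) *
    fine (cutoff_int r (dotv (tnth v) (tnth v)) (-1 * tau (ck D s) (tnth v))))%:E)%E.
    rewrite [LHS](H _ _); last 2 first.
    - move=> k; apply/measurable_EFinP.
      have := measurable_height_mass k 1; congr measurable_fun.
      by apply/funext => v; rewrite mul1r.
    - move=> k; apply/measurable_EFinP.
      have := measurable_height_mass k (-1); congr measurable_fun.
      by apply/funext => v; rewrite /F /tau mulN1r mulNr.
    by apply: eq_integral => v _; rewrite /F /tau mulN1r mulNr.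
  have fin : (\int[mu n]_v (height_mass (ck D s) (tnth v))%:E)%E \is a fin_num.
    by rewrite E1; exact: integrable_fin_num I1.
  set I := (\int[mu n]_v _)%E in E1 E2 fin *.
  have IE : I = (fine I)%:E := esym (fineK fin).
  exists (fine I); first exact: IE.
  rewrite EFinD -IE [X in (X + _)%E]E1 [X in (_ + X)%E]E2.
  rewrite -(integralD measurableT I1 I2).
  apply: eq_integral => v _; rewrite -EFinD -mulrDr; congr (_%:E); congr (_ * _).
  have [xe|ex] := ltP (dotv (tnth v) (tnth v)) (e ^+ 2); last first.
    have rx := le_trans (ltW re') ex.
    rewrite (cutoff_int_eq0 (1 * _) rx) (cutoff_int_eq0 (-1 * _) rx) (cutoff_int_eq0 2 rx).
    exact: addr0.
  have [_ t1 _ _] := He s xe.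
  have t2 : `|1 * tau (ck D s) (tnth v)| <= 1 by rewrite mul1r.
  have t3 : `|-1 * tau (ck D s) (tnth v)| <= 1 by rewrite mulN1r normrN.
  rewrite -(fineD (cutoff_int_fin _ _ t2) (cutoff_int_fin _ _ t3)).
  rewrite [1 * _]mul1r [-1 * _]mulN1r (cutoff_intN _ _ t1).
  exact: erefl.
have [x -> xc] := E t; have [y -> yc] := E t'.
have [h] : (x + x)%:E = (y + y)%:E by rewrite xc yc.
by congr (_%:E); lra.
Qed.

Let mI : measurable (`[0, L]%classic : set mR). Proof. exact: measurable_itv. Qed.

(* For a fixed x, the truncated [kden] is the derivative in time of [height_mass]. *)
Lemma integral_kden (x : 'I_n -> R) :
  (\int[lam]_(t in `[0%R, L]) (truncated (ck D t) x (kden (ck D t) (cl D t) x))%:E =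
   (height_mass (ck D L) x - height_mass (ck D 0) x)%:E)%E.
Proof.
have [xe|ex] := ltP (dotv x x) (e ^+ 2); last first.
  rewrite (eq_integral (cst 0%E)); last by move=> t _; rewrite truncated_eq0.
  rewrite integral0 /height_mass !cutoff_int_eq0 ?mulr0 ?subrr//;
  exact: le_trans (ltW re') ex.
pose f t := tau (ck D t) x; pose df t := dtau (ck D t) (cl D t) x.
have C1f : C1_itv 0 L f df.
  split => [t _|t _|t t0L].
  - by apply: continuous_tau => i; [exact: ck_cont|exact: cvg_cst].
  - by apply: continuous_dtau => i; [exact: ck_cont|exact: cl_cont|exact: cvg_cst].
  - have [B1 _ _ _] := He t xe.
    have := is_derive_tau (fun i => ck_der D i t0L) (fun i => is_derive_cst (x i) t 1) B1.
    have z a : dotv a (fun=> 0) = 0 :> R by rewrite /dotv big1// => i _; rewrite mulr0.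
    by rewrite !z mulr0 !mul0r !addr0.
have f1 t : t \in `[0, L] -> `|f t| <= 1 by move=> _; have [] := He t xe.
have := integral_comp_limit L0 C1f f1 (@continuous_cutoff_ r (dotv x x))
  (@cutoff_le r (dotv x x)) (@cvg_cutoff r (dotv x x))
  (measurable_cutoff _ (measurable_cst _) (@measurable_id _ mR _)).
move=> E.
have cont : continuous df.
  by move=> t; apply: continuous_dtau => i; [exact: ck_cont|exact: cl_cont|exact: cvg_cst].
transitivity ((dotv x x)%:E * \int[lam]_(t in `[0%R, L])
   (cutoff r (dotv x x) (f t) * df t)%:E)%E; last first.
  have i0 : (0 : R) \in `[0, L] by rewrite in_itv/= lexx.
  have iL : L \in `[0, L] by rewrite in_itv/= lexx andbT.
  rewrite E -/(cutoff_int _ _ _) -/(cutoff_int _ _ _).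
  rewrite -(fineK (cutoff_int_fin r (dotv x x) (f1 _ i0))).
  rewrite -(fineK (cutoff_int_fin r (dotv x x) (f1 _ iL))).
  by rewrite -EFinB -EFinM mulrBr.
have contf : continuous f.
  by move=> t; apply: continuous_tau => i; [exact: ck_cont|exact: cvg_cst].
have mc : measurable_fun setT (fun t : mR => cutoff r (dotv x x) (f t) * df t).
  apply: measurable_funM; last exact: continuous_measurable_fun.
  by apply: measurable_cutoff => //; exact: continuous_measurable_fun.
rewrite -integralZl//; last first.
  have idf : lam.-integrable (`[0, L]%classic : set mR) (EFin \o df).
    apply: continuous_compact_integrable; first exact: segment_compact.
    exact: continuous_subspaceT.
  apply: (le_integrable mI _ _ idf); first exact/measurable_EFinP/measurable_funTS.
  move=> t _; rewrite /= lee_fin normrM ler_piMl//.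
  by rewrite ger0_norm ?cutoff_ge0 ?cutoff_le1.
apply: eq_integral => t _; rewrite -EFinM; congr (_%:E).
rewrite /truncated /cutoff /len2 /kden -/(f t) -/(df t).
by case: ifP => _; rewrite ?mul0r ?mulr0// mulrA.
Qed.

End curve.
End total.

Section total.
Context {R : realType}.
Local Notation mR := (measurableTypeR R).
Local Notation lam := (@lebesgue_measure R).
Local Notation mu n := (@lebesgue_tuple R n).
Context {d : nat} {L : R} (D : curve_data d L).
Local Notation n := (d + d)%N.
Local Notation X := (n.-tuple mR).

Lemma measurable_truncated r (k : 'I_n -> R) (F : ('I_n -> R) -> R) :
  measurable_fun setT (fun v : X => F (tnth v)) ->
  measurable_fun setT (fun v : X => truncated r k (tnth v) (F (tnth v))).
Proof.
move=> mF; apply: measurable_fun_ifT => //.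
apply: measurable_fun_ltr => //; apply: measurable_fun_len2 => // i.
exact: measurable_tnth_fun.
Qed.

(** The truncated [pden] sees x only through its norm and its products with k and J k. The remaining
    occurrence of k, its squared norm, is frozen as a constant in F. *)
Lemma slice_mass_norm r (k k' : 'I_n -> R) : dotv k k = dotv k' k' ->
  slice_mass r k = slice_mass r k'.
Proof.
move=> kk'; pose tb A B : R := A * ginv (2 - B).
pose F rho A B : R := if rho * tprof (tb A B) < r ^+ 2 then
  (2 - B) / 2 + 2 * A * qprof (tb A B) +
    rho * (atan_defect (tb A B) / 2) * (dotv k k * ginv (2 - B)) else 0.
have mt (i : 'I_n) : measurable_fun setT (fun v : X => tnth v i : R) by exact: measurable_tnth_fun.
rewrite -[slice_mass r k']/(\int[mu n]_x (truncated r k' (tnth x) (pden k' (tnth x)))%:E)%E.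
transitivity (\int[mu n]_x (F (dotv (tnth x) (tnth x)) (dotv k' (tnth x))
  (dotv (Jv k') (tnth x)))%:E)%E; last first.
  by apply: eq_integral => x _; rewrite /F kk'.
apply: (@integral_norm_eq R d F k k' _ kk') => h; apply/measurable_EFinP.
have mB : measurable_fun setT (fun v : X => 2 - dotv (Jv h) (tnth v)).
  by apply: measurable_funB => //; apply: measurable_fun_dotv => // i.
have mtau : measurable_fun setT (fun v : X => tau h (tnth v)) by exact: measurable_fun_tau.
apply: (measurable_truncated r h (F := fun x => (2 - dotv (Jv h) x) / 2 +
   2 * dotv h x * qprof (tau h x) + dotv x x * (atan_defect (tau h x) / 2) *
   (dotv k k * ginv (2 - dotv (Jv h) x)))).
apply: measurable_funD; last first.
  apply: measurable_funM.
    apply: measurable_funM; first exact: measurable_fun_dotv.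
    apply: measurable_funM => //.
    exact: (measurable_fun_continuous_comp continuous_atan_defect).
  apply: measurable_funM => //.
  exact: (measurable_fun_continuous_comp continuous_ginv).
apply: measurable_funD; first exact: measurable_funM.
apply: measurable_funM.
  by apply: measurable_funM => //; exact: measurable_fun_dotv.
exact: (measurable_fun_continuous_comp continuous_qprof).
Qed.

Variables (e M r : R).
Hypotheses (L0 : 0 <= L) (e0 : 0 < e) (He : forall t x, dotv x x < e ^+ 2 ->
  [/\ 1 < 2 - dotv (Jv (ck D t)) x, `|tau (ck D t) x| <= 1,
      0 < csg D * dphi D t x & 0 <= pden (ck D t) x])
  (Hb : forall t x, dotv x x < e ^+ 2 ->
    pden (ck D t) x <= M /\ `|kden (ck D t) (cl D t) x| <= M).
Hypotheses (re : r ^+ 2 <= (e / 4) ^+ 2).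

Let mI : measurable (`[0, L]%classic : set mR). Proof. exact: measurable_itv. Qed.

Let M0 : 0 <= M.
Proof.
have x0 : dotv (fun _ : 'I_n => 0 : R) (fun=> 0) < e ^+ 2.
  by rewrite /dotv big1 ?exprn_gt0// => i _; rewrite mulr0.
by have [_ /(le_trans (normr_ge0 _))] := Hb 0 x0.
Qed.

Let mtrunc (F : R -> ('I_n -> R) -> R) :
  measurable_fun setT (fun p : mR * X => F p.1 (tnth p.2)) ->
  measurable_fun setT (fun p : mR * X => truncated r (ck D p.1) (tnth p.2) (F p.1 (tnth p.2))).
Proof.
move=> mF; apply: measurable_fun_ifT => //.
apply: measurable_fun_ltr => //; apply: measurable_fun_len2_disp; first exact: measurable_fst.
by move=> i; exact: measurableT_comp (@measurable_tnth_fun R n i) measurable_snd.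
Qed.

Let mfst (g : R -> R) : continuous g -> measurable_fun setT (fun p : mR * X => g p.1).
Proof. by move=> cg; apply: measurable_fun_continuous_comp => //; exact: measurable_fst. Qed.

Let msndi i : measurable_fun setT (fun p : mR * X => tnth p.2 i : R).
Proof. exact: measurableT_comp (@measurable_tnth_fun R n i) measurable_snd. Qed.

Let mind : measurable_fun setT (fun p : mR * X => \1_(`[0, L]%classic : set mR) p.1 : R).
Proof. exact: measurableT_comp (measurable_indic mI) measurable_fst. Qed.

(** The two summands of the density are integrated separately, and [FK] has no sign. Exchanging its
    integrals needs integrability, which comes from the bound M and the box of finite measure
    [S]. *)
Let FP (p : mR * X) : R := \1_(`[0, L]%classic : set mR) p.1 *
  (csg D * cv D p.1 * truncated r (ck D p.1) (tnth p.2) (pden (ck D p.1) (tnth p.2))).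

Let FK (p : mR * X) : R := \1_(`[0, L]%classic : set mR) p.1 *
  (csg D * truncated r (ck D p.1) (tnth p.2) (kden (ck D p.1) (cl D p.1) (tnth p.2))).

Let S : set (mR * X) := `[0, L]%classic `*` @coord_box R n e.

Let mS : measurable S. Proof. by apply: measurableX => //; exact: measurable_coord_box. Qed.

Let Soo : ((lam \x mu n) S < +oo)%E.
Proof.
rewrite /S product_measure1E//; last exact: measurable_coord_box.
rewrite lte_mul_pinfty//; last exact: lebesgue_tuple_box.
change (lam (`[0, L]%classic : set mR) \is a fin_num).
by rewrite lebesgue_measure_itv/=; case: ifP.
Qed.

Let out (p : mR * X) (F : R) : ~ S p ->
  \1_(`[0, L]%classic : set mR) p.1 * truncated r (ck D p.1) (tnth p.2) F = 0.
Proof.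
move=> nS; have [tI|tI] := pselect ((`[0, L]%classic : set mR) p.1); last first.
  by rewrite indicE memNset// mul0r.
rewrite (truncated_eq0 e0 re) ?mulr0//; apply: (not_coord_box e0) => bp; exact: nS.
Qed.

Let ind_le t (y B : R) : `|y| <= B -> `|\1_(`[0, L]%classic : set mR) t * y| <= B.
Proof.
move=> yB; rewrite indicE; case: (_ \in _); rewrite ?mul1r//.
by rewrite mul0r normr0 (le_trans _ yB).
Qed.

Let iFP : (lam \x mu n)%E.-integrable setT (EFin \o FP).
Proof.
apply: (@bounded_support_integrable _ _ _ _ _ S M) => //.
- apply: measurable_funM => //; apply: measurable_funM.
    by apply: measurable_funM => //; apply: mfst; exact: cv_cont.
  apply: (mtrunc (F := fun t x => pden (ck D t) x)); apply: measurable_fun_pden => i.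
    by apply: (mfst (g := fun t => ck D t i)); exact: ck_cont.
  exact: msndi.
- move=> p; apply: ind_le; rewrite normrM normrM csg1 mul1r -[X in _ <= X]mul1r.
  apply: ler_pM => //; first exact: cv_le.
  apply: (truncated_bound e0 re) => // h; have [_ _ _ p0] := He p.1 h.
  by rewrite ger0_norm//; have [] := Hb p.1 h.
- by move=> p nS; rewrite /FP mulrCA out// mulr0.
Qed.

Let iFK : (lam \x mu n)%E.-integrable setT (EFin \o FK).
Proof.
apply: (@bounded_support_integrable _ _ _ _ _ S M) => //.
- apply: measurable_funM => //; apply: measurable_funM => //.
  apply: (mtrunc (F := fun t x => kden (ck D t) (cl D t) x)).
  apply: measurable_fun_kden => i.
  + by apply: (mfst (g := fun t => ck D t i)); exact: ck_cont.
  + by apply: (mfst (g := fun t => cl D t i)); exact: cl_cont.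
  + exact: msndi.
- move=> p; apply: ind_le; rewrite normrM csg1 mul1r.
  by apply: (truncated_bound e0 re) => // h; have [] := Hb p.1 h.
- by move=> p nS; rewrite /FK mulrCA out// mulr0.
Qed.

Let int_ind (g : R -> R) : (\int[lam]_(t in `[0%R, L]) (g t)%:E =
  \int[lam]_t (\1_(`[0, L]%classic : set mR) t * g t)%:E)%E.
Proof.
rewrite integral_mkcond; apply: eq_integral => t _.
by rewrite /patch indicE; case: ifP => _; rewrite ?mul1r ?mul0r.
Qed.

(** Integrating in time first, at fixed x, leaves the increment of [height_mass] between 0 and L,
    and the two end values have the same integral over x. *)
Let FK0 : (\int[lam \x mu n]_p (FK p)%:E = 0)%E.
Proof.
rewrite -(integral21_prod_meas1 iFK) /fubini_G /=.
have I1 := height_mass_integrable e0 He re L (normr1 _).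
have I0 := height_mass_integrable e0 He re 0 (normr1 _).
have E s v : height_mass r (ck D s) v = dotv v v * fine (cutoff_int r (dotv v v) (1 * tau (ck D s) v)).
  by rewrite mul1r.
have IL : (mu n).-integrable setT (fun v => (height_mass r (ck D L) (tnth v))%:E).
  by move: I1; congr integrable; apply/funext => v; rewrite E.
have I0' : (mu n).-integrable setT (fun v => (height_mass r (ck D 0) (tnth v))%:E).
  by move: I0; congr integrable; apply/funext => v; rewrite E.
transitivity (\int[mu n]_v ((csg D)%:E * ((height_mass r (ck D L) (tnth v))%:E -
    (height_mass r (ck D 0) (tnth v))%:E)))%E.
  apply: eq_integral => v _.
  rewrite -EFinB -(integral_kden L0 e0 He re) int_ind.
  under eq_integral do rewrite /FK /= mulrCA EFinM.
  rewrite integralZl//.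
  apply: (@bounded_support_integrable _ _ _ _ _ (`[0, L]%classic : set mR) M) => //.
  - have mG : measurable_fun setT (fun p : mR * X => \1_(`[0, L]%classic : set mR) p.1 *
        truncated r (ck D p.1) (tnth p.2) (kden (ck D p.1) (cl D p.1) (tnth p.2))).
      apply: measurable_funM => //.
      apply: (mtrunc (F := fun t x => kden (ck D t) (cl D t) x)).
      apply: measurable_fun_kden => i.
      + by apply: (mfst (g := fun t => ck D t i)); exact: ck_cont.
      + by apply: (mfst (g := fun t => cl D t i)); exact: cl_cont.
      + exact: msndi.
    exact: measurableT_comp mG (pair2_measurable v).
  - change (lam (`[0%R, L]%classic : set mR) < +oo)%E.
    by rewrite lebesgue_measure_itv/=; case: ifP => _; rewrite -?EFinB ltry.
  - move=> t; apply: ind_le; apply: (truncated_bound e0 re) => // h.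
    by have [] := Hb t h.
  - by move=> t tI; rewrite indicE memNset// mul0r.
rewrite integralZl//; last exact: integrableB.
rewrite integralB// (height_mass_const e0 He re L 0) subee ?mule0//.
exact: integrable_fin_num I0'.
Qed.

Lemma integral_tube_density :
  (\int[lam]_(t in `[0%R, L]) \int[mu n]_x (tube_density D r t (tnth x))%:E =
   \int[lam]_(t in `[0%R, L]) ((`|cv D t|)%:E * slice_mass r (ck D t)))%E.
Proof.
transitivity (\int[lam \x mu n]_p ((FP p)%:E + (FK p)%:E))%E.
  have i : (lam \x mu n)%E.-integrable setT (fun p => (FP p)%:E + (FK p)%:E)%E.
    exact: integrableD.
  rewrite -(integral12_prod_meas1 i) /fubini_F integral_mkcond.
  apply: eq_integral => t _; rewrite /patch; case: ifPn => tI; last first.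
    rewrite (eq_integral (cst 0%E)) ?integral0// => x _.
    by rewrite /FP /FK indicE /= (negbTE tI) !mul0r adde0.
  apply: eq_integral => x _; rewrite tube_density_split.
  by rewrite /FP /FK /= indicE tI !mul1r.
rewrite integralD// FK0 adde0 -(integral12_prod_meas1 iFP) /fubini_F [RHS]integral_mkcond.
apply: eq_integral => t _; rewrite /patch; case: ifPn => tI; last first.
  rewrite (eq_integral (cst 0%E)) ?integral0// => x _.
  by rewrite /= /FP /= indicE (negbTE tI) mul0r.
have vE : csg D * cv D t = `|cv D t|.
  rewrite -[RHS]mul1r -(csg1 D) -normrM ger0_norm// ltW//.
  exact: lt_le_trans (cv0_gt0 D) (cv_ge D t).
rewrite /slice_mass -ge0_integralZl//.
- by apply: eq_integral => x _; rewrite /= /FP /= indicE tI mul1r vE.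
- apply/measurable_EFinP; apply: (measurable_truncated r (ck D t)).
  by apply: measurable_fun_pden => // i; exact: measurable_tnth_fun.
- move=> x _; rewrite lee_fin; have [xe|ex] := ltP (dotv (tnth x) (tnth x)) (e ^+ 2).
    by rewrite /truncated; case: ifP => // _; have [] := He t xe.
  by rewrite (truncated_eq0 e0 re).
Qed.

End total.

(** * The Hamiltonian flow *)

Section directional_derivatives.
Context {R : realType}.

Lemma is_derive_cvg (V W : normedModType R) (f : V -> W) (x v : V) (df : W) :
  is_derive x v f df <-> h^-1 *: (f (h *: v + x) - f x) @[h --> (0:R)^'] --> df.
Proof.
split=> [[dfx <-]|H]; first exact: dfx.
by split; [apply/cvg_ex; exists df|exact: cvg_lim H].
Qed.

Lemma is_derive_affine (V : normedModType R) (f : V -> R) (x v : V) (a : R) :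
  (forall h : R, f (h *: v + x) = f x + h * a) -> is_derive x v (f : V -> R^o) a.
Proof.
move=> fE; apply/is_derive_cvg; apply: cvg_near_cst.
near=> h; have h0 : h != 0 by near: h; exact: nbhs_dnbhs_neq.
by rewrite fE addrAC subrr add0r /GRing.scale/= mulKf.
Unshelve. all: by end_near. Qed.

Lemma is_derive_pair (V A B : normedModType R) (f : V -> A * B) (x v : V) (df : A * B) :
  is_derive x v f df <->
  is_derive x v (fun y => (f y).1) df.1 /\ is_derive x v (fun y => (f y).2) df.2.
Proof.
rewrite !is_derive_cvg; split=> [H|[H1 H2]].
  by split; [exact: cvg_comp H (@cvg_fst _ _ _ _ _)|exact: cvg_comp H (@cvg_snd _ _ _ _ _)].
case: df => a b in H1 H2 *; apply: (cvg_trans _ (cvg_pair H1 H2)).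
by apply: near_eq_cvg; near=> h.
Unshelve. all: by end_near. Qed.

Lemma is_derive_rV (V : normedModType R) m (f : V -> 'rV[R]_m) (x v : V) (df : 'rV[R]_m) :
  is_derive x v f df <-> forall i, is_derive x v (fun y => f y 0 i : R) (df 0 i).
Proof.
split=> [[dfx dE] i|H].
  split; first by have /derivable_mxP := dfx; apply.
  by rewrite -dE derive_mx// mxE.
have dfx : derivable f x v.
  by apply/derivable_mxP => i j; rewrite (ord1 i); have [] := H j.
split => //; rewrite derive_mx//; apply/rowP => j; rewrite mxE.
by have [_ ->] := H j.
Qed.

End directional_derivatives.

Section hamiltonian_flow.
Context {R : realType} {d : nat}.
Local Notation H := (heis R d).
Local Notation TH := (cotangent R d).

(* The momenta along X_i and X_{d+i}. *)
Definition mom1 (l : TH) (i : 'I_d) : R := l.2.1.1 0 i - l.2.2 * l.1.1.2 0 i / 2.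
Definition mom2 (l : TH) (i : 'I_d) : R := l.2.1.2 0 i + l.2.2 * l.1.1.1 0 i / 2.

Lemma hamiltonianE (l : TH) :
  hamiltonian l = 2^-1 * \sum_i (mom1 l i ^+ 2 + mom2 l i ^+ 2).
Proof.
rewrite /hamiltonian big_sumType big_split/=; congr (_ * (_ + _)); apply: eq_bigr => i _.
  by rewrite /pairing /mom1 /= dotC dot_deltal [dot _ 0]dotC dot0l addr0 mulrN mulrA.
by rewrite /pairing /mom2 /= [dot _ (delta_mx _ _)]dotC dot_deltal [dot _ 0]dotC dot0l add0r mulrA.
Qed.

Definition dmom1 (l xi : TH) (i : 'I_d) : R :=
  xi.2.1.1 0 i - (xi.2.2 * l.1.1.2 0 i + l.2.2 * xi.1.1.2 0 i) / 2.
Definition dmom2 (l xi : TH) (i : 'I_d) : R :=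
  xi.2.1.2 0 i + (xi.2.2 * l.1.1.1 0 i + l.2.2 * xi.1.1.1 0 i) / 2.

Lemma is_derive_mom1 (l xi : TH) i : is_derive l xi (mom1^~ i : _ -> R^o) (dmom1 l xi i).
Proof.
have c1 : is_derive l xi (fun l : TH => l.2.1.1 0 i : R^o) (xi.2.1.1 0 i).
  by apply: is_derive_affine => h; rewrite /= !mxE addrC.
have c2 : is_derive l xi (fun l : TH => l.2.2 : R^o) (xi.2.2).
  by apply: is_derive_affine => h; rewrite /= addrC.
have c3 : is_derive l xi (fun l : TH => l.1.1.2 0 i : R^o) (xi.1.1.2 0 i).
  by apply: is_derive_affine => h; rewrite /= !mxE addrC.
apply: (is_derive_eq (is_deriveB c1 (is_deriveM (is_deriveM c2 c3) (is_derive_cst (2^-1 : R^o) l xi)))); rewrite /dmom1 /GRing.scale/=; ring.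
Qed.

Lemma is_derive_mom2 (l xi : TH) i : is_derive l xi (mom2^~ i : _ -> R^o) (dmom2 l xi i).
Proof.
have c1 : is_derive l xi (fun l : TH => l.2.1.2 0 i : R^o) (xi.2.1.2 0 i).
  by apply: is_derive_affine => h; rewrite /= !mxE addrC.
have c2 : is_derive l xi (fun l : TH => l.2.2 : R^o) (xi.2.2).
  by apply: is_derive_affine => h; rewrite /= addrC.
have c3 : is_derive l xi (fun l : TH => l.1.1.1 0 i : R^o) (xi.1.1.1 0 i).
  by apply: is_derive_affine => h; rewrite /= !mxE addrC.
apply: (is_derive_eq (is_deriveD c1 (is_deriveM (is_deriveM c2 c3) (is_derive_cst (2^-1 : R^o) l xi)))); rewrite /dmom2 /GRing.scale/=; ring.
Qed.

Lemma derive_hamiltonian (l xi : TH) : 'D_xi (hamiltonian : _ -> R^o) l =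
  \sum_i (mom1 l i * dmom1 l xi i + mom2 l i * dmom2 l xi i).
Proof.
have Hi i : is_derive l xi (fun l => mom1 l i ^+ 2 + mom2 l i ^+ 2 : R^o)
    (2 * (mom1 l i * dmom1 l xi i + mom2 l i * dmom2 l xi i)).
  have m1 := is_derive_mom1 l xi i; have m2 := is_derive_mom2 l xi i.
  apply: (is_derive_eq (is_deriveD (is_deriveM m1 m1) (is_deriveM m2 m2))); rewrite /GRing.scale/=; ring.
have := is_deriveM (is_derive_cst (2^-1 : R^o) l xi) (is_derive_sum Hi).
set f := (F in is_derive _ _ F _) => -[_].
have -> : (hamiltonian : _ -> R^o) = f.
  by apply/funext => l'; rewrite hamiltonianE /f /= /GRing.mul/= fct_sumE.
move=> ->; rewrite -mulr_sumr /GRing.scale/= mulr0 addr0 mulKf//.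
Qed.

Definition ham_eqs (l m : TH) :=
  [/\ forall i, m.1.1.1 0 i = mom1 l i, forall i, m.1.1.2 0 i = mom2 l i,
      m.1.2 = 2^-1 * \sum_i (l.1.1.1 0 i * mom2 l i - l.1.1.2 0 i * mom1 l i),
      (forall i, m.2.1.1 0 i = - (l.2.2 * mom2 l i / 2)) /\
      (forall i, m.2.1.2 0 i = l.2.2 * mom1 l i / 2) & m.2.2 = 0].

(** Both sides are linear in xi, so testing on the coordinate vectors of the cotangent space yields
    Hamilton's equations one at a time. *)
Lemma ham_eqsP (l m : TH) :
  (forall xi, symplectic xi m = 'D_xi (hamiltonian : _ -> R^o) l) <-> ham_eqs l m.
Proof.
pose P xi := symplectic xi m = \sum_i (mom1 l i * dmom1 l xi i + mom2 l i * dmom2 l xi i).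
have -> : (forall xi, symplectic xi m = 'D_xi (hamiltonian : _ -> R^o) l) <-> (forall xi, P xi).
  by split => h xi; rewrite /P -?derive_hamiltonian// derive_hamiltonian; exact: h.
have sd (F : 'I_d -> R) j : \sum_i F i * (delta_mx 0 j : 'rV[R]_d) 0 i = F j.
  rewrite (bigD1 j)//= mxE !eqxx mulr1 big1 ?addr0// => i /negbTE ij.
  by rewrite mxE ij andbF mulr0.
split=> [h|[e1 e2 e3 [e4 e5] e6] xi].
- split.
  + move=> j; have := h (0, (delta_mx 0 j, 0, 0)).
    rewrite /P /symplectic /pairing /= dot_deltal ![dot _ 0]dotC !dot0l.
    rewrite mul0r mulr0 !addr0 subr0 => ->; rewrite -[RHS](sd (mom1 l)).
    by apply: eq_bigr => i _; rewrite /dmom1 /dmom2 /= !mxE; ring.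
  + move=> j; have := h (0, (0, delta_mx 0 j, 0)).
    rewrite /P /symplectic /pairing /= dot_deltal ![dot _ 0]dotC !dot0l.
    rewrite mul0r mulr0 !addr0 add0r subr0 => ->; rewrite -[RHS](sd (mom2 l)).
    by apply: eq_bigr => i _; rewrite /dmom1 /dmom2 /= !mxE; ring.
  + have := h (0, (0, 0, 1)).
    rewrite /P /symplectic /pairing /= ![dot _ 0]dotC !dot0l.
    rewrite mul1r mulr0 !addr0 !add0r subr0 => ->; rewrite mulr_sumr.
    by apply: eq_bigr => i _; rewrite /dmom1 /dmom2 /= !mxE; field.
  + split => j.
      have := h ((delta_mx 0 j, 0, 0), 0).
      rewrite /P /symplectic /pairing /= [dot _ (delta_mx _ _)]dotC dot_deltal ![dot _ 0]dotC !dot0l.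
      rewrite !(mul0r, mulr0, addr0, add0r, sub0r) => /eqP; rewrite eqr_oppLR => /eqP ->.
      congr (- _); rewrite -[RHS](sd (fun i => l.2.2 * mom2 l i / 2)).
      by apply: eq_bigr => i _; rewrite /dmom1 /dmom2 /= !mxE; field.
    have := h ((0, delta_mx 0 j, 0), 0).
    rewrite /P /symplectic /pairing /= [dot _ (delta_mx _ _)]dotC dot_deltal ![dot _ 0]dotC !dot0l.
    rewrite !(mul0r, mulr0, addr0, add0r, sub0r) => /eqP; rewrite eqr_oppLR => /eqP ->.
    rewrite -[RHS](sd (fun i => l.2.2 * mom1 l i / 2)) -sumrN.
    by apply: eq_bigr => i _; rewrite /dmom1 /dmom2 /= !mxE; field.
  + have := h ((0, 0, 1), 0).
    rewrite /P /symplectic /pairing /= ![dot _ 0]dotC !dot0l.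
    rewrite !(mul0r, mulr0, mulr1, addr0, add0r, sub0r) => /eqP; rewrite eqr_oppLR => /eqP ->.
    by rewrite big1 ?oppr0// => i _; rewrite /dmom1 /dmom2 /= !mxE; ring.
- rewrite /P /symplectic /pairing e3 e6 /dot mul0r addr0 [xi.2.2 * _]mulrA mulr_sumr.
  rewrite -!big_split/= -sumrB; apply: eq_bigr => i _.
  by rewrite e1 e2 e4 e5 /dmom1 /dmom2; field.
Qed.

End hamiltonian_flow.

(** * Explicit solutions of Hamilton's equations *)

Section flow.
Context {R : realType}.

(** The iterated primitives in t, vanishing at 0, of cos (s t) and sin (s t) that describe the arc
    and its swept area. The values at s = 0 are the limits, for straight lines. *)
Definition sins (s t : R) : R := if s == 0 then t else sin (s * t) / s.
Definition coss (s t : R) : R := if s == 0 then 0 else (1 - cos (s * t)) / s.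
Definition areas (s t : R) : R := if s == 0 then 0 else (s * t - sin (s * t)) / s ^+ 2.

Lemma is_derive_sinM (s t : R) : is_derive t 1 (fun t : R => sin (s * t)) (s * cos (s * t)).
Proof. by apply: is_derive_eq; rewrite /GRing.scale/=; ring. Qed.

Lemma is_derive_cosM (s t : R) : is_derive t 1 (fun t : R => cos (s * t)) (- (s * sin (s * t))).
Proof. by apply: is_derive_eq; rewrite /GRing.scale/=; ring. Qed.

Lemma is_derive_sins (s t : R) : is_derive t 1 (sins s) (cos (s * t)).
Proof.
rewrite /sins; have [->|s0] := eqVneq s 0.
  by rewrite mul0r cos0; exact: is_derive_id.
have h := is_derive_sinM s t.
by apply: is_derive_eq; rewrite /GRing.scale/=; field.
Qed.

Lemma is_derive_coss (s t : R) : is_derive t 1 (coss s) (sin (s * t)).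
Proof.
rewrite /coss; have [->|s0] := eqVneq s 0.
  by rewrite mul0r sin0; exact: is_derive_cst.
have h := is_derive_cosM s t.
by apply: is_derive_eq; rewrite /GRing.scale/=; field.
Qed.

Lemma is_derive_areas (s t : R) : is_derive t 1 (areas s) (coss s t).
Proof.
rewrite /areas /coss; have [_|s0] := eqVneq s 0; first exact: is_derive_cst.
have h := is_derive_sinM s t.
by apply: is_derive_eq; rewrite /GRing.scale/=; field.
Qed.

Lemma sins_coss (s t : R) : sins s t * sin (s * t) - coss s t * cos (s * t) = coss s t.
Proof.
rewrite /sins /coss; have [->|s0] := eqVneq s 0; first by rewrite !mul0r sin0 mulr0 subr0.
have := cos2Dsin2 (s * t); set c := cos _; set si := sin _ => h.
apply: (mulIf s0); rewrite mulrBl mulrAC divfK// [(1 - c) / s * c]mulrAC divfK// divfK//.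
have -> : si * si = 1 - c ^+ 2 by apply/eqP; rewrite eq_sym subr_eq -h addrC -!expr2.
ring.
Qed.

Lemma sins0 s : sins s 0 = 0.
Proof. by rewrite /sins mulr0 sin0 mul0r if_same. Qed.

Lemma coss0 s : coss s 0 = 0.
Proof. by rewrite /coss mulr0 cos0 subrr mul0r if_same. Qed.

Lemma areas0 s : areas s 0 = 0.
Proof. by rewrite /areas mulr0 sin0 subrr mul0r if_same. Qed.

Lemma is_derive_const_eq (f g : R -> R) (f' : R -> R) :
  (forall t : R, is_derive t 1 f (f' t)) -> (forall t : R, is_derive t 1 g (f' t)) ->
  f 0 = g 0 -> f =1 g.
Proof.
move=> df dg fg t; apply/eqP; rewrite -subr_eq0; apply/eqP.
have E : (f - g) t = (f - g) 0.
  apply: (is_derive_0_is_cst (f := f - g)) => x.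
  by apply: (is_derive_eq (is_deriveB (df x) (dg x))); rewrite subrr.
by rewrite -[LHS]/((f - g) t) E -[LHS]/(f 0 - g 0) fg subrr.
Qed.

Context {d : nat}.
Local Notation TH := (cotangent R d).

Lemma ham_curveP (c : R -> TH) : ham_curve hamiltonian c <->
  forall t : R, exists2 m, is_derive t 1 c m & ham_eqs (c t) m.
Proof.
split=> [h t|h t].
  have [dc hc] := h t; exists ('D_1 c t); first exact: DeriveDef.
  exact/ham_eqsP.
have [m [dc <-] /ham_eqsP hm] := h t; by split.
Qed.

Section components.
Variables (c : R -> TH).
Hypothesis hc : ham_curve hamiltonian c.

Let comp (t : R) : exists2 m : TH, [/\ forall i, is_derive t 1 (fun t => (c t).1.1.1 0 i : R) (m.1.1.1 0 i),
   forall i, is_derive t 1 (fun t => (c t).1.1.2 0 i : R) (m.1.1.2 0 i),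
   is_derive t 1 (fun t => (c t).1.2 : R) m.1.2,
   (forall i, is_derive t 1 (fun t => (c t).2.1.1 0 i : R) (m.2.1.1 0 i)) /\
   (forall i, is_derive t 1 (fun t => (c t).2.1.2 0 i : R) (m.2.1.2 0 i)) &
   is_derive t 1 (fun t => (c t).2.2 : R) m.2.2] & ham_eqs (c t) m.
Proof.
have [m dc hm] := (ham_curveP c).1 hc t; exists m => //.
move/is_derive_pair : dc => [/is_derive_pair[/is_derive_pair[/is_derive_rV h1 /is_derive_rV h2] h3]].
by move=> /is_derive_pair[/is_derive_pair[/is_derive_rV h4 /is_derive_rV h5] h6].
Qed.

Lemma ham_pz t : (c t).2.2 = (c 0).2.2.
Proof.
apply: (is_derive_0_is_cst (f := fun t => (c t).2.2)) => x.
by have [m [_ _ _ _ h] [_ _ _ _ <-]] := comp x.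
Qed.

Lemma ham_x (t : R) i : is_derive t 1 (fun t => (c t).1.1.1 0 i : R) (mom1 (c t) i).
Proof. by have [m [h _ _ _ _] [<- _ _ _ _]] := comp t. Qed.

Lemma ham_y (t : R) i : is_derive t 1 (fun t => (c t).1.1.2 0 i : R) (mom2 (c t) i).
Proof. by have [m [_ h _ _ _] [_ <- _ _ _]] := comp t. Qed.

Lemma ham_z (t : R) : is_derive t 1 (fun t => (c t).1.2 : R)
  (2^-1 * \sum_i ((c t).1.1.1 0 i * mom2 (c t) i - (c t).1.1.2 0 i * mom1 (c t) i)).
Proof. by have [m [_ _ h _ _] [_ _ <- _ _]] := comp t. Qed.

Lemma ham_mom1 (t : R) i : is_derive t 1 (fun t => mom1 (c t) i : R) (- ((c 0).2.2 * mom2 (c t) i)).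
Proof.
have [m [_ _ _ [h4 _] h6] [_ e2 _ [e4 _] e6]] := comp t.
apply: (is_derive_eq (is_deriveB (h4 i) (is_deriveM (is_deriveM h6 (ham_y t i))
  (is_derive_cst (2^-1 : R) t 1)))).
by rewrite /GRing.scale/= e4 e6 ham_pz; field.
Qed.

Lemma ham_mom2 (t : R) i : is_derive t 1 (fun t => mom2 (c t) i : R) ((c 0).2.2 * mom1 (c t) i).
Proof.
have [m [_ _ _ [_ h5] h6] [e1 _ _ [_ e5] e6]] := comp t.
apply: (is_derive_eq (is_deriveD (h5 i) (is_deriveM (is_deriveM h6 (ham_x t i))
  (is_derive_cst (2^-1 : R) t 1)))).
by rewrite /GRing.scale/= e5 e6 ham_pz; field.
Qed.

End components.

(** The vertical momentum is constant and the difference of the horizontal momenta rotates at that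
    speed. Its squared norm is therefore constant, hence 0, and the positions follow by integration.
    Base points are all that [sr_exp] sees. *)
Lemma ham_curve_unique (c c' : R -> TH) :
  ham_curve hamiltonian c -> ham_curve hamiltonian c' -> c 0 = c' 0 ->
  forall t, (c t).1 = (c' t).1.
Proof.
move=> hc hc' c0.
have mE t i : mom1 (c t) i = mom1 (c' t) i /\ mom2 (c t) i = mom2 (c' t) i.
  pose u (t : R) := mom1 (c t) i - mom1 (c' t) i; pose v (t : R) := mom2 (c t) i - mom2 (c' t) i.
  have du (x : R) : is_derive x 1 u (- ((c 0).2.2 * v x)).
    apply: (is_derive_eq (is_deriveB (ham_mom1 hc x i) (ham_mom1 hc' x i))).
    by rewrite -c0 /v; ring.
  have dv (x : R) : is_derive x 1 v ((c 0).2.2 * u x).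
    apply: (is_derive_eq (is_deriveB (ham_mom2 hc x i) (ham_mom2 hc' x i))).
    by rewrite -c0 /u; ring.
  have E : u t * u t + v t * v t = 0.
    have -> : u t * u t + v t * v t = (u * u + v * v) t by [].
    transitivity ((u * u + v * v) 0); last first.
      by rewrite -[LHS]/(u 0 * u 0 + v 0 * v 0) /u /v c0 !subrr mulr0 addr0.
    apply: (is_derive_0_is_cst (f := u * u + v * v)) => x.
    apply: (is_derive_eq (is_deriveD (is_deriveM (du x) (du x)) (is_deriveM (dv x) (dv x)))).
    by rewrite /GRing.scale/=; ring.
  have := E; move/eqP; rewrite paddr_eq0 -?expr2 ?sqr_ge0// !sqrf_eq0 !subr_eq0.
  by move=> /andP[/eqP -> /eqP ->].
have xE t i : (c t).1.1.1 0 i = (c' t).1.1.1 0 i.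
  apply: (is_derive_const_eq (f := fun t => (c t).1.1.1 0 i) (g := fun t => (c' t).1.1.1 0 i)
    (fun x => ham_x hc x i)); last by rewrite c0.
  by move=> x; have [-> _] := mE x i; exact: ham_x.
have yE t i : (c t).1.1.2 0 i = (c' t).1.1.2 0 i.
  apply: (is_derive_const_eq (f := fun t => (c t).1.1.2 0 i) (g := fun t => (c' t).1.1.2 0 i)
    (fun x => ham_y hc x i)); last by rewrite c0.
  by move=> x; have [_ ->] := mE x i; exact: ham_y.
have zE t : (c t).1.2 = (c' t).1.2.
  apply: (is_derive_const_eq (f := fun t => (c t).1.2) (g := fun t => (c' t).1.2)
    (fun x => ham_z hc x)); last by rewrite c0.
  move=> x; rewrite (_ : \sum_i _ = \sum_i ((c' x).1.1.1 0 i * mom2 (c' x) i -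
    (c' x).1.1.2 0 i * mom1 (c' x) i)); first exact: ham_z.
  by apply: eq_bigr => i _; have [-> ->] := mE x i; rewrite xE yE.
move=> t; rewrite [LHS]surjective_pairing [RHS]surjective_pairing zE; congr pair.
rewrite [LHS]surjective_pairing [RHS]surjective_pairing; congr pair.
  by apply/rowP => i; rewrite xE.
by apply/rowP => i; rewrite yE.
Qed.

Section solution.
Variable l : TH.
Let s := l.2.2.
Let x i := l.1.1.1 0 i.
Let y i := l.1.1.2 0 i.
Let a := mom1 l.
Let b := mom2 l.

Definition sol_x t i : R := x i + (sins s t * a i - coss s t * b i).
Definition sol_y t i : R := y i + (coss s t * a i + sins s t * b i).
Definition sol_z t : R := l.1.2 +
  2^-1 * (\sum_i (x i * (coss s t * a i + sins s t * b i) -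
                  y i * (sins s t * a i - coss s t * b i)) +
          areas s t * \sum_i (a i ^+ 2 + b i ^+ 2)).
Let mx t i : R := cos (s * t) * a i - sin (s * t) * b i.
Let my t i : R := sin (s * t) * a i + cos (s * t) * b i.

Definition sol (t : R) : TH :=
  ((\row_i sol_x t i, \row_i sol_y t i, sol_z t : R^o),
   (\row_i (mx t i + s * sol_y t i / 2), \row_i (my t i - s * sol_x t i / 2), s : R^o)).

Let mom1_sol t i : mom1 (sol t) i = mx t i.
Proof. by rewrite /mom1 /sol /= !mxE; ring. Qed.

Let mom2_sol t i : mom2 (sol t) i = my t i.
Proof. by rewrite /mom2 /sol /= !mxE; ring. Qed.

Let d_sol_x (t : R) i : is_derive t 1 (sol_x^~ i) (mx t i).
Proof.
have h1 := is_derive_sins s t; have h2 := is_derive_coss s t.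
by apply: is_derive_eq; rewrite /mx /GRing.scale/=; ring.
Qed.

Let d_sol_y (t : R) i : is_derive t 1 (sol_y^~ i) (my t i).
Proof.
have h1 := is_derive_sins s t; have h2 := is_derive_coss s t.
by apply: is_derive_eq; rewrite /my /GRing.scale/=; ring.
Qed.

Let d_mx (t : R) i : is_derive t 1 (mx^~ i) (- (s * my t i)).
Proof.
have h1 := is_derive_sinM s t; have h2 := is_derive_cosM s t.
by apply: is_derive_eq; rewrite /my /GRing.scale/=; ring.
Qed.

Let d_my (t : R) i : is_derive t 1 (my^~ i) (s * mx t i).
Proof.
have h1 := is_derive_sinM s t; have h2 := is_derive_cosM s t.
by apply: is_derive_eq; rewrite /mx /GRing.scale/=; ring.
Qed.

Let d_sol_z (t : R) : is_derive t 1 sol_z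
  (2^-1 * \sum_i (sol_x t i * my t i - sol_y t i * mx t i)).
Proof.
have h1 := is_derive_sins s t; have h2 := is_derive_coss s t; have h3 := is_derive_areas s t.
have hs i : is_derive t 1 (fun t => x i * (coss s t * a i + sins s t * b i) -
    y i * (sins s t * a i - coss s t * b i)) (x i * my t i - y i * mx t i).
  by apply: is_derive_eq; rewrite /mx /my /GRing.scale/=; ring.
have hS := is_derive_sum hs.
have hA := is_deriveM h3 (is_derive_cst (\sum_i (a i ^+ 2 + b i ^+ 2) : R) t 1).
have := is_deriveD (is_derive_cst (l.1.2 : R) t 1)
  (is_deriveM (is_derive_cst (2^-1 : R) t 1) (is_deriveD hS hA)).
set f := (F in is_derive _ _ F _ -> _).
have -> : f = sol_z.
  by apply/funext => u; rewrite /f /sol_z /= /GRing.add/= /GRing.mul/= fct_sumE.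
move=> h; apply: (is_derive_eq h).
transitivity (2^-1 * (\sum_i (x i * my t i - y i * mx t i) +
    coss s t * \sum_i (a i ^+ 2 + b i ^+ 2))); first by rewrite /GRing.scale/=; ring.
congr (_ * _); rewrite -sins_coss mulr_sumr -big_split/=; apply: eq_bigr => i _.
rewrite /sol_x /sol_y /mx /my; ring.
Qed.

Lemma ham_curve_sol : ham_curve hamiltonian sol.
Proof.
apply/ham_curveP => t.
exists ((\row_i mx t i, \row_i my t i,
    2^-1 * \sum_i (sol_x t i * my t i - sol_y t i * mx t i) : R^o),
  (\row_i (- (s * my t i) + s * my t i / 2), \row_i (s * mx t i - s * mx t i / 2), 0 : R^o)).
  apply/is_derive_pair; split; apply/is_derive_pair; split => /=.
  - apply/is_derive_pair; split; apply/is_derive_rV => i /=; rewrite mxE.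
      by have h := d_sol_x t i; under [F in is_derive _ _ F _]funext do rewrite mxE.
    by have h := d_sol_y t i; under [F in is_derive _ _ F _]funext do rewrite mxE.
  - exact: d_sol_z.
  - apply/is_derive_pair; split; apply/is_derive_rV => i /=; rewrite mxE.
      have h := d_mx t i; have h2 := d_sol_y t i.
      under [F in is_derive _ _ F _]funext do rewrite mxE.
      by apply: is_derive_eq; rewrite /GRing.scale/=; ring.
    have h := d_my t i; have h2 := d_sol_x t i.
    under [F in is_derive _ _ F _]funext do rewrite mxE.
    by apply: is_derive_eq; rewrite /GRing.scale/=; ring.
  - exact: is_derive_cst.
split; rewrite ?mom1_sol ?mom2_sol /=.
- by move=> i; rewrite mom1_sol mxE.
- by move=> i; rewrite mom2_sol mxE.
- by congr (_ * _); apply: eq_bigr => i _; rewrite mom1_sol mom2_sol !mxE.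
- by split => i; rewrite ?mom1_sol ?mom2_sol mxE; field.
- by [].
Qed.

Lemma sol0 : sol 0 = l.
Proof.
rewrite /sol /sol_z sins0 coss0 areas0 /mx /my mulr0 cos0 sin0.
rewrite [RHS]surjective_pairing; congr pair.
  rewrite [RHS]surjective_pairing; congr pair.
    rewrite [RHS]surjective_pairing; congr pair; apply/rowP => i; rewrite mxE.
      by rewrite /sol_x sins0 coss0 !mul0r subrr addr0.
    by rewrite /sol_y sins0 coss0 !mul0r addr0 addr0.
  rewrite big1 ?mul0r ?addr0 ?mulr0 ?addr0// => i _.
  by rewrite !mul0r addr0 subr0 !mulr0 subr0.
rewrite [RHS]surjective_pairing; congr pair.
rewrite [RHS]surjective_pairing; congr pair; apply/rowP => i; rewrite mxE.
  by rewrite /sol_y sins0 coss0 /a /mom1 /y /s; ring.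
by rewrite /sol_x sins0 coss0 /b /mom2 /x /s; ring.
Qed.

(** [ham_flow] picks some value: the explicit solution shows that there is one, and uniqueness
    identifies its base point. *)
Lemma sr_expE : sr_exp l = (sol 1).1.
Proof.
rewrite /sr_exp /ham_flow.
set P := [set m | _].
have [|c [hc c0 <-]] := @getPex _ P.
  by exists (sol 1); exists sol; split => //; [exact: ham_curve_sol|exact: sol0].
apply: ham_curve_unique => //; first exact: ham_curve_sol.
by rewrite c0 sol0.
Qed.

End solution.
End flow.

(** * The tube as a union of slices *)

Section slices.
Context {R : realType} {d : nat}.
Local Notation n := (d + d)%N.
Implicit Types (k h x : 'I_n -> R).

(* Multiplication of h by the complex number (exp (i s) - 1) / (i s). *)
Definition endpoint (s : R) h (i : 'I_n) : R := sins s 1 * h i + coss s 1 * Jv h i.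

Lemma dotvZDr (a b : R) (x y z : 'I_n -> R) :
  dotv x (fun i => a * y i + b * z i) = a * dotv x y + b * dotv x z.
Proof. by rewrite /dotv !mulr_sumr -big_split/=; apply: eq_bigr => i _; ring. Qed.

Lemma JvK x : Jv (Jv x) = (fun i => - x i).
Proof.
apply/funext => i; case: (split_ordP i) => j ->.
  by rewrite Jv_l Jv_r.
by rewrite Jv_r Jv_l.
Qed.

Lemma dotv_JvJv x y : dotv (Jv x) (Jv y) = dotv x y.
Proof.
rewrite dotv_Jv JvK [dotv _ x]dotvC /dotv -sumrN; apply: eq_bigr => i _; ring.
Qed.

Lemma sins_half (s : R) : s * sins s 1 = 2 * sin (s / 2) * cos (s / 2).
Proof.
rewrite /sins; have [->|s0] := eqVneq s 0; first by rewrite !mul0r sin0 mulr0 mul0r.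
rewrite mulr1 mulrC divfK// {1}(splitr s) sinD; ring.
Qed.

Lemma coss_half (s : R) : s * coss s 1 = 2 * sin (s / 2) ^+ 2.
Proof.
rewrite /coss; have [->|s0] := eqVneq s 0; first by rewrite !mul0r sin0 expr0n/= mulr0.
rewrite mulr1 mulrC divfK// {1}(splitr s) cosD.
by have := cos2Dsin2 (s / 2); move: (cos _) (sin _) => c si cs; rewrite -[X in X - _]cs; ring.
Qed.

Lemma dotv_endpoint (s : R) h :
  dotv (endpoint s h) (endpoint s h) = (sins s 1 ^+ 2 + coss s 1 ^+ 2) * dotv h h.
Proof.
rewrite /endpoint dotvZDr [dotv (endpoint s h) h]dotvC [dotv (endpoint s h) (Jv h)]dotvC.
by rewrite !dotvZDr [dotv h (Jv h)]dotvC dotv_Jvv dotv_JvJv; ring.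
Qed.

Lemma sins_coss_sqr (s : R) : s ^+ 2 * (sins s 1 ^+ 2 + coss s 1 ^+ 2) = 4 * sin (s / 2) ^+ 2.
Proof.
rewrite mulrDr -!exprMn sins_half coss_half.
transitivity (4 * sin (s / 2) ^+ 2 * (cos (s / 2) ^+ 2 + sin (s / 2) ^+ 2)); first by ring.
by rewrite cos2Dsin2 mulr1.
Qed.

Lemma sins_coss_le1 (s : R) : sins s 1 ^+ 2 + coss s 1 ^+ 2 <= 1.
Proof.
have [->|s0] := eqVneq s 0.
  by rewrite /sins /coss eqxx expr1n expr0n addr0.
have s2 : 0 < s ^+ 2 by rewrite exprn_even_gt0.
rewrite -(ler_pM2l s2) sins_coss_sqr mulr1.
have := sqr_sin_le (s / 2); rewrite [(s / 2) ^+ 2]exprMn => H.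
by rewrite (_ : s ^+ 2 = 4 * (s ^+ 2 * 2^-1 ^+ 2)) ?ler_pM2l//; field.
Qed.

Lemma sin_neq0 (x : R) : - (pi / 2) < x < pi / 2 -> x != 0 -> sin x != 0.
Proof.
move=> /andP[x1 x2] x0; have := pi_gt0 R => p0.
have [xn|xp|xE] := ltgtP x 0; last by rewrite xE eqxx in x0.
  by rewrite -oppr_eq0 -sinN gt_eqF// sin_gt0_pi//; apply/andP; split; lra.
by rewrite gt_eqF// sin_gt0_pi//; apply/andP; split; lra.
Qed.

(** With u = s / 2 and m = <J k, h>, the products <k, x> and 2 - <J k, x> are 2 sin u and 2 cos u
    times the same factor cos u - sin u * m / s, so that [tau] is tan u. As |u| < pi / 2, u is
    recovered by atan, and the profiles become trigonometric in u. *)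
Lemma slice_endpoint k h : let s := dotv k h in
  - (pi / 2) < s / 2 < pi / 2 -> 1 <= 2 - dotv (Jv k) (endpoint s h) ->
  len2 k (endpoint s h) = dotv h h /\
  height k (endpoint s h) = areas s 1 / 2 * dotv h h.
Proof.
move=> s sp B1.
have cs : 0 < cos (s / 2) by apply: cos_gt0_pihalf.
set m := dotv (Jv k) h.
have A : dotv k (endpoint s h) = s * sins s 1 - coss s 1 * m.
  by rewrite /endpoint dotvZDr [dotv k (Jv h)]dotvC dotv_Jv -/s -/m; ring.
have B : dotv (Jv k) (endpoint s h) = sins s 1 * m + s * coss s 1.
  by rewrite /endpoint dotvZDr dotv_JvJv -/s -/m; ring.
have tauE : tau k (endpoint s h) = tan (s / 2).
  rewrite /tau ginvE// A.
  have D0 : 2 - dotv (Jv k) (endpoint s h) != 0 by rewrite gt_eqF// (lt_le_trans ltr01).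
  apply: (mulIf D0); rewrite divfK// B /tan.
  (* The common factor involves m / s, so s = 0 is separate; there both sides vanish. *)
  have [s0|s0] := eqVneq s 0.
    by rewrite s0 /sins /coss eqxx !mul0r sin0 !mul0r subr0.
  have e1 : sins s 1 = 2 * sin (s / 2) * cos (s / 2) / s by rewrite -sins_half mulrAC divff ?mul1r.
  have e2 : coss s 1 = 2 * sin (s / 2) ^+ 2 / s by rewrite -coss_half mulrAC divff ?mul1r.
  have c2 := cos2Dsin2 (s / 2).
  rewrite e1 e2; move: cs c2; set c := cos _; set si := sin _ => cs c2.
  have c0 : c != 0 by rewrite gt_eqF.
  rewrite (_ : 2 - _ = (2 * c * (c * c + si * si)) / c - (2 * si * c / s * m + s * (2 * si ^+ 2 / s))); last first.
    by rewrite -!expr2 c2 mulr1 mulfK.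
  by field; rewrite s0 c0.
rewrite /len2 /height tauE dotv_endpoint.
have [s0|s0] := eqVneq s 0.
  rewrite s0 mul0r tan0 /tprof /qprof /sins /coss /areas eqxx.
  by rewrite !expr0n/= !mul0r; split; field.
have s20 : s / 2 != 0 by rewrite mulf_neq0// ?invr_eq0.
have si0 := sin_neq0 sp s20.
have t0 : tan (s / 2) != 0 by rewrite /tan mulf_neq0// ?invr_eq0 gt_eqF.
have N : sins s 1 ^+ 2 + coss s 1 ^+ 2 = 4 * sin (s / 2) ^+ 2 / s ^+ 2.
  by rewrite -sins_coss_sqr mulrAC divff ?mul1r// expf_neq0.
have atanE' : atan (tan (s / 2)) = s / 2 by rewrite tanK// in_itv.
have t2 : 1 + tan (s / 2) ^+ 2 = (cos (s / 2) ^+ 2)^-1 by rewrite -cos2_tan2// gt_eqF.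
have Ts : tprof (tan (s / 2)) = (s / 2) ^+ 2 / sin (s / 2) ^+ 2.
  have := tprofE (tan (s / 2)); rewrite atanE' t2 /tan.
  move: cs si0; set c := cos _; set si := sin _ => cs si0 H.
  have c0 : c != 0 by rewrite gt_eqF.
  have n0 : (si / c) ^+ 2 != 0 by rewrite expf_neq0// mulf_neq0// ?invr_eq0.
  by apply: (mulfI n0); rewrite H; field; rewrite c0 si0.
have Qs : qprof (tan (s / 2)) =
    (s / 2 - sin (s / 2) * cos (s / 2)) / (4 * sin (s / 2) ^+ 2).
  have := qprofE (tan (s / 2)); rewrite atanE' t2 /tan.
  move: cs si0; set c := cos _; set si := sin _ => cs si0 H.
  have c0 : c != 0 by rewrite gt_eqF.
  have n0 : 4 * (si / c) ^+ 2 != 0 by rewrite mulf_neq0// expf_neq0// mulf_neq0// ?invr_eq0.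
  by apply: (mulfI n0); rewrite H; field; rewrite c0 si0.
have sn : sin s = 2 * sin (s / 2) * cos (s / 2) by rewrite {1}(splitr s) sinD; ring.
rewrite N Ts Qs /areas (negbTE s0) mulr1 sn.
by split; field; rewrite s0 si0.
Qed.

(** The vertical momentum s is forced by [tau], and h by division. It remains to see that <k, h> is
    again s, which is the defining equation of [tau]. *)
Lemma endpoint_exists k x : 1 <= 2 - dotv (Jv k) x ->
  exists2 h, - (pi / 2) < dotv k h / 2 < pi / 2 & x = endpoint (dotv k h) h.
Proof.
move=> B1; pose s := 2 * atan (tau k x).
have s2 : s / 2 = atan (tau k x) by rewrite /s mulrC mulrA mulVf ?mul1r.
have sp : - (pi / 2) < s / 2 < pi / 2 by rewrite s2 atan_gtNpi2 atan_ltpi2.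
have cs : 0 < cos (s / 2) by apply: cos_gt0_pihalf.
have tE : tau k x = tan (s / 2) by rewrite s2 atanK.
pose N := sins s 1 ^+ 2 + coss s 1 ^+ 2.
have N0 : N != 0.
  rewrite /N; have [->|s0] := eqVneq s 0.
    by rewrite /sins /coss eqxx expr1n expr0n/= addr0 oner_eq0.
  have si0 : sin (s / 2) != 0 by apply: sin_neq0 => //; rewrite mulf_neq0// ?invr_eq0.
  have : s ^+ 2 * N != 0 by rewrite /N sins_coss_sqr mulf_neq0// expf_neq0.
  by rewrite mulf_eq0 negb_or => /andP[].
have St : sins s 1 * tau k x = coss s 1.
  rewrite tE /tan; have [->|s0] := eqVneq s 0.
    by rewrite /coss eqxx mul0r sin0 mul0r mulr0.
  apply: (mulfI s0); rewrite (mulrA s (sins s 1)) sins_half coss_half.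
  by field; rewrite gt_eqF.
have sN : s * N = 2 * coss s 1.
  have [->|s0] := eqVneq s 0; first by rewrite /coss eqxx mul0r mulr0.
  by apply: (mulfI s0); rewrite (mulrA s s N) -expr2 sins_coss_sqr (mulrCA s 2) coss_half; ring.
(* Division of x by the complex number sins + i coss: conjugate over squared modulus N. *)
pose h i := N^-1 * (sins s 1 * x i + (- coss s 1) * Jv x i).
have hk : dotv k h = s.
  rewrite /h dotvZr dotvZDr [dotv k (Jv x)]dotvC dotv_Jv.
  apply: (mulfI N0); rewrite mulrA divff// mul1r [N * s]mulrC sN.
  have A : dotv k x = tau k x * (2 - dotv (Jv k) x).
    by rewrite /tau ginvE// divfK// gt_eqF// (lt_le_trans ltr01).
  by rewrite A mulrA St; ring.
exists h; rewrite hk//; apply/funext => i; rewrite /endpoint.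
have -> : Jv h i = N^-1 * (sins s 1 * Jv x i + coss s 1 * x i).
  rewrite /h JvZ; congr (_ * _).
  rewrite (_ : Jv _ i = sins s 1 * Jv x i + - coss s 1 * Jv (Jv x) i); first by rewrite JvK; ring.
  by case: (split_ordP i) => j ->; rewrite ?(Jv_l, Jv_r); ring.
rewrite /h /N; move: N0; rewrite /N => N0; by field.
Qed.

End slices.

(** * From annihilating covectors to graphs over the horizontal coordinates *)

Section tube_description.
Context {R : realType} {d : nat}.
Local Notation n := (d + d)%N.
Implicit Types (p q W : heis R d) (l : cotangent R d).

Definition hcoord p (i : 'I_n) : R := row_mx p.1.1 p.1.2 0 i.

Definition hmom l (i : 'I_n) : R := row_mx (\row_j mom1 l j) (\row_j mom2 l j) 0 i.

Lemma hcoord_l p i : hcoord p (lshift d i) = p.1.1 0 i.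
Proof. exact: row_mxEl. Qed.

Lemma hcoord_r p i : hcoord p (rshift d i) = p.1.2 0 i.
Proof. exact: row_mxEr. Qed.

Lemma hmom_l l i : hmom l (lshift d i) = mom1 l i.
Proof. by rewrite /hmom row_mxEl mxE. Qed.

Lemma hmom_r l i : hmom l (rshift d i) = mom2 l i.
Proof. by rewrite /hmom row_mxEr mxE. Qed.

Lemma hcoord_inj p q : hcoord p = hcoord q -> p.2 = q.2 -> p = q.
Proof.
move: p q => [[x y] z] [[x' y'] z'] pq /= ->; congr (_, _, _); apply/rowP => i.
  by have := congr1 (@^~ (lshift d i)) pq; rewrite /= !hcoord_l.
by have := congr1 (@^~ (rshift d i)) pq; rewrite /= !hcoord_r.
Qed.

Lemma dotv_hcoord p q : dotv (hcoord p) (hcoord q) = dot p.1.1 q.1.1 + dot p.1.2 q.1.2.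
Proof.
by rewrite dotv_split /dot -big_split; apply: eq_bigr => i _; rewrite !hcoord_l !hcoord_r.
Qed.

Lemma verticalE q W : vertical q W = W.2 - dotv (Jv (hcoord q)) (hcoord W) / 2.
Proof.
rewrite /vertical mulrC dotv_split /dot -sumrB; congr (_ - _ / _); apply: eq_bigr => i _.
by rewrite Jv_l Jv_r !hcoord_l !hcoord_r; ring.
Qed.

Lemma pairingE l W : pairing l.2 W = dotv (hmom l) (hcoord W) + l.2.2 * vertical l.1 W.
Proof.
rewrite verticalE mulrBr addrCA addrC /pairing; congr (_ + _).
rewrite mulrA mulrAC -[l.2.2 / 2]mulrC !dotv_split mulr_sumr -sumrB /dot -big_split.
apply: eq_bigr => i _ /=; rewrite Jv_l Jv_r !hcoord_l !hcoord_r hmom_l hmom_r /mom1 /mom2.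
by field.
Qed.

Lemma hamiltonian_hmom l : 2 * hamiltonian l = dotv (hmom l) (hmom l).
Proof.
rewrite hamiltonianE mulrA divff// mul1r dotv_split.
by apply: eq_bigr => i _; rewrite hmom_l hmom_r !expr2.
Qed.

Lemma hcoord_sr_exp l :
  hcoord (sr_exp l) = (fun i => hcoord l.1 i + endpoint l.2.2 (hmom l) i).
Proof.
apply/funext => i; rewrite sr_expE /endpoint; case: (split_ordP i) => j ->.
  by rewrite !hcoord_l hmom_l Jv_l hmom_r /= mxE /sol_x; ring.
by rewrite !hcoord_r hmom_r Jv_r hmom_l /= mxE /sol_y; ring.
Qed.

Lemma sr_exp_z l : (sr_exp l).2 = l.1.2 +
  dotv (Jv (hcoord l.1)) (endpoint l.2.2 (hmom l)) / 2 +
  areas l.2.2 1 / 2 * dotv (hmom l) (hmom l).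
Proof.
rewrite sr_expE /= /sol_z mulrDr addrA; congr (_ + _ + _).
  rewrite mulrC dotv_split; congr (_ / _); apply: eq_bigr => i _.
  by rewrite /endpoint !Jv_l !Jv_r !hcoord_l !hcoord_r !hmom_l !hmom_r; ring.
rewrite mulrA [2^-1 * _]mulrC dotv_split; congr (_ * _); apply: eq_bigr => i _.
by rewrite hmom_l hmom_r !expr2.
Qed.

Lemma covector_exists q (h : 'I_n -> R) (s : R) :
  exists l, [/\ l.1 = q, l.2.2 = s & hmom l = h].
Proof.
exists (q, (\row_i (h (lshift d i) + s * q.1.2 0 i / 2),
            \row_i (h (rshift d i) - s * q.1.1 0 i / 2), s : R^o)).
split=> //; apply/funext => i; case: (split_ordP i) => j ->.
  by rewrite hmom_l /mom1 /= mxE; ring.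
by rewrite hmom_r /mom2 /= mxE; ring.
Qed.

Context {L : R} (D : curve_data d L) (g G : R -> heis R d).
Context (T : heis R d -> set (heis R d)).
Hypotheses (gw : forall t, t \in `[0, L] -> hcoord (g t) = cw D t)
  (gz : forall t, t \in `[0, L] -> (g t).2 = cz D t)
  (Gk : forall t, t \in `[0, L] -> hcoord (G t) = (fun i => - cv D t * ck D t i))
  (Gv : forall t, t \in `[0, L] -> vertical (g t) (G t) = cv D t)
  (TG : forall t, t \in `[0, L] -> T (g t) = [set W | exists c : R, W = c *: G t]).

Lemma pairingZ q (c : R) W : pairing q (c *: W) = c * pairing q W.
Proof.
rewrite /pairing [dot q.1.1 _]dotC [dot q.1.2 _]dotC !dotZl.
rewrite [dot W.1.1 _]dotC [dot W.1.2 _]dotC.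
have -> : (c *: W).2 = c * W.2 by [].
by ring.
Qed.

Lemma annihilator_dual t l : t \in `[0, L] -> l.1 = g t ->
  (forall W, T l.1 W -> pairing l.2 W = 0) <-> l.2.2 = dotv (ck D t) (hmom l).
Proof.
move=> tI lg.
have v0 : cv D t != 0.
  apply/eqP => v0; have := cv_ge D t; rewrite v0 mulr0.
  by rewrite leNgt cv0_gt0.
have P : pairing l.2 (G t) = cv D t * (l.2.2 - dotv (ck D t) (hmom l)).
  by rewrite pairingE lg Gv// Gk// dotvZr [dotv (hmom l) _]dotvC; ring.
rewrite lg TG//; split=> [H|H W [c ->]].
  have : pairing l.2 (G t) = 0 by apply: H; exists 1; rewrite scale1r.
  by rewrite P => /eqP; rewrite mulf_eq0 (negbTE v0)/= subr_eq0 => /eqP.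
by rewrite pairingZ P H subrr !mulr0.
Qed.

Variables (e r : R).
Hypotheses (e0 : 0 < e) (r0 : 0 < r) (re : r ^+ 2 <= (e / 4) ^+ 2)
  (He : forall t x, dotv x x < e ^+ 2 ->
    [/\ 1 < 2 - dotv (Jv (ck D t)) x, `|tau (ck D t) x| <= 1,
      0 < csg D * dphi D t x & 0 <= pden (ck D t) x])
  (Hc : forall t x, dotv x x < e ^+ 2 -> `|dotv (ck D t) x| <= 1).

(** For a short covector |<k, h>| <= 1 < pi, so the parametrization by tan (s / 2) is valid; its
    displacement is no longer than h, as the multiplier has modulus at most 1. Conversely
    [endpoint_exists] supplies the covector, whose length is then given by [len2]. *)
Lemma tubeP p : tube (g @` [set t | 0 <= t <= L]) T r p <->
  exists2 t, t \in `[0, L] &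
    len2 (ck D t) (disp D t (hcoord p)) < r ^+ 2 /\ p.2 = phi D t (hcoord p).
Proof.
have r2e : r ^+ 2 <= e ^+ 2.
  apply: (le_trans re); rewrite ler_pXn2r ?nnegrE ?divr_ge0 ?ltW//.
  by have := e0; lra.
have phiE t h : t \in `[0, L] -> let s := dotv (ck D t) h in let x := endpoint s h in
    let W i := cw D t i + x i in
    - (pi / 2) < s / 2 < pi / 2 -> 1 <= 2 - dotv (Jv (ck D t)) x ->
    len2 (ck D t) (disp D t W) = dotv h h /\
    phi D t W = cz D t + dotv (Jv (cw D t)) x / 2 + areas s 1 / 2 * dotv h h.
  move=> tI s x W sp B1; have [E1 E2] := slice_endpoint sp B1.
  have dW : disp D t W = x by apply/funext => i; rewrite /disp /W addrAC subrr add0r.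
  rewrite /phi dW E1 E2; split=> //; congr (_ + _ / _ + _).
  rewrite /W; transitivity (dotv (Jv (cw D t)) (cw D t) + dotv (Jv (cw D t)) x).
    by rewrite /dotv -big_split; apply: eq_bigr => i _; rewrite mulrDr.
  by rewrite dotv_Jvv add0r.
split=> [[l [[[t tI gt] Al] rl] <-]|[t tI [lr pz]]].
  have tI' : t \in `[0, L] by rewrite in_itv.
  have /(annihilator_dual tI' (esym gt)) sE := Al.
  have hr : dotv (hmom l) (hmom l) < r ^+ 2.
    rewrite -hamiltonian_hmom; rewrite -(ltr_sqrt _ (exprn_gt0 2 r0)).
    by rewrite sqrtr_sqr gtr0_norm.
  have s1 := Hc t (lt_le_trans hr r2e).
  have xr : dotv (endpoint l.2.2 (hmom l)) (endpoint l.2.2 (hmom l)) < e ^+ 2.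
    apply: le_lt_trans (lt_le_trans hr r2e); rewrite dotv_endpoint.
    by rewrite ler_piMl ?dotvv_ge0// sins_coss_le1.
  have [B1 _ _ _] := He t xr.
  have sp : - (pi / 2) < dotv (ck D t) (hmom l) / 2 < pi / 2.
    have := pi_ge2 R; move: s1; rewrite ler_norml => /andP[? ?] ?.
    by apply/andP; split; lra.
  rewrite sE in B1.
  have [E1 E2] := phiE t (hmom l) tI' sp (ltW B1).
  exists t => //; rewrite hcoord_sr_exp -gt gw// sE E1 E2; split=> //.
  by rewrite sr_exp_z -gt gz// gw// sE.
have xe : dotv (disp D t (hcoord p)) (disp D t (hcoord p)) < e ^+ 2.
  exact: le_lt_trans (sqnorm_le_len2 _ _) (lt_le_trans lr r2e).
have [B1 _ _ _] := He t xe.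
have [h sp xE] := endpoint_exists (ltW B1).
have [l [lq ls lh]] := covector_exists (g t) h (dotv (ck D t) h).
have WE : hcoord p = (fun i => cw D t i + endpoint (dotv (ck D t) h) h i).
  by apply/funext => i; rewrite -xE /disp addrC subrK.
rewrite xE in B1.
have [E1 E2] := phiE t h tI sp (ltW B1).
rewrite -WE in E1 E2.
exists l; last first.
  apply: hcoord_inj; first by rewrite hcoord_sr_exp lq gw// ls lh WE.
  by rewrite sr_exp_z lq gw// gz// ls lh pz E2.
split; first split.
- by exists t => //; rewrite /= -in_itv.
- by apply/(annihilator_dual tI lq); rewrite ls lh.
- rewrite /= hamiltonian_hmom lh -E1; rewrite -[X in _ < X](gtr0_norm r0) -sqrtr_sqr.
  by rewrite ltr_sqrt// exprn_gt0.
Qed.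

End tube_description.

(** * Data of a non-characteristic curve *)

Section relative_derivative.
Context {R : realType} (L : R) (L0 : 0 < L).
Local Notation I := [set t : R | 0 <= t <= L].

(** Freezing the curve outside [0, L] turns relative continuity into continuity on the line and
    makes bounds on [0, L] global. *)
Definition clamp (t : R) : R := Num.min L (Num.max 0 t).

Lemma clamp_in t : I (clamp t).
Proof. by rewrite /= /clamp le_min ge_min lexx (ltW L0) le_max lexx. Qed.

Lemma clamp_id t : I t -> clamp t = t.
Proof. by move=> /andP[t0 tL]; rewrite /clamp max_r// min_r. Qed.

Lemma continuous_clamp_comp (V : topologicalType) (f : R -> V) :
  (forall t, I t -> f s @[s --> within I (nbhs t)] --> f t) ->
  continuous (f \o clamp).
Proof.
move=> cf t; have cc : clamp s @[s --> t] --> within I (nbhs (clamp t)).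
  move=> A /= nA.
  have cmax : {for t, continuous (fun s : R => Num.max 0 s)}.
    exact: (continuous_max (cvg_cst _) (cvg_id)).
  have : \forall s \near t, I (clamp s) -> A (clamp s).
    exact: (continuous_min (cvg_cst L) cmax) _ nA.
  by apply: filterS => s; apply; exact: clamp_in.
exact: (cvg_comp clamp f cc (cf _ (clamp_in t))).
Qed.

Lemma relative_derivative_continuous (V : normedModType R) (f : R -> V) (t : R) (v : V) :
  diff_quotient f t s @[s --> within I (t^')] --> v -> f s @[s --> within I (nbhs t)] --> f t.
Proof.
move=> H; have H' : f s @[s --> within I (t^')] --> f t.
  have -> : f t = (t - t) *: v + f t by rewrite subrr scale0r add0r.
  have ct : (s - t) *: diff_quotient f t s + f t @[s --> within I (t^')] --> (t - t) *: v + f t.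
    apply: cvgD; last exact: cvg_cst.
    apply: cvgZ H; apply: cvgB; last exact: cvg_cst.
    by apply: cvg_within_filter; apply: cvg_within_filter; exact: cvg_id.
  apply: cvg_trans ct; apply: near_eq_cvg; rewrite near_withinE.
  near=> s => _; have st : s != t by near: s; exact: nbhs_dnbhs_neq.
  by rewrite /diff_quotient scalerA divff ?subr_eq0// scale1r subrK.
move=> A nA; have := H' A nA; rewrite /= => nA'.
suff : \forall s \near t, I s -> A (f s) by [].
have : \forall s \near t, s != t -> I s -> A (f s) by exact: nA'.
apply: filterS => s H2; have [->|] := eqVneq s t; last exact: H2.
by move=> _; exact: nbhs_singleton.
Unshelve. all: by end_near. Qed.

Lemma relative_derivative_interior (f : R -> R) (t f' : R) :
  t \in `]0, L[ -> diff_quotient f t s @[s --> within I (t^')] --> (f' : R) ->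
  is_derive t 1 (f \o clamp) f'.
Proof.
move=> tI H; apply/is_derive_cvg.
have cs : h *: 1 + t @[h --> (0:R)^'] --> t.
  rewrite -[X in _ --> X]add0r -[X in _ --> X + _](scale0r (1 : R)).
  by apply: cvgD; [apply: cvgZr_tmp; exact: cvg_within|exact: cvg_cst].
have nI : \forall s \near t, I s.
  have : \forall s \near t, s \in `]0, L[ by exact: near_in_itvoo.
  by apply: filterS => s; rewrite in_itv/= => /andP[/ltW -> /ltW ->].
have ct : h *: 1 + t @[h --> (0:R)^'] --> within I (t^').
  move=> A /= nA; have nA' : \forall s \near t, s != t -> I s -> A s by exact: nA.
  have nA2 := cs _ nA'; have nI2 := cs _ nI.
  rewrite /nbhs/=; near=> h.
  have h0 : h != 0 by near: h; exact: nbhs_dnbhs_neq.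
  have : I (h *: 1 + t) by near: h; exact: nI2.
  have : (h *: 1 + t != t -> I (h *: 1 + t) -> A (h *: 1 + t)) by near: h; exact: nA2.
  apply; rewrite -subr_eq0 addrK.
  by rewrite /GRing.scale/= mulr1.
have := cvg_comp _ _ ct H; apply: cvg_trans; apply: near_eq_cvg.
have nI2 := cs _ nI.
near=> h.
have Ih : I (h *: 1 + t) by near: h; exact: nI2.
have It : I t by exact: nbhs_singleton nI.
by rewrite /= /diff_quotient !clamp_id// addrK /GRing.scale/= mulr1.
Unshelve. all: by end_near. Qed.

End relative_derivative.

Section curve_extraction.
Context {R : realType} {d : nat} (L : R) (L0 : 0 < L).
Local Notation n := (d + d)%N.
Local Notation I := [set t : R | 0 <= t <= L].
Implicit Types (p q W : heis R d).

Lemma hcoordZB (a : R) W W' (i : 'I_n) :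
  hcoord (a *: (W - W')) i = a * (hcoord W i - hcoord W' i).
Proof. by case: (split_ordP i) => j ->; rewrite ?hcoord_l ?hcoord_r /= !mxE. Qed.

Lemma verticalZB q (a : R) W W' :
  vertical q (a *: (W - W')) = a * (vertical q W - vertical q W').
Proof.
rewrite !verticalE; have -> : (a *: (W - W')).2 = a * (W.2 - W'.2) by [].
rewrite (_ : hcoord (a *: _) = (fun i => a * (hcoord W i - hcoord W' i))); last first.
  by apply/funext => i; exact: hcoordZB.
by rewrite dotvZr dotvBr; ring.
Qed.

Lemma vertical0 q : vertical q 0 = 0.
Proof. by have := verticalZB q 0 0 0; rewrite scale0r mul0r. Qed.

Lemma verticalD q W W' : vertical q (W + W') = vertical q W + vertical q W'.
Proof.
have := verticalZB q 1 W (0 - W'); rewrite scale1r opprB subr0 mul1r => ->.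
by have := verticalZB q 1 0 W'; rewrite scale1r mul1r vertical0 => ->; rewrite opprB subr0.
Qed.

Lemma verticalZ q (a : R) W : vertical q (a *: W) = a * vertical q W.
Proof. by have := verticalZB q a W 0; rewrite vertical0 !subr0. Qed.

Lemma vertical_distribution q W : Defs.distribution q W -> vertical q W = 0.
Proof.
move=> [c ->]; apply: (@big_ind _ (fun W => vertical q W = 0)).
- exact: vertical0.
- by move=> x y x0 y0; rewrite verticalD x0 y0 addr0.
- by move=> k _; rewrite verticalZ vertical_hframe mulr0.
Qed.

Lemma continuous_hcoord i : continuous (fun p : heis R d => hcoord p i : R).
Proof.
move=> p; case: (split_ordP i) => j ->.
  rewrite (_ : hcoord^~ _ = (fun p => p.1.1 0 j)); last by apply/funext => ?; exact: hcoord_l.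
  apply: (cvg_comp (fun p : heis R d => p.1.1) (fun M : 'rV[R]_d => M 0 j)); last exact: coord_continuous.
  by apply: (cvg_comp (fun p : heis R d => p.1) fst); exact: cvg_fst.
rewrite (_ : hcoord^~ _ = (fun p => p.1.2 0 j)); last by apply/funext => ?; exact: hcoord_r.
apply: (cvg_comp (fun p : heis R d => p.1.2) (fun M : 'rV[R]_d => M 0 j)); last exact: coord_continuous.
by apply: (cvg_comp (fun p : heis R d => p.1) snd); [exact: cvg_fst|exact: cvg_snd].
Qed.

Context (f : R -> heis R d).
Hypothesis df : derivable_on I f.

Let dfE t : I t -> diff_quotient f t s @[s --> within I (t^')] --> deriv_on I f t.
Proof. exact: df. Qed.

Lemma derivable_on_continuous : continuous (f \o clamp L).
Proof.
apply: continuous_clamp_comp => // t It.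
by apply: relative_derivative_continuous; exact: dfE.
Qed.

Lemma is_derive_hcoord t i : t \in `]0, L[ ->
  is_derive t 1 (fun t => hcoord (f (clamp L t)) i) (hcoord (deriv_on I f t) i).
Proof.
move=> tI; refine (@relative_derivative_interior R L (fun t => hcoord (f t) i) t _ tI _).
have It : I t by move: tI; rewrite in_itv/= => /andP[/ltW -> /ltW ->].
have := cvg_comp _ _ (dfE It) (@continuous_hcoord i _).
by apply: cvg_trans; apply: near_eq_cvg; apply: nearW => s; exact: hcoordZB.
Qed.

Lemma is_derive_hz t : t \in `]0, L[ ->
  is_derive t 1 (fun t => (f (clamp L t)).2 : R) ((deriv_on I f t).2 : R).
Proof.
move=> tI; refine (@relative_derivative_interior R L (fun t => (f t).2) t _ tI _).
have It : I t by move: tI; rewrite in_itv/= => /andP[/ltW -> /ltW ->].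
have c2 : p.2 @[p --> deriv_on I f t] --> (deriv_on I f t).2 by exact: cvg_snd.
have := cvg_comp _ _ (dfE It) c2.
by apply: cvg_trans; apply: near_eq_cvg; exact: nearW.
Qed.

End curve_extraction.

Lemma sg_mul_gt0 (R : realType) (f : R -> R) (t : R) :
  (forall s, f s != 0) -> continuous f -> 0 <= t -> 0 < Num.sg (f 0) * f t.
Proof.
move=> fn0 cf t0; rewrite ltNge; apply/negP => H.
have cg : {within `[0, t], continuous (fun s => Num.sg (f 0) * f s)}.
  by apply: continuous_subspaceT => x; apply: cvgM; [exact: cvg_cst|exact: cf].
have f0 : 0 < Num.sg (f 0) * f 0 by rewrite -normrEsg normr_gt0.
have [|c _ /eqP] := IVT t0 cg (v := 0); first by rewrite ge_min le_max (ltW f0) H orbT.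
by rewrite mulf_eq0 sgr_eq0 !(negbTE (fn0 _)).
Qed.

Section curve_data_of.
Context {R : realType} {d : nat} (L : R) (L0 : 0 < L) (g : R -> heis R d).
Local Notation n := (d + d)%N.
Local Notation I := [set t : R | 0 <= t <= L].
Local Notation G := (deriv_on I g).
Local Notation A := (deriv_on I G).
Local Notation T := (curve_tangent I g).
Hypotheses (gC2 : C2_on I g) (gemb : embedded_on I g)
  (gnc : non_characteristic (g @` I) T)
  (gunit : forall t, I t -> normR (g t) (G t) = 1).
Local Notation cl := (clamp L).

Let cg : continuous (g \o cl).
Proof. by apply: derivable_on_continuous => //; case: gC2. Qed.

Let cG : continuous (G \o cl).
Proof. by apply: derivable_on_continuous => //; case: gC2. Qed.

Let cA : continuous (A \o cl).
Proof. by apply: continuous_clamp_comp => //; apply/subspace_continuousP; case: gC2. Qed.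

Let w t (i : 'I_n) : R := hcoord (g (cl t)) i.
Let u t (i : 'I_n) : R := hcoord (G (cl t)) i.
Let b t (i : 'I_n) : R := hcoord (A (cl t)) i.
Let z t : R := (g (cl t)).2.
Let v t : R := vertical (g (cl t)) (G (cl t)).
Let va t : R := vertical (g (cl t)) (A (cl t)).

Let cw' i : continuous (w^~ i).
Proof. by move=> t; exact: (cvg_comp _ _ (@cg t) (@continuous_hcoord _ _ i _)). Qed.

Let cu' i : continuous (u^~ i).
Proof. by move=> t; exact: (cvg_comp _ _ (@cG t) (@continuous_hcoord _ _ i _)). Qed.

Let cb' i : continuous (b^~ i).
Proof. by move=> t; exact: (cvg_comp _ _ (@cA t) (@continuous_hcoord _ _ i _)). Qed.

Let csnd (f : R -> heis R d) : continuous (f \o cl) -> continuous (fun t => (f (cl t)).2 : R).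
Proof.
move=> cf t; have c2 : p.2 @[p --> f (cl t)] --> (f (cl t)).2 by exact: cvg_snd.
exact: (cvg_comp _ _ (cf t) c2).
Qed.

Let cvert (f : R -> heis R d) : continuous (f \o cl) ->
  continuous (fun t => vertical (g (cl t)) (f (cl t)) : R).
Proof.
move=> cf t; rewrite /continuous_at verticalE.
rewrite (_ : (fun t => _) = (fun t => (f (cl t)).2 - dotv (Jv (w t)) (hcoord (f (cl t))) / 2)); last first.
  by apply/funext => s; rewrite verticalE.
apply: cvgB; first exact: csnd.
apply: cvgM; last exact: cvg_cst.
apply: (@continuous_dotv _ _ t _ (fun s => Jv (w s)) (fun s => hcoord (f (cl s)))) => i.
  by apply: continuous_Jv => j; exact: cw'.
exact: (cvg_comp _ _ (cf t) (@continuous_hcoord _ _ i _)).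
Qed.

Let cv' : continuous v. Proof. exact (@cvert G cG). Qed.
Let cva : continuous va. Proof. exact (@cvert A cA). Qed.

Lemma curve_tangentE t : I t -> T (g t) = [set W | exists c : R, W = c *: G t].
Proof.
move=> It; apply/seteqP; split=> W /=.
  move=> [s [Is gst [c ->]]]; exists c.
  by case: gemb => inj _ _; rewrite (inj s t)// inE.
by move=> [c ->]; exists t; split=> //; exists c.
Qed.

Let v0 t : v t != 0.
Proof.
have It := clamp_in L0 t.
(* The Reeb vector is a horizontal vector plus c times the velocity; comparing vertical parts gives
   1 = c v. *)
have : [set: heis R d] (reeb (g (cl t))) by [].
rewrite -(gnc (ex_intro2 _ _ _ It erefl)) => -[U dU [W]].
rewrite curve_tangentE// => -[c ->] /(congr1 (vertical (g (cl t)))).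
rewrite verticalD vertical_distribution// verticalZ vertical_reeb add0r -/(v t).
by move=> H; apply/eqP => vt; move/eqP: H; rewrite vt mulr0 eq_sym oner_eq0.
Qed.

Let uv t : dotv (u t) (u t) + v t ^+ 2 = 1.
Proof.
have := gunit (clamp_in L0 t); rewrite /normR.
rewrite /gR -dotv_hcoord -/(u t) -/(v t) -expr2 => H.
have h0 : 0 <= dotv (u t) (u t) + v t ^+ 2 by rewrite addr_ge0 ?dotvv_ge0 ?sqr_ge0.
by rewrite -(sqr_sqrtr h0) H expr1n.
Qed.

Let k t i : R := - (v t)^-1 * u t i.
Let l t i : R := - (v t)^-1 * b t i + va t * (v t)^-1 ^+ 2 * u t i.

Let cvi : continuous (fun t => (v t)^-1).
Proof. by move=> t; apply: cvgV => //; exact: cv'. Qed.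

Let ck' i : continuous (k^~ i).
Proof. by move=> t; apply: cvgM; [apply: cvgN; exact: cvi|exact: cu']. Qed.

Let cl' i : continuous (l^~ i).
Proof.
move=> t; apply: cvgD; apply: cvgM.
- by apply: cvgN; exact: cvi.
- exact: cb'.
- by apply: cvgM; [exact: cva|apply: cvgM; exact: cvi].
- exact: cu'.
Qed.

Let clI t : t \in `]0, L[ -> cl t = t.
Proof. by rewrite in_itv/= => /andP[/ltW a0 /ltW aL]; apply: clamp_id => /=; rewrite a0. Qed.

Let dw t i : t \in `]0, L[ -> is_derive t 1 (w^~ i) (u t i).
Proof.
by move=> tI; rewrite /u clI//; apply: is_derive_hcoord => //; case: gC2.
Qed.

Let du t i : t \in `]0, L[ -> is_derive t 1 (u^~ i) (b t i).
Proof.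
by move=> tI; rewrite /b clI//; apply: is_derive_hcoord => //; case: gC2.
Qed.

Let dv t : t \in `]0, L[ -> is_derive t 1 v (va t).
Proof.
move=> tI; have [_ dG _] := gC2; have dG2 := is_derive_hz dG tI.
rewrite -[in X in is_derive _ _ _ X.2](clI tI) in dG2.
have dd := is_derive_dotv (is_derive_Jv (fun i => dw i tI)) (fun i => du i tI).
rewrite dotv_Jvv add0r in dd.
rewrite (_ : v = (fun t => (G (cl t)).2 - dotv (Jv (w t)) (u t) / 2)); last first.
  by apply/funext => s; rewrite /v verticalE.
have half (f1 f2 : R -> R) (a1 a2 : R) : is_derive t 1 f1 a1 -> is_derive t 1 f2 a2 ->
    is_derive t 1 (fun s => f1 s - f2 s / 2) (a1 - a2 / 2).
  by move=> ? ?; apply: is_derive_eq; rewrite /GRing.scale/=; ring.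
by rewrite /va verticalE; exact: half.
Qed.

Let dk t i : t \in `]0, L[ -> is_derive t 1 (k^~ i) (l t i).
Proof.
move=> tI; have := dv tI; have := du i tI => du1 dv1.
have dvi : is_derive t 1 (fun t => (v t)^-1) (- (v t) ^- 2 *: va t) by exact: is_deriveV.
by apply: is_derive_eq; rewrite /l /GRing.scale/= exprVn; ring.
Qed.

Let dz t : t \in `]0, L[ -> is_derive t 1 z (v t - v t * dotv (Jv (w t)) (k t) / 2).
Proof.
move=> tI; rewrite /k dotvZr mulrA mulrN mulfV// mulN1r mulNr opprK /v verticalE subrK.
by rewrite clI//; apply: is_derive_hz => //; case: gC2.
Qed.

Let vpos t : 0 < Num.sg (v 0) * v t.
Proof.
have -> : v t = v (cl t) by rewrite /v (clamp_id (clamp_in L0 t)).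
by apply: sg_mul_gt0 (v0) (cv') _; case/andP: (clamp_in L0 t).
Qed.

Let kl_bound : exists K, forall t i, `|k t i| <= K /\ `|l t i| <= K.
Proof.
(* A single continuous function dominates all coordinates, so one maximum on [0, L] bounds them
   all. *)
pose f t := \sum_i (`|k t i| + `|l t i|).
have cf : {within `[0, L], continuous f}.
  apply: continuous_subspaceT => t; apply: cvg_big => [|i _]; first exact: add_continuous.
  by apply: cvgD; apply: cvg_norm; [exact: ck'|exact: cl'].
have [c _ H] := EVT_max (ltW L0) cf.
exists (f c) => t i.
have fi : `|k t i| + `|l t i| <= f c.
  have ccl s : cl (cl s) = cl s by exact/clamp_id/clamp_in.
  have -> : k t i = k (cl t) i by rewrite /k /v /u ccl.
  have -> : l t i = l (cl t) i by rewrite /l /v /u /va /b ccl.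
  have : cl t \in `[0, L] by rewrite in_itv/=; exact: clamp_in.
  by move=> /H; apply: le_trans; rewrite /f (bigD1 i)//= lerDl sumr_ge0.
have := normr_ge0 (k t i); have := normr_ge0 (l t i).
by split; lra.
Qed.

Lemma curve_data_exists : exists D : curve_data d L, [/\
  [/\ forall t, t \in `[0, L] -> hcoord (g t) = cw D t,
     forall t, t \in `[0, L] -> (g t).2 = cz D t,
     forall t, t \in `[0, L] -> hcoord (G t) = (fun i => - cv D t * ck D t i) &
     forall t, t \in `[0, L] -> vertical (g t) (G t) = cv D t],
  forall t, cv D t ^+ 2 * dotv (ck D t) (ck D t) = 1 - cv D t ^+ 2 &
  forall t, t \in `[0, L] -> reeb_angle T (g t) = `|cv D t|].
Proof.
have [K KP] := kl_bound.
have cf : {within `[0, L], continuous (fun t => Num.sg (v 0) * v t)}.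
  by apply: continuous_subspaceT => x; apply: cvgM; [exact: cvg_cst|exact: cv'].
have [c _ cmin] := EVT_min (ltW L0) cf.
have vge t : Num.sg (v 0) * v c <= Num.sg (v 0) * v t.
  have -> : v t = v (cl t) by rewrite /v (clamp_id (clamp_in L0 t)).
  by apply: cmin; rewrite in_itv/=; exact: clamp_in.
have v1 t : `|v t| <= 1.
  have := uv t; have := dotvv_ge0 (u t); move: (dotv _ _) (v t) => y x y0 E.
  by rewrite -(ler_pXn2r (ltn0Sn 1)) ?nnegrE// expr1n -normrX ger0_norm ?sqr_ge0//; lra.
have uk t : u t = (fun i => - v t * k t i).
  by apply/funext => i; rewrite /k mulrA mulrNN mulfV// mul1r.
have dw2 t i : t \in `]0, L[ -> is_derive t 1 (w^~ i) (- (v t * k t i)).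
  by move=> tI; have := dw i tI; rewrite uk mulNr.
have sg1 : `|Num.sg (v 0)| = 1 by rewrite normr_sg v0.
pose D := @CurveData R d L w k l z v (Num.sg (v 0)) K (Num.sg (v 0) * v c)
  cw' ck' cl' (csnd cg) cv' dw2 (fun t i tI => @dk t i tI) dz sg1 (vpos c) vge v1
  (fun t i => (KP t i).1) (fun t i => (KP t i).2).
exists D; have clJ t : t \in `[0, L] -> cl t = t by rewrite in_itv/=; exact: clamp_id.
split.
- split=> t /clJ tI.
  + by apply/funext => i; rewrite /= /w tI.
  + by rewrite /= /z tI.
  + by have := uk t; rewrite /u tI.
  + by rewrite /= /v tI.
- move=> t /=; have := uv t; rewrite uk dotvZr dotvC dotvZr => <-; ring.
- move=> t tJ; have tI := clJ _ tJ; have It : I t by move: tJ; rewrite in_itv.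
  have vE : vertical (g t) (G t) = v t by rewrite /v tI.
  (* On a tangent line spanned by a unit vector the quotient takes only the values v and - v. The
     supremum is |v|, attained at the velocity times the sign of v. *)
  have val (a : R) : a != 0 ->
      gR (g t) (a *: G t) (reeb (g t)) / normR (g t) (a *: G t) = Num.sg a * v t.
    move=> a0; have -> : gR (g t) (a *: G t) (reeb (g t)) = a * v t.
      rewrite /gR vertical_reeb verticalZ vE /= ![dot _ 0]dotC !dot0l.
      by rewrite !add0r mulr1.
    have -> : normR (g t) (a *: G t) = `|a|.
      have -> : `|a| = `|a| * normR (g t) (G t) by rewrite gunit// mulr1.
      rewrite /normR -sqrtr_sqr -sqrtrM ?sqr_ge0//; congr Num.sqrt.
      rewrite /gR verticalZ !dotZl ![dot _ (a *: _)]dotC !dotZl; ring.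
    by rewrite {1}[a]numEsg; field; rewrite normr_eq0.
  rewrite /reeb_angle.
  have G0 : G t <> 0 by case: gemb => _ + _; apply.
  have ub : ubound [set gR (g t) W (reeb (g t)) / normR (g t) W |
      W in [set W | T (g t) W /\ W <> 0]] `|v t|.
    move=> _ [W [TW W0] <-]; move: TW; rewrite (curve_tangentE It) => -[a Wa].
    have a0 : a != 0 by apply/eqP => a0; apply: W0; rewrite Wa a0 scale0r.
    rewrite Wa (val _ a0); apply: le_trans (ler_norm _) _.
    by rewrite normrM normr_sg a0 mul1r.
  apply/eqP; rewrite eq_le; apply/andP; split.
    apply: ge_sup; last exact: ub.
    by eexists; exists (G t) => //; split=> //; rewrite curve_tangentE//; exists 1; rewrite scale1r.
  apply: ub_le_sup; first by exists `|v t|.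
  have sv : Num.sg (v t) != 0 by rewrite sgr_eq0 v0.
  exists (Num.sg (v t) *: G t).
    split; first by rewrite curve_tangentE//; exists (Num.sg (v t)).
    by move=> /eqP; rewrite scaler_eq0 (negbTE sv)/= => /eqP.
  by rewrite (val _ sv) sgr_id -normrEsg.
Qed.

End curve_data_of.

(** * Disjointness of the slices *)

Section separation.
Context {R : realType} {d : nat} {L : R} (D : curve_data d L) (L0 : 0 < L).
Local Notation n := (d + d)%N.
Let K : R := `|cK D|.

Lemma cw_lipschitz t t' i : 0 <= t <= t' -> t' <= L -> `|cw D t' i - cw D t i| <= K * (t' - t).
Proof.
move=> /andP[t0 tt'] t'L.
have cf : {within `[t, t'], continuous (fun s => cw D s i)} by apply: continuous_subspaceT; exact: cw_cont.
have df s : s \in `]t, t'[ -> is_derive s 1 (fun s : R => cw D s i : R) (- (cv D s * ck D s i)).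
  rewrite in_itv/= => /andP[ts st']; apply: cw_der.
  by rewrite in_itv/= (le_lt_trans t0 ts) (lt_le_trans st' t'L).
have [c _ ->] := MVT_segment tt' df cf.
rewrite normrM normrN normrM [`|t' - t|]ger0_norm ?subr_ge0// ler_wpM2r ?subr_ge0//.
rewrite -[K]mul1r; apply: ler_pM => //; first exact: cv_le.
exact: le_trans (ck_le D c i) (ler_norm _).
Qed.

Lemma cw_small (e : R) : 0 < e -> exists2 dl : R, 0 < dl &
  forall t t', t \in `[0, L] -> t' \in `[0, L] -> `|t - t'| <= dl ->
  dotv (fun i => cw D t i - cw D t' i) (fun i => cw D t i - cw D t' i) <= e ^+ 2.
Proof.
(* N = n + 1 and K + 1 keep the denominator below positive when d = 0 or K = 0; N >= 1 also bounds s
   by N * s. *)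
move=> e0; pose N : R := n%:R + 1; have N1 : 1 <= N by rewrite lerDr.
have K0 : 0 <= K by exact: normr_ge0.
have P0 : 0 < N * (K + 1) by rewrite mulr_gt0 ?(lt_le_trans ltr01 N1)//; lra.
have lip t t' i : t \in `[0, L] -> t' \in `[0, L] -> `|cw D t i - cw D t' i| <= K * `|t - t'|.
  rewrite !in_itv/= => /andP[t0 tL] /andP[t'0 t'L].
  have [tt'|/ltW tt'] := leP t t'.
    rewrite distrC [`|t - t'|]distrC [`|t' - t|]ger0_norm ?subr_ge0//.
    by apply: cw_lipschitz => //; rewrite t0.
  rewrite [`|t - t'|]ger0_norm ?subr_ge0//.
  by apply: cw_lipschitz => //; rewrite t'0.
exists (e / (N * (K + 1))); first exact: divr_gt0.
move=> t t' tI t'I tt'.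
pose s := K * (e / (N * (K + 1))).
have s0 : 0 <= s by apply: mulr_ge0 => //; apply: ltW; exact: divr_gt0.
have ws i : `|cw D t i - cw D t' i| <= s.
  by apply: (le_trans (lip t t' i tI t'I)); exact: ler_wpM2l.
apply: (le_trans (ler_norm _)); apply: (le_trans (dotv_le s0 ws ws)).
have N0 : N != 0 by rewrite gt_eqF// (lt_le_trans ltr01).
have K1 : K + 1 != 0 by rewrite gt_eqF//; lra.
have Ns : N * s <= e.
  rewrite /s (_ : N * _ = e * (K / (K + 1))); last first.
    by field; rewrite ?K1 ?N0.
  by apply: ler_piMr; [exact: ltW|rewrite ler_pdivrMr; lra].
have ns : n%:R * s <= N * s by apply: ler_wpM2r => //; rewrite /N; lra.
have ns0 : 0 <= n%:R * s by rewrite mulr_ge0.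
have sN : s <= N * s by rewrite ler_peMl.
rewrite expr2; apply: ler_pM => //; [exact: le_trans ns Ns|exact: le_trans sN Ns].
Qed.

Hypothesis inj : forall t t', t \in `[0, L] -> t' \in `[0, L] ->
  cw D t = cw D t' -> cz D t = cz D t' -> t = t'.

(** The squared distance of two points of the curve is continuous and, by injectivity, positive on
    the compact set of pairs of times at least dl apart; its minimum there is rho. *)
Lemma separated (dl : R) : 0 < dl -> exists2 rho : R, 0 < rho &
  forall t t', t \in `[0, L] -> t' \in `[0, L] -> dl <= `|t - t'| ->
  rho <= dotv (fun i => cw D t i - cw D t' i) (fun i => cw D t i - cw D t' i) +
    (cz D t - cz D t') ^+ 2.
Proof.
move=> dl0; pose F (p : R * R) : R :=
  dotv (fun i => cw D p.1 i - cw D p.2 i) (fun i => cw D p.1 i - cw D p.2 i) +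
    (cz D p.1 - cz D p.2) ^+ 2.
pose A : set (R * R) := (`[0, L]%classic `*` `[0, L]%classic) `&` [set p | dl <= `|p.1 - p.2|].
have cfst (f : R -> R) : continuous f -> continuous (fun p : R * R => f p.1 : R).
  by move=> cf p; apply: (cvg_comp fst f); [exact: cvg_fst|exact: cf].
have csnd (f : R -> R) : continuous f -> continuous (fun p : R * R => f p.2 : R).
  by move=> cf p; apply: (cvg_comp snd f); [exact: cvg_snd|exact: cf].
have cF : continuous F.
  move=> p; have cd i : {for p, continuous (fun p : R * R => cw D p.1 i - cw D p.2 i : R)}.
    apply: cvgB; [apply: (cfst (fun t => cw D t i))|apply: (csnd (fun t => cw D t i))];
    exact: cw_cont.
  apply: cvgD; first exact: continuous_dotv.
  have cz' : {for p, continuous (fun p : R * R => cz D p.1 - cz D p.2 : R)}.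
    by apply: cvgB; [apply: cfst|apply: csnd]; exact: cz_cont.
  apply: (@continuous_fcomp R _ p (fun y => y ^+ 2)) cz'; exact: exprn_continuous.
have cA : compact A.
  apply: compact_closedI; first by apply: compact_setX; exact: segment_compact.
  apply: (@closed_comp _ _ (fun p : R * R => `|p.1 - p.2|) [set y | dl <= y]); last exact: closed_ge.
  by move=> p _; apply: cvg_norm; apply: cvgB; [exact: cvg_fst|exact: cvg_snd].
(* If dl exceeds L there are no such pairs, and any positive rho will do. *)
have [A0|/set0P[p0 Ap0]] := eqVneq A set0.
  exists 1 => // t t' tI t'I dt; exfalso.
  by have : A (t, t') by []; rewrite A0.
have [[c c'] cA' cmin] := compact_EVT_min (ex_intro _ p0 Ap0) cA (continuous_subspaceT cF).
exists (F (c, c')); last first.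
  by move=> t t' tI t'I dt; apply: (cmin (t, t')); rewrite inE.
move: cA'; rewrite inE => -[[/= cI c'I]] dc.
have F0 : 0 <= F (c, c') by rewrite addr_ge0 ?dotvv_ge0 ?sqr_ge0.
rewrite lt_neqAle F0 andbT eq_sym; apply/eqP => /eqP.
rewrite paddr_eq0 ?dotvv_ge0 ?sqr_ge0// => /andP[/eqP E1]; rewrite sqrf_eq0 subr_eq0 => /eqP E2.
have : c = c'.
  apply: inj => //; apply/funext => i; apply/eqP; rewrite -subr_eq0.
  have : `|cw D c i - cw D c' i| <= 0.
    apply: (@coord_le_norm R _ (fun i => cw D c i - cw D c' i)) => //.
    by rewrite E1 expr0n.
  by rewrite normr_le0.
by move=> cc; move: dc; rewrite cc subrr normr0 leNgt dl0.
Qed.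

Variables (e : R).
Hypotheses (e0 : 0 < e) (He : forall t x, dotv x x < e ^+ 2 ->
  [/\ 1 < 2 - dotv (Jv (ck D t)) x, `|tau (ck D t) x| <= 1,
      0 < csg D * dphi D t x & 0 <= pden (ck D t) x]).

(** Slices at close times are disjoint because phi is strictly monotone in t between them. Slices at
    distant times are disjoint because a common point would put two separated points of the curve
    within O(r) of each other. *)
Lemma slices_disjoint : exists dl eps : R, [/\ 0 < dl, 0 < eps <= e / 4,
  forall t t', t \in `[0, L] -> t' \in `[0, L] -> `|t - t'| <= dl ->
    dotv (fun i => cw D t i - cw D t' i) (fun i => cw D t i - cw D t' i) <= (e / 4) ^+ 2 &
  forall r t t' W, 0 < r < eps -> t \in `[0, L] -> t' \in `[0, L] ->
    len2 (ck D t) (disp D t W) < r ^+ 2 -> len2 (ck D t') (disp D t' W) < r ^+ 2 ->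
    phi D t W = phi D t' W -> t = t'].
Proof.
have e40 : 0 < e / 4 by rewrite divr_gt0.
have [dl dl0 Hdl] := cw_small e40.
have [rho rho0 Hrho] := separated dl0.
have [B B0 HB] : exists2 B : R, 0 <= B & forall t i, t \in `[0, L] -> `|cw D t i| <= B.
  pose f t := \sum_i `|cw D t i|.
  have cf : {within `[0, L], continuous f}.
    apply: continuous_subspaceT => t; apply: cvg_big => [|i _]; first exact: add_continuous.
    by apply: cvg_norm; exact: cw_cont.
  have [c _ H] := EVT_max (ltW L0) cf.
  exists (f c); first exact: sumr_ge0.
  by move=> t i /H; apply: le_trans; rewrite /f (bigD1 i)//= lerDl sumr_ge0.
(* A point of a slice differs in height from its base point by at most n B r / 2 + r = C r / 2, so
   two base points sharing it differ in height by at most C r. *)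
pose C : R := n%:R * B + 2; have C0 : 0 <= C by rewrite addr_ge0// mulr_ge0.
(* Q r ^+ 2 bounds the squared distance of these base points, with 4 r ^+ 2 for the horizontal part.
   For r < 1 it is at most Q r, which is less than rho once r < rho / Q. *)
pose Q := 4 + C ^+ 2; have Q0 : 0 < Q by have := sqr_ge0 C; rewrite /Q; lra.
pose eps := Num.min (e / 4) (Num.min 1 (rho / Q)).
have rQ0 : 0 < rho / Q by exact: divr_gt0.
exists dl, eps; split => //.
  by rewrite /eps !lt_min e40 ltr01 rQ0/= ge_min lexx.
move=> r t t' W /andP[r0]; rewrite !lt_min => /and3P[re r1 rQ] tI t'I lt lt' pp.
have re2 : r ^+ 2 <= (e / 4) ^+ 2 by rewrite ler_pXn2r ?nnegrE ?ltW.
have re3 : r ^+ 2 <= e ^+ 2.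
  by apply: (le_trans re2); rewrite ler_pXn2r ?nnegrE ?ltW//; have := e0; lra.
wlog tt' : t t' tI t'I lt lt' pp / t <= t' => [H|].
  have [/H|/ltW /H tt'] := leP t t'; first exact.
  by apply: esym; apply: tt'.
have [tdl|tdl] := leP `|t - t'| dl.
  have t0 : 0 <= t by move: tI; rewrite in_itv/= => /andP[].
  have t'L : t' <= L by move: t'I; rewrite in_itv/= => /andP[].
  have sub s : s \in `[t, t'] -> s \in `[0, L].
    rewrite !in_itv/= => /andP[ts st']; by rewrite (le_trans t0 ts) (le_trans st' t'L).
  have wsm s s' : s \in `[t, t'] -> s' \in `[t, t'] ->
      dotv (fun i => cw D s i - cw D s' i) (fun i => cw D s i - cw D s' i) <= (e / 4) ^+ 2.
    move=> sI s'I; apply: Hdl; [exact: sub|exact: sub|].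
    move: sI s'I tdl; rewrite !in_itv/= !ler_norml => /andP[? ?] /andP[? ?] /andP[? ?].
    by apply/andP; split; lra.
  have tin : t \in `[t, t'] by rewrite in_itv/= lexx.
  have t'in : t' \in `[t, t'] by rewrite in_itv/= lexx andbT.
  have gW : good D e t W.
    exact: (small_good e0 tt' wsm tin (len2_small re2 lt)).
  exact: (good_inj e0 He t0 tt' t'L wsm gW tin t'in pp).
have := Hrho t t' tI t'I (ltW tdl).
set S := _ + _; rewrite leNgt => /negP[].
pose x := disp D t W; pose x' := disp D t' W.
have xr : dotv x x < r ^+ 2 by exact: le_lt_trans (sqnorm_le_len2 _ _) lt.
have xr' : dotv x' x' < r ^+ 2 by exact: le_lt_trans (sqnorm_le_len2 _ _) lt'.
have S1 : dotv (fun i => cw D t i - cw D t' i) (fun i => cw D t i - cw D t' i) <= 4 * r ^+ 2.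
  have E : (fun i => cw D t i - cw D t' i) = (fun i => x' i + - x i).
    by apply/funext => i; rewrite /x /x' /disp; ring.
  rewrite E; apply: le_trans (sqnormD_le _ _) _.
  have -> : dotv (fun i => - x i) (fun i => - x i) = dotv x x.
    by apply: eq_bigr => i _; rewrite mulrNN.
  by lra.
have part s y : s \in `[0, L] -> y = disp D s W -> dotv y y < r ^+ 2 ->
    `|dotv (Jv (cw D s)) W / 2 + height (ck D s) y| <= C / 2 * r.
  move=> sI yE yr.
  have -> : dotv (Jv (cw D s)) W = dotv (Jv (cw D s)) y.
    by rewrite yE /disp dotvBr dotv_Jvv subr0.
  have [_ ty _ _] := He s (lt_le_trans yr re3).
  have H1 : `|dotv (Jv (cw D s)) y| <= n%:R * B * r.
    apply: dotv_le (ltW r0) (Jv_le (fun i => HB s i sI)) _.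
    exact: coord_le_norm (ltW r0) (ltW yr).
  have H2 : `|height (ck D s) y| <= r.
    rewrite normrM [`|dotv y y|]ger0_norm ?dotvv_ge0//.
    apply: (@le_trans _ _ (r ^+ 2 * 1)).
      apply: ler_pM => //; [exact: dotvv_ge0|exact: ltW|].
      exact: le_trans (qprof_le ty) ty.
    by rewrite mulr1 expr2 ler_piMr ?ltW.
  apply: (le_trans (ler_normD _ _)); rewrite normrM [`|2^-1|]ger0_norm ?invr_ge0//.
  rewrite /C; have -> : (n%:R * B + 2) / 2 * r = n%:R * B * r / 2 + r by field.
  by apply: lerD => //; rewrite ler_pM2r ?invr_gt0.
have := part t x tI erefl xr; have := part t' x' t'I erefl xr'.
move: pp; rewrite /phi -/x -/x'.
rewrite -!addrA; set P := (_ / 2 + height _ x); set P' := (_ / 2 + height _ x') => pp HP' HP.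
have S2 : `|cz D t - cz D t'| <= C * r.
  have -> : cz D t - cz D t' = P' - P by lra.
  by apply: (le_trans (ler_normB _ _)); lra.
have S3 : (cz D t - cz D t') ^+ 2 <= C ^+ 2 * r ^+ 2.
  rewrite -exprMn -[X in X <= _]ger0_norm ?sqr_ge0// normrX.
  by rewrite ler_pXn2r ?nnegrE ?mulr_ge0// ltW.
have S4 : S <= Q * r ^+ 2 by rewrite /S /Q mulrDl; exact: lerD.
apply: (le_lt_trans S4); apply: (@le_lt_trans _ _ (Q * r)).
  by rewrite ler_pM2l// expr2 ler_piMr ?ltW.
by move: rQ; rewrite ltr_pdivlMr// mulrC.
Qed.

End separation.

(** * Assembly of the short pieces over [0, L] *)

Section tube_volume.
Context {R : realType}.
Local Notation mR := (measurableTypeR R).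
Local Notation lam := (@lebesgue_measure R).
Local Notation mu n := (@lebesgue_tuple R n).

Section unsnoc.
Variable n : nat.

Definition unsnoc (v : (n + 1).-tuple mR) : n.-tuple mR * mR :=
  ([tuple tnth v (lshift 1 i) | i < n], tnth v (rshift n ord0)).

Lemma measurable_unsnoc : measurable_fun setT unsnoc.
Proof.
apply/measurable_fun_pairP; split; last exact: measurable_tnth.
apply/measurable_fun_tnthP => i; rewrite (_ : _ \o _ = (fun v => tnth v (lshift 1 i))); last first.
  by apply/funext => v /=; rewrite tnth_mktuple.
exact: measurable_tnth.
Qed.

Lemma tuple_snocK (W : n.-tuple mR) (z : mR) : unsnoc (tuple_snoc W z) = (W, z).
Proof.
congr (_, _); last exact: tnth_snoc_r.
by apply: eq_from_tnth => i; rewrite tnth_mktuple tnth_snoc_l.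
Qed.

Lemma lebesgue_tuple_unsnoc (B : set (n.-tuple mR * mR)) : measurable B ->
  mu (n + 1) (unsnoc @^-1` B) = (\int[mu n]_W lam [set z | B (W, z)])%E.
Proof.
move=> mB; rewrite lebesgue_tuple_snoc; last exact: measurable_preimage measurable_unsnoc mB.
apply: eq_integral => W _; congr (lam _); apply/seteqP.
by split => z /=; rewrite tuple_snocK.
Qed.

End unsnoc.

Lemma trivIset_steps (dl : R) : 0 < dl ->
  trivIset setT (fun i : nat => `[i%:R * dl, i.+1%:R * dl[%classic : set R).
Proof.
move=> dl0; apply/trivIsetP => i j _ _.
wlog ij : i j / (i < j)%N => [H|].
  by rewrite neq_ltn => /orP[ij|ij]; [|rewrite setIC]; apply: H => //; rewrite neq_ltn ij.
move=> _; apply/seteqP; split => // x []; rewrite /= !in_itv/= => /andP[_ xi] /andP[xj _].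
have le : i.+1%:R * dl <= j%:R * dl by rewrite ler_wpM2r ?ler_nat// ltW.
by have := lt_le_trans xi (le_trans le xj); rewrite ltxx.
Qed.

Lemma bigcup_steps (dl : R) (A : set R) : 0 < dl -> (forall t, A t -> 0 <= t) ->
  \bigcup_i (A `&` `[i%:R * dl, i.+1%:R * dl[%classic) = A.
Proof.
move=> dl0 A0; apply/seteqP; split=> [t [i _ []]//|t At].
have t0 : 0 <= t / dl by apply: divr_ge0; [exact: A0|exact: ltW].
exists (Num.truncn (t / dl)) => //; split=> //.
have := truncn_itv t0; rewrite /= in_itv/= => /andP[].
by rewrite ler_pdivlMr// ltr_pdivrMr// => -> ->.
Qed.

Context {d : nat} {L : R} (D : curve_data d L) (L0 : 0 < L).
Local Notation n := (d + d)%N.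
Hypothesis inj : forall t t', t \in `[0, L] -> t' \in `[0, L] ->
  cw D t = cw D t' -> cz D t = cz D t' -> t = t'.
Variables (e M : R).
Hypotheses (e0 : 0 < e) (He : forall t x, dotv x x < e ^+ 2 ->
  [/\ 1 < 2 - dotv (Jv (ck D t)) x, `|tau (ck D t) x| <= 1,
      0 < csg D * dphi D t x & 0 <= pden (ck D t) x])
  (Hb : forall t x, dotv x x < e ^+ 2 ->
    pden (ck D t) x <= M /\ `|kden (ck D t) (cl D t) x| <= M).

Lemma measurable_slice_integral r : r ^+ 2 <= (e / 4) ^+ 2 ->
  measurable_fun setT (fun t : mR => (\int[mu n]_x (tube_density D r t (tnth x))%:E)%E).
Proof.
move=> re; pose F (p : mR * n.-tuple mR) : \bar R := (tube_density D r p.1 (tnth p.2))%:E.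
apply: (@measurable_fun_fubini_tonelli_F _ _ _ _ _ (mu n) F).
  apply/measurable_EFinP; apply: measurable_fun_tube_density => [|i]; first exact: measurable_fst.
  exact: measurableT_comp (@measurable_tnth_fun R n i) measurable_snd.
by move=> p; rewrite lee_fin (tube_density_ge0 e0 He re).
Qed.

(** The graph argument needs arcs short enough for one set of good points, so [0, L] is cut into
    steps of length dl. Half-open steps are disjoint in time, and disjoint slices then make the
    pieces of the tube disjoint, so volumes add up. *)
Lemma slices_volume : exists2 eps : R, 0 < eps <= e / 4 & forall r, 0 < r < eps ->
  mu (n + 1) (@unsnoc n @^-1` tube_piece D r `[0, L]%classic) =
  (\int[lam]_(t in `[0%R, L]) ((`|cv D t|)%:E * slice_mass r (ck D t)))%E.
Proof.
have [dl [eps [dl0 /andP[eps0 epse] wsm disj]]] := slices_disjoint L0 inj e0 He.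
exists eps; first by rewrite eps0.
move=> r rb; have /andP[r0 re] := rb.
have re2 : r ^+ 2 <= (e / 4) ^+ 2.
  have ree := lt_le_trans re epse.
  by rewrite ler_pXn2r ?nnegrE ?(ltW r0) ?(ltW ree)// (ltW (lt_trans r0 ree)).
rewrite -(integral_tube_density (ltW L0) e0 He Hb re2).
pose step (i : nat) : set mR := `[i%:R * dl, i.+1%:R * dl[%classic.
pose J i : set mR := `[0, L]%classic `&` step i.
have mJ i : measurable (J i) by apply: measurableI; exact: measurable_itv.
have UJ : \bigcup_i J i = `[0, L]%classic.
  by apply: bigcup_steps => // t /=; rewrite in_itv/= => /andP[].
have tJ : trivIset setT J by apply: trivIset_setIl; exact: trivIset_steps.
(* Clipping at L keeps a <= b <= L for the infinitely many steps beyond L as well, where the piece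
   is empty. *)
pose a i := Num.min L (i%:R * dl); pose b i := Num.min L (i.+1%:R * dl).
have idl i : 0 <= i%:R * dl by apply: mulr_ge0; [exact: ler0n|exact: ltW].
have a0 i : 0 <= a i by rewrite le_min idl ltW.
have bL i : b i <= L by rewrite ge_min lexx.
have ab i : a i <= b i.
  by rewrite le_min ge_min lexx/= ge_min ler_wpM2r ?orbT ?ler_nat// ltW.
have baE i : b i - a i <= dl.
  rewrite /a /b; have : i.+1%:R * dl = i%:R * dl + dl by rewrite -natr1 mulrDl mul1r.
  by move=> ->; case: (leP L (i%:R * dl)) => ?; case: (leP L (_ + dl)) => ?; lra.
have w_small i t t' : t \in `[a i, b i] -> t' \in `[a i, b i] ->
    dotv (fun i => cw D t i - cw D t' i) (fun i => cw D t i - cw D t' i) <= (e / 4) ^+ 2.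
  have := a0 i; have := bL i; have := baE i.
  rewrite !in_itv/= => ? ? ? /andP[? ?] /andP[? ?].
  by apply: wsm; rewrite ?in_itv/=; try (apply/andP; split; lra); rewrite ler_norml; apply/andP; split; lra.
have Jab i : J i `<=` `[a i, b i]%classic.
  move=> t []; rewrite /step /= !in_itv/= => /andP[_ tL] /andP[ti ti'].
  by rewrite ge_min ti orbT le_min tL ltW.
have mP i := measurable_tube_piece e0 He re2 (a0 i) (ab i) (bL i) (@w_small i) (mJ i) (@Jab i).
have tP : trivIset setT (fun i => @unsnoc n @^-1` tube_piece D r (J i)).
  apply/trivIsetP => i j _ _ ij; apply/seteqP; split => // v /= [].
  move=> [t Jt [lt pt]] [t' Jt' [lt' pt']].
  have tt' : t = t'.
    apply: (disj r t t' (tnth (unsnoc v).1) rb _ _ lt lt'); last by rewrite -pt -pt'.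
    - by case: Jt.
    - by case: Jt'.
  have /trivIsetP/(_ i j I I ij) := tJ.
  by move=> /seteqP[+ _] => /(_ t); apply; split=> //; rewrite tt'.
have -> : @unsnoc n @^-1` tube_piece D r `[0, L]%classic =
    \bigcup_i (@unsnoc n @^-1` tube_piece D r (J i)).
  apply/seteqP; split=> [v [t tI H]|v [i _ [t [tI _] H]]]; last by exists t.
  by move: tI; rewrite -UJ => -[i _ Jt]; exists i => //; exists t.
rewrite measure_bigcup//; last first.
  by move=> i _; exact: measurable_preimage (@measurable_unsnoc n) (mP i).
rewrite -[in RHS]UJ ge0_integral_bigcup//; last first.
- by move=> t _; apply: integral_ge0 => x _; rewrite lee_fin (tube_density_ge0 e0 He re2).
- by apply: measurable_funS (measurable_slice_integral re2).
rewrite (@eq_eseriesl _ _ predT) => [|i]; last by rewrite in_setT.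
apply: eq_eseriesr => i _.
apply: etrans (lebesgue_tuple_unsnoc (mP i)) _.
exact: (tube_piece_volume e0 He re2 (a0 i) (ab i) (bL i) (@w_small i) (mJ i) (@Jab i)).
Qed.

End tube_volume.

Lemma tube_volumeE (R : realType) (d : nat) (L : R) (g : R -> heis R d)
    (I := [set t : R | 0 <= t <= L]) (T := curve_tangent I g) :
  0 < L -> C2_on I g -> embedded_on I g -> non_characteristic (g @` I) T ->
  (forall t, I t -> normR (g t) (deriv_on I g t) = 1) ->
  exists D : curve_data d L, [/\
    forall t, cv D t ^+ 2 * dotv (ck D t) (ck D t) = 1 - cv D t ^+ 2,
    forall t, I t -> reeb_angle T (g t) = `|cv D t| &
    exists2 eps : R, 0 < eps & forall r, 0 < r < eps ->
      volume (tube (g @` I) T r) = (\int[@lebesgue_measure R]_(t in `[0%R, L])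
        ((`|cv D t|)%:E * slice_mass r (ck D t)))%E].
Proof.
move=> L0 gC2 gemb gnc gunit.
have [D [[gw gz Gk Gv] kE angle]] := curve_data_exists L0 gC2 gemb gnc gunit.
have IE t : (t \in `[0, L]) = (0 <= t <= L) by rewrite in_itv.
exists D; split; [exact: kE|by move=> t It; apply: angle; rewrite IE|].
have inj t t' : t \in `[0, L] -> t' \in `[0, L] ->
    cw D t = cw D t' -> cz D t = cz D t' -> t = t'.
  move=> tI t'I wE zE; case: gemb => ginj _ _; apply: ginj; rewrite ?inE /I /= -?IE//.
  by apply: hcoord_inj; rewrite ?gw// ?gz.
have [e [M [e0 He Hb Hc]]] := uniform_radius D.
have [eps /andP[eps0 epse] V] := slices_volume L0 inj e0 He Hb.
exists eps => // r rb; rewrite -(V r rb) /volume; congr (lebesgue_tuple _ _).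
have /andP[r0 re] := rb; have ree := lt_le_trans re epse.
have re2 : r ^+ 2 <= (e / 4) ^+ 2.
  by rewrite ler_pXn2r ?nnegrE ?(ltW r0) ?(ltW ree)// (ltW (lt_trans r0 ree)).
have TG t : t \in `[0, L] -> T (g t) = [set W | exists c : R, W = c *: deriv_on I g t].
  by rewrite IE => It; exact: curve_tangentE.
have tP := tubeP gw gz Gk Gv TG e0 r0 re2 He Hc.
have hE v : hcoord (heis_of_tuple v) = tnth (unsnoc v).1.
  apply/funext => i; rewrite tnth_mktuple.
  by case: (split_ordP i) => j ->; rewrite ?hcoord_l ?hcoord_r /= mxE.
apply/seteqP; split => v.
  by move=> /tP[t tI]; rewrite hE => H; exists t.
by move=> [t tI H]; apply/tP; exists t => //; rewrite hE.
Qed.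

Theorem theorem1p18 (R : realType) (d : nat) (L : R) (g g' : R -> heis R d)
  (I := [set t : R | 0 <= t <= L])
  (Gamma := g @` I) (Gamma' := g' @` I)
  (T := curve_tangent I g) (T' := curve_tangent I g')
  (L_gt0 : 0 < L)
  (g_C2 : C2_on I g) (g'_C2 : C2_on I g')
  (g_emb : embedded_on I g) (g'_emb : embedded_on I g')
  (g_nonchar : non_characteristic Gamma T)
  (g'_nonchar : non_characteristic Gamma' T')
  (g_unit : forall t, I t -> normR (g t) (deriv_on I g t) = 1)
  (g'_unit : forall t, I t -> normR (g' t) (deriv_on I g' t) = 1)
  (same_angle : forall t, I t -> reeb_angle T (g t) = reeb_angle T' (g' t)) :
  exists2 eps : R, 0 < eps &
    forall r : R, 0 <= r < eps ->
      volume (tube Gamma T r) = volume (tube Gamma' T' r).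
Proof.
have [D [kE angle [eps eps0 V]]] := tube_volumeE L_gt0 g_C2 g_emb g_nonchar g_unit.
have [D' [kE' angle' [eps' eps'0 V']]] :=
  tube_volumeE L_gt0 g'_C2 g'_emb g'_nonchar g'_unit.
exists (Num.min eps eps'); first by rewrite lt_min eps0.
move=> r /andP[r0]; rewrite lt_min => /andP[re re'].
(* The length condition is strict, so at r = 0 both tubes are empty. *)
have [r00|r00] := eqVneq r 0.
  have tube0 S (U : heis R d -> set (heis R d)) : tube S U r = set0.
    apply/seteqP; split=> // p [l [_ /= H] _]; move: H.
    by rewrite r00 ltNge sqrtr_ge0.
  by rewrite !tube0.
have rp : 0 < r by rewrite lt_neqAle eq_sym r00.
have rb : 0 < r < eps by rewrite rp.
have rb' : 0 < r < eps' by rewrite rp.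
apply: etrans (V r rb) (etrans _ (esym (V' r rb'))).
apply: eq_integral => t tI.
have It : I t by move: tI; rewrite inE /= in_itv.
have vv : `|cv D t| = `|cv D' t|.
  exact: etrans (esym (angle t It)) (etrans (same_angle t It) (angle' t It)).
have v2 : cv D t ^+ 2 = cv D' t ^+ 2.
  by rewrite -[LHS]ger0_norm ?sqr_ge0// -[RHS]ger0_norm ?sqr_ge0// !normrX vv.
have v0 : cv D t ^+ 2 != 0.
  rewrite sqrf_eq0; apply/eqP => v0; have := cv_ge D t.
  by rewrite v0 mulr0 leNgt cv0_gt0.
(* Unit speed gives v ^+ 2 |k| ^+ 2 = 1 - v ^+ 2, and v ^+ 2 is nonzero, so equal angles force equal
   norms of k. *)
have kk : dotv (ck D t) (ck D t) = dotv (ck D' t) (ck D' t).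
  by apply: (mulfI v0); rewrite kE v2 kE'.
by rewrite vv (slice_mass_norm r kk).
Qed.
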